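(* Let $\alpha=\alpha_{-1}\approx 2.32472$ be the real root of $t^3-3t^2+2t-1$, let $\beta=\alpha/(\alpha-1)$, and let $$\Xi:=\{u_1\psi(\alpha-\beta)+u_2\psi(\alpha-\beta^2): u_1,u_2\in\mathbb{Z}\}.$$ Then $$\dim_H(\partial\mathcal{F}_\alpha)=\frac{2\log(\mu)}{\log(\beta)}\approx 1.70018,$$ where $\mu\approx 1.61299$ is the dominant root of $t^{10}-t^7-4t^5-4t^4-t^3-4t^2-4t+1$, and the collection $\{x+\mathcal{F}_\alpha: x\in\Xi\}\cup\{x+(\psi(\alpha)-\mathcal{F}_\alpha): x\in\Xi\}$ is a proper tiling of $\mathbb{K}_\alpha=\mathbb{C}$.
   Context: Fix a non-real Galois conjugate $\alpha'$ of $\alpha$ and let $\psi:\mathbb{Q}(\alpha)\to\mathbb{C}$ be the field embedding with $\psi(\alpha)=\alpha'$. Both $\alpha$ and $\beta$ are Pisot units, so $f_L(x)=\psi(\alpha)x$ and $f_R(x)=\psi(\beta)(\psi(1)-x)$ are contractions of $\mathbb{C}$. The tent-tile $\mathcal{F}_\alpha$ is the unique non-empty compact set $\mathcal{F}_\alpha\subset\mathbb{C}$ with $\mathcal{F}_\alpha=f_L(\mathcal{F}_\alpha)\cup f_R(\mathcal{F}_\alpha)$. For a set $F$, $c-F=\{c-y:y\in F\}$. $\dim_H$ denotes Hausdorff dimension and $\partial$ the topological boundary. The dominant root of a polynomial is its root of largest modulus. A collection $\{Y_i:i\in I\}$ of compact subsets of a Euclidean space $\mathbb{E}$ is a (proper)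 tiling of $\mathbb{E}$ if (1) $\bigcup_{i\in I}Y_i=\mathbb{E}$; (2) for each compact $Y\subset\mathbb{E}$ the set $\{i\in I:Y\cap Y_i\neq\emptyset\}$ is finite; (3) for Lebesgue-almost every $x\in\mathbb{E}$ the set $\{i\in I:x\in Y_i\}$ has exactly one element. *)

(* Defs.v *)
From HB Require Import structures.
From mathcomp Require Import all_boot all_order all_algebra.
From mathcomp Require Import complex.
From mathcomp Require Import all_classical all_reals all_analysis.

Set Implicit Arguments.
Unset Strict Implicit.
Unset Printing Implicit Defensive.

Import Order.TTheory GRing.Theory Num.Theory.
Import numFieldNormedType.Exports.

Local Open Scope classical_set_scope.
Local Open Scope ring_scope.
Local Open Scope complex_scope.

(* The usual topology of the complex plane: that of the norm of the field R[i],
   which the library attaches only to the alias R[i]^o. *)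
HB.instance Definition _ (R : rcfType) := NormedModule.copy R[i] R[i]^o.

Definition boundary (T : topologicalType) (A : set T) : set T :=
  closure A `\` interior A.

Section HausdorffDimension.
Variable R : realType.
Implicit Types (U E : set R[i]) (s delta : R).
Local Open Scope ereal_scope.

(* Equals -oo when U is empty. *)
Definition diam U : \bar R :=
  ereal_sup [set (Normc.normc (p.1 - p.2)%R)%:E | p in U `*` U].

(* The empty set is separated out so that it costs nothing even for s = 0. *)
Definition hausdorff_gauge s U : \bar R :=
  if U == set0 then 0 else diam U `^ s.

Definition hausdorff_premeasure s delta E : \bar R :=
  ereal_inf [set \sum_(0 <= n <oo) hausdorff_gauge s (U n) |
    U in [set U : (set R[i])^nat |
      E `<=` \bigcup_n U n /\ forall n, diam (U n) <= delta%:E]].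

Definition hausdorff_measure s E : \bar R :=
  ereal_sup [set hausdorff_premeasure s delta E |
    delta in [set delta : R | (0 < delta)%R]].

Definition hausdorff_dim E : \bar R :=
  ereal_inf [set s%:E | s in [set s : R | (0 <= s)%R /\ hausdorff_measure s E = 0]].

End HausdorffDimension.

(* Lebesgue-almost everywhere in the plane; R[i] carries no measure in the
   library, so it is identified with R * R through real and imaginary parts. *)
Definition ae_complex (R : realType) (P : R[i] -> Prop) : Prop :=
  {ae ((@lebesgue_measure R) \x (@lebesgue_measure R))%E,
    forall p : R * R, P (p.1 +i* p.2)}.

Definition proper_tiling (R : realType) (I : Type) (D : set I)
    (Y : I -> set R[i]) : Prop :=
  [/\ forall i, D i -> compact (Y i),
      \bigcup_(i in D) Y i = setT,
      forall K : set R[i], compact K ->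
        finite_set [set i | D i /\ K `&` Y i !=set0]
    & ae_complex (fun x => exists! i, D i /\ Y i x)].

(* The subfield Q(a) of R. *)
Definition Qadjoin (R : realType) (a : R) : set R :=
  smallest [set S : set R | divring_closed (mem S)] [set a].

Definition field_embedding (R : realType) (K : set R) (psi : R -> R[i]) : Prop :=
  [/\ psi 1 = 1,
      {in K &, {morph psi : x y / x + y}}
    & {in K &, {morph psi : x y / x * y}}].

Definition galois_conjugate (R : realType) (a : R) (a' : R[i]) : Prop :=
  exists m : {poly rat},
    [/\ m \is monic, irreducible_poly m,
        root (map_poly ratr m) a & root (map_poly ratr m) a'].

Definition dominant_root (K : numDomainType) (p : {poly K}) (z : K) : Prop :=
  root p z /\ forall w, root p w -> w != z -> `|w| < `|z|.

(* Correct to five decimal places: |x - y| <= 10^-5 / 2. *)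
Definition approx5 (R : realType) (x y : R) : Prop :=
  `|x - y| <= (2 * 10 ^+ 5)^-1.

Definition alpha_poly (A : nzRingType) : {poly A} :=
  'X^3 - 3 *: 'X^2 + 2 *: 'X - 1.

Definition mu_poly (A : nzRingType) : {poly A} :=
  'X^10 - 'X^7 - 4 *: 'X^5 - 4 *: 'X^4 - 'X^3 - 4 *: 'X^2 - 4 *: 'X + 1.

Section TentTile.
Variables (R : realType) (psi : R -> R[i]) (alpha beta : R).

Definition tent_left (x : R[i]) : R[i] := psi alpha * x.
Definition tent_right (x : R[i]) : R[i] := psi beta * (psi 1 - x).

(* The two maps are contractions, so exactly one F satisfies this. *)
Definition is_tent_tile (F : set R[i]) : Prop :=
  [/\ F !=set0, compact F & F = tent_left @` F `|` tent_right @` F].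

Definition Xi : set R[i] :=
  [set u.1%:~R * psi (alpha - beta) + u.2%:~R * psi (alpha - beta ^+ 2) |
    u in [set: int * int]].

(* Index (x, true) stands for x + F and (x, false) for x + (psi alpha - F). *)
Definition tent_tiles (F : set R[i]) (i : R[i] * bool) : set R[i] :=
  if i.2 then [set i.1 + y | y in F]
  else [set i.1 + z | z in [set psi alpha - y | y in F]].

End TentTile.

(* Main.v *)
(** Let rho be the plastic number, rho ^ 3 = rho + 1, and lam the given conjugate
    of rho; then alpha = rho ^ 3, beta = rho ^ 2 and F is the union of lam ^ 3 F
    and lam ^ 2 (1 - F), with |lam| ^ 2 = 1 / rho.

    Covering.  For p = a + b lam + c lam ^ 2 put tr p = a + c.  The tiles are the
    p + F with tr p = 0 and the p - F with tr p = 1.  Subdividing them, one meets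
    at scale lam ^ n exactly the p + lam ^ n F with - tr (lam ^ n) < tr p <= 0 and
    the p - lam ^ n F with 1 <= tr p <= tr (lam ^ n).  Such p are
    O(|lam| ^ n)-dense, so the union of the tiles, being closed, is the plane.

    Overlaps.  The intersection of F with e lam ^ k F + d splits into two sets of
    the same kind, and only finitely many d in Z[lam] occur.  Eliminating states
    from this finite graph shows that every overlap consists, up to points, of
    copies of the core, the intersection of F and lam ^ 2 F, which is itself
    covered by five copies of itself scaled by lam ^ n for n = 3, 7, 9, 9, 10, and
    points.  Hence its s-dimensional content vanishes as soon as
    x ^ 3 + x ^ 7 + 2 x ^ 9 + x ^ 10 < 1 for x = |lam| ^ s.  For s = 2 this says
    that distinct tiles overlap in Lebesgue null sets.  Equality holds for
    x = 1 / theta with theta ^ 10 = theta ^ 7 + theta ^ 3 + 2 theta + 1, and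
    squaring (theta ^ 10 - 1) = theta (theta ^ 6 + theta ^ 2 + 2) exhibits
    mu = theta ^ 2 as a root of the polynomial of degree 10.

    Lower bound.  The images of the core under distinct words in the five maps are
    intersections of distinct pairs of subtiles of F and lam ^ 2 F, as is seen by
    ping-pong on the real conjugates of the maps.  Their anchors are lattice
    points, so boundedly many images of size about r meet a disc of radius r, and
    the uniform mass on words bounds the content of the core from below. *)
Require Import Defs.
From Stdlib Require Import ZArith.
From mathcomp Require Import all_boot all_order all_algebra.
From mathcomp Require Import complex.
From mathcomp Require Import all_classical all_reals all_analysis.
From mathcomp Require Import ring lra zify ssrZ.
Set Implicit Arguments.
Unset Strict Implicit.
Unset Printing Implicit Defensive.
Import Order.TTheory GRing.Theory Num.Theory.
Import numFieldNormedType.Exports.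
Local Open Scope classical_set_scope.
Local Open Scope ring_scope.
Local Open Scope complex_scope.
Delimit Scope Z_scope with Z.

(** * The topology of the complex plane *)

Notation nrm := Normc.normc.

Lemma normC_nrm (R : rcfType) (z : R[i]) : `|z| = (nrm z)%:C.
Proof. by case: z. Qed.

Lemma nrm_ge0 (R : rcfType) (z : R[i]) : 0 <= nrm z.
Proof. by case: z => a b; exact: sqrtr_ge0. Qed.

Lemma nrm_sqr (R : rcfType) (z : R[i]) : nrm z ^+ 2 = complex.Re z ^+ 2 + complex.Im z ^+ 2.
Proof. by case: z => a b /=; rewrite sqr_sqrtr// addr_ge0// sqr_ge0. Qed.

Lemma nrm_natpow (R : rcfType) (z : R[i]) n : nrm (z ^+ n) = nrm z ^+ n.
Proof.
elim: n => [|n IH]; first by rewrite !expr0 Normc.normc1.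
by rewrite !exprS Normc.normcM IH.
Qed.

Lemma nrm_sub (R : rcfType) (z w : R[i]) : nrm (z - w) = nrm (w - z).
Proof. by rewrite -normcN opprB. Qed.

Lemma nrm_triangle (R : rcfType) (x y z : R[i]) : nrm (x - z) <= nrm (x - y) + nrm (y - z).
Proof. by rewrite (_ : x - z = (x - y) + (y - z)); [exact: le_normcD | rewrite addrA subrK]. Qed.

Lemma nrm_real (R : rcfType) (x : R) : nrm x%:C = `|x|.
Proof. by rewrite /= expr0n addr0 sqrtr_sqr. Qed.

Lemma nrm_half (R : rcfType) (z : R[i]) : nrm (z / 2) = nrm z / 2.
Proof.
rewrite Normc.normcM (_ : (2^-1 : R[i]) = (2^-1)%:C) ?nrm_real ?ger0_norm ?invr_ge0//.
by rewrite fmorphV rmorph_nat.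
Qed.

Lemma nrm_Re (R : rcfType) (z : R[i]) : `|complex.Re z| <= nrm z.
Proof. by case: z => a b /=; rewrite -sqrtr_sqr ler_wsqrtr// lerDl sqr_ge0. Qed.

Lemma nrm_Im (R : rcfType) (z : R[i]) : `|complex.Im z| <= nrm z.
Proof. by case: z => a b /=; rewrite -sqrtr_sqr ler_wsqrtr// lerDr sqr_ge0. Qed.

Section ComplexTopology.
Variable R : realType.
Implicit Types (z w : R[i]) (A : set R[i]) (r : R).

Lemma nbhs_discP z A :
  nbhs z A <-> exists2 r, 0 < r & forall w, nrm (w - z) < r -> A w.
Proof.
split.
  move/nbhs_ballP => [e /= e0 H].
  (* The order of [R[i]] compares only numbers with equal imaginary parts, so a positive radius is
     real. *)
  have [e1 he] : exists e1 : R, e = e1%:C.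
    move: e0; rewrite ltcE => /andP[/eqP h _]; exists (complex.Re e).
    by case: e h {H} => a b /= ->.
  subst e; exists e1; first by move: e0; rewrite ltcR.
  by move=> w hw; apply: H; rewrite -ball_normE /= normC_nrm ltcR nrm_sub.
move=> [r r0 H]; apply/nbhs_ballP; exists r%:C => /=; first by rewrite ltcR.
by move=> w; rewrite -ball_normE /= normC_nrm ltcR nrm_sub => /H.
Qed.

Lemma open_disc z r : open [set w | nrm (w - z) < r].
Proof.
rewrite openE => w /= hw; apply/nbhs_discP; exists (r - nrm (w - z)); first by rewrite subr_gt0.
move=> v hv; apply: le_lt_trans (nrm_triangle v w z) _; lra.
Qed.

Lemma closed_discP A : closed A <->
  forall z, (forall r, 0 < r -> exists2 w, A w & nrm (w - z) < r) -> A z.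
Proof.
split=> [cA z H|H].
  apply: cA => B /nbhs_discP [r r0 hB]; have [w Aw hw] := H r r0.
  by exists w; split => //; exact: hB.
move=> z cz; apply: H => r r0.
have /cz [w [Aw hw]] : nbhs z [set w | nrm (w - z) < r] by apply/nbhs_discP; exists r.
by exists w.
Qed.

Lemma hausC : hausdorff_space R[i].
Proof. exact: norm_hausdorff. Qed.

Lemma finite_disc_cover A (c : nat -> R[i]) (r : nat -> R) :
  compact A -> (forall z, A z -> exists n, nrm (z - c n) < r n) ->
  exists N, forall z, A z -> exists2 n, (n < N)%N & nrm (z - c n) < r n.
Proof.
rewrite compact_cover => cA H.
have [|z Az|D _ HD] := cA nat setT (fun n => [set z | nrm (z - c n) < r n]).
- by move=> n _; exact: open_disc.
- by have [n hn] := H z Az; exists n.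
exists (\max_(n <- finmap.enum_fset D) n).+1 => z /HD [n /= nD hn]; exists n => //.
by rewrite ltnS; apply: (@leq_bigmax_seq _ _ (fun=> true) id).
Qed.

Lemma compactC_bounded A : compact A -> exists M, forall z, A z -> nrm z <= M.
Proof.
move=> cA; have [|N HN] := @finite_disc_cover A (fun=> 0) (fun n => n%:R) cA.
  move=> z _; exists (Num.truncn (nrm z)).+1; rewrite subr0; exact: truncnS_gt.
exists N%:R => z /HN [n nN]; rewrite subr0 => /ltW h; apply: le_trans h _.
by rewrite ler_nat ltnW.
Qed.

Lemma compactC_closed A : compact A -> closed A.
Proof. exact: compact_closed hausC. Qed.

End ComplexTopology.

(** * The plastic number and its conjugate *)

(* (a, b, c) stands for a + b x + c x ^ 2 where x ^ 3 = x + 1. *)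
Definition tri : Type := Z * Z * Z.

Definition tadd (p p' : tri) : tri :=
  let: (a, b, c) := p in let: (a', b', c') := p' in (a + a', b + b', c + c')%Z.
Definition topp (p : tri) : tri := let: (a, b, c) := p in (- a, - b, - c)%Z.
Definition tmulx (p : tri) : tri := let: (a, b, c) := p in (c, a + c, b)%Z.
(** Integral because [1 / x = x ^ 2 - 1]; rescaling by powers of [x] therefore stays within exact
    integer arithmetic. *)
Definition tdivx (p : tri) : tri := let: (a, b, c) := p in (b - a, c, a)%Z.
Definition tsg (e : bool) (p : tri) : tri := if e then p else topp p.

Section Evaluation.
Variable A : comNzRingType.
Implicit Types (x : A) (p : tri).

Definition zr (z : Z) : A := (int_of_Z z)%:~R.

Lemma zrD z z' : zr (z + z')%Z = zr z + zr z'.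
Proof. by rewrite /zr -intrD; congr (_%:~R); lia. Qed.
Lemma zrN z : zr (- z)%Z = - zr z.
Proof. by rewrite /zr -mulrNz; congr (_%:~R); lia. Qed.
Lemma zrB z z' : zr (z - z')%Z = zr z - zr z'.
Proof. by rewrite -Z.add_opp_r zrD zrN. Qed.
Lemma zrM z z' : zr (z * z')%Z = zr z * zr z'.
Proof. by rewrite /zr -intrM; congr (_%:~R); lia. Qed.
Lemma zr0 : zr 0 = 0. Proof. by []. Qed.
Lemma zr1 : zr 1 = 1. Proof. by []. Qed.

Definition zrE := (zrD, zrN, zrB, zrM, zr0, zr1).

Definition sg (e : bool) : A := if e then 1 else -1.

Lemma sgK e : sg e * sg e = 1.
Proof. by case: e; rewrite /sg ?mulr1// mulrNN mulr1. Qed.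

Definition ev x p : A :=
  let: (a, b, c) := p in zr a + zr b * x + zr c * x ^+ 2.

Lemma ev_add x p p' : ev x (tadd p p') = ev x p + ev x p'.
Proof. case: p p' => [[a b] c] [[a' b'] c']; rewrite /= !zrE; ring. Qed.

Lemma ev_opp x p : ev x (topp p) = - ev x p.
Proof. case: p => [[a b] c]; rewrite /= !zrE; ring. Qed.

Lemma ev_sg x e p : ev x (tsg e p) = sg e * ev x p.
Proof. by case: e; rewrite /tsg /sg ?mul1r// ev_opp mulN1r. Qed.

Lemma ev_mulx x p : x ^+ 3 = x + 1 -> ev x (tmulx p) = x * ev x p.
Proof.
case: p => [[a b] c] x3; rewrite /= !zrE.
rewrite (_ : x * _ = zr a * x + zr b * x ^+ 2 + zr c * x ^+ 3); last by ring.
rewrite x3; ring.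
Qed.

Lemma tdivxK p : tmulx (tdivx p) = p.
Proof. by case: p => [[a b] c] /=; congr (_, _, _); lia. Qed.

Lemma ev_divx x p : x ^+ 3 = x + 1 -> x * ev x (tdivx p) = ev x p.
Proof. by move=> x3; rewrite -ev_mulx// tdivxK. Qed.

Lemma ev_iter_divx x n p : x ^+ 3 = x + 1 -> x ^+ n * ev x (iter n tdivx p) = ev x p.
Proof.
move=> x3; elim: n p => [|n IH] p; first by rewrite expr0 mul1r.
by rewrite exprSr -mulrA iterS ev_divx// IH.
Qed.

Lemma ev_iter_mulx x n p : x ^+ 3 = x + 1 -> ev x (iter n tmulx p) = x ^+ n * ev x p.
Proof.
move=> x3; elim: n p => [|n IH] p; first by rewrite expr0 mul1r.
by rewrite exprS -mulrA -IH -ev_mulx.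
Qed.

End Evaluation.
Arguments sg {A} e.

Section PlasticNumber.
Variables (R : realType) (rho q : R).
Hypothesis rho3 : rho ^+ 3 = rho + 1.
Hypothesis q2 : q ^+ 2 = 3 / 4 * rho ^+ 2 - 1.

Lemma rho_quad_ge0 c : 6 / 5 <= c -> 0 <= rho ^+ 2 + rho * c + c ^+ 2 - 1.
Proof.
move=> c1; have := sqr_ge0 (rho + c / 2).
have : 36 / 25 <= c ^+ 2 by nra.
rewrite (_ : (_ + _) ^+ 2 = rho ^+ 2 + rho * c + c ^+ 2 / 4); [lra | by field].
Qed.

(** For [c >= 6 / 5] the quadratic factor is nonnegative, so the sign of [c + 1 - c ^ 3] tells on
    which side of [c] the number [rho] lies. Decimal bounds on [rho] thus become rational
    evaluations. *)
Lemma rho_factor c :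
  (rho - c) * (rho ^+ 2 + rho * c + c ^+ 2 - 1) = c + 1 - c ^+ 3.
Proof.
by transitivity (rho ^+ 3 - rho - 1 - (c ^+ 3 - c - 1)); [ring | rewrite rho3; ring].
Qed.

Lemma rho_lt c : 6 / 5 <= c -> c + 1 < c ^+ 3 -> rho < c.
Proof.
move=> c1 hc; rewrite ltNge; apply/negP => h; have := rho_factor c.
have : 0 <= (rho - c) * (rho ^+ 2 + rho * c + c ^+ 2 - 1).
  by rewrite mulr_ge0 ?rho_quad_ge0 ?subr_ge0.
lra.
Qed.

Lemma rho_gt c : 6 / 5 <= c -> c ^+ 3 < c + 1 -> c < rho.
Proof.
move=> c1 hc; rewrite ltNge; apply/negP => h; have := rho_factor c.
have : (rho - c) * (rho ^+ 2 + rho * c + c ^+ 2 - 1) <= 0.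
  by rewrite mulr_le0_ge0 ?rho_quad_ge0 ?subr_le0.
lra.
Qed.

Lemma rho_bounds : 1 + 324 / 10 ^+ 3 + 717 / 10 ^+ 6 < rho < 1 + 324 / 10 ^+ 3 + 718 / 10 ^+ 6.
Proof. by apply/andP; split; [apply: rho_gt|apply: rho_lt]; lra. Qed.

Lemma rho_gt1 : 1 < rho. Proof. have /andP[] := rho_bounds; lra. Qed.
Lemma rho_gt0 : 0 < rho. Proof. have := rho_gt1; lra. Qed.

Lemma rhoV : rho^-1 = rho ^+ 2 - 1.
Proof.
have h := rho_gt0; apply: (mulfI (lt0r_neq0 h)).
rewrite divff ?lt0r_neq0// mulrBr mulr1 -exprS rho3; ring.
Qed.

(** A root of [x ^ 2 + rho x + rho ^ 2 - 1], the quotient of [x ^ 3 - x - 1] by [x - rho]. Since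
    [q2] fixes [q] up to sign only, both nonreal conjugates are covered. *)
Definition conj_root : R[i] := (- rho / 2) +i* q.
Notation lam := conj_root.

Lemma lam2E : lam ^+ 2 = (1 - rho ^+ 2 / 2) +i* (- rho * q).
Proof.
rewrite expr2 /conj_root; apply/eqP; rewrite eq_complex /=; apply/andP; split; apply/eqP.
  by transitivity (rho ^+ 2 / 4 - q ^+ 2); [field | rewrite q2; field].
by field.
Qed.

Lemma lam3 : lam ^+ 3 = lam + 1.
Proof.
rewrite exprS lam2E /conj_root; apply/eqP; rewrite eq_complex /=; apply/andP; split; apply/eqP.
  transitivity (rho ^+ 3 / 4 - rho / 2 + rho * q ^+ 2); first by field.
  rewrite q2; transitivity (rho ^+ 3 - 3 / 2 * rho); first by field.
  by rewrite rho3; field.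
by rewrite addr0; field.
Qed.

Lemma zr_complex z : zr R[i] z = (zr R z)%:C.
Proof. by rewrite /zr rmorph_int. Qed.

Lemma ev_lamE p : ev lam p =
  let: (a, b, c) := p in
  (zr R a - zr R b * rho / 2 + zr R c * (1 - rho ^+ 2 / 2))
    +i* (q * (zr R b - zr R c * rho)).
Proof.
case: p => [[a b] c]; rewrite /ev lam2E /conj_root !zr_complex.
by apply/eqP; rewrite eq_complex /=; apply/andP; split; apply/eqP; field.
Qed.

(** The product of the values of [p] at the two nonreal conjugates is symmetric in them, hence lies
    in Z[rho]; these are its coordinates. Squared distances become computable with integers. *)
Definition tnorm (p : tri) : tri := let: (a, b, c) := p in
  (a * a - b * b + c * c + 2 * a * c - b * c, c * c - a * b, b * b - c * c - a * c)%Z.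

Lemma nrm_ev p : nrm (ev lam p) ^+ 2 = ev rho (tnorm p).
Proof.
rewrite ev_lamE nrm_sqr; case: p => [[a b] c].
rewrite [complex.Re _]/= [complex.Im _]/= exprMn q2 /ev /tnorm !zrE.
set A := zr R a; set B := zr R b; set C := zr R c.
have -> : zr R 2 = 2 by [].
have e4 : rho ^+ 4 = rho ^+ 2 + rho by rewrite exprSr rho3 mulrDl mul1r expr2.
transitivity (A ^+ 2 - B ^+ 2 + C ^+ 2 + 2 * A * C + (B ^+ 2 - A * C - 2 * C ^+ 2) * rho ^+ 2
  - A * B * rho + B * C * rho + C ^+ 2 * rho ^+ 4 - B * C * (rho ^+ 3)); first by field.
rewrite e4 rho3; ring.
Qed.

Definition conj_modulus : R := nrm lam.
Notation lamN := conj_modulus.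

Lemma lamN2 : lamN ^+ 2 = rho ^+ 2 - 1.
Proof. by rewrite nrm_sqr /= q2; field. Qed.

Lemma lamN_gt0 : 0 < lamN.
Proof.
rewrite lt_neqAle nrm_ge0 andbT; apply/eqP => h.
have := lamN2; have := rho_gt1; rewrite -h; nra.
Qed.

Lemma lamN_lt1 : lamN < 1.
Proof.
have /andP[h1 h2] := rho_bounds; have h3 := lamN2; have h4 := lamN_gt0.
rewrite ltNge; apply/negP => h; have : 1 <= lamN ^+ 2 by nra.
rewrite lamN2; nra.
Qed.

Lemma lam_neq0 : lam != 0.
Proof. by apply/eqP => h; have := lamN_gt0; rewrite /conj_modulus h Normc.normc0 ltxx. Qed.

Lemma nrm_lamX n z : nrm (lam ^+ n * z) = lamN ^+ n * nrm z.
Proof. by rewrite Normc.normcM nrm_natpow. Qed.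

Lemma nrm_sg e (z : R[i]) : nrm (sg e * z) = nrm z.
Proof. by case: e; rewrite /sg ?mul1r// mulN1r normcN. Qed.

End PlasticNumber.

(** Not the field trace, but the linear form that is 0 on the anchors of the translates and 1 on
    those of the reflected tiles. *)
Definition tr (p : tri) : Z := let: (a, _, c) := p in (a + c)%Z.
Definition lamt (n : nat) : tri := iter n tmulx (1, 0, 0)%Z.
(** A Padovan sequence: 1, 0, 1, 1, 1, 2, 2, 3 and so on. *)
Definition trl (n : nat) : Z := tr (lamt n).

Lemma tr_add p p' : tr (tadd p p') = (tr p + tr p')%Z.
Proof. by case: p p' => [[a b] c] [[a' b'] c'] /=; lia. Qed.

Lemma tr_opp p : tr (topp p) = (- tr p)%Z.
Proof. by case: p => [[a b] c] /=; lia. Qed.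

Lemma tmulx3 p : tmulx (tmulx (tmulx p)) = tadd (tmulx p) p.
Proof. by case: p => [[a b] c] /=; congr (_, _, _); lia. Qed.

Lemma trlS3 n : trl n.+3 = (trl n.+1 + trl n)%Z.
Proof. by rewrite /trl -tr_add /lamt !iterS tmulx3. Qed.

(** Serves to get [trl n.+2 + trl n.+3 + trl n.+4 <= 5 * trl n.+2], the range that [shift_window]
    can correct. *)
Lemma trl_growth n :
  (1 <= trl n.+2 <= trl n.+3)%Z /\ (trl n.+3 <= trl n.+4 <= 2 * trl n.+2)%Z.
Proof.
elim: n => [|n IH]; first by split; vm_compute; split.
by have := trlS3 n.+2; lia.
Qed.

Lemma tr_iter n a b c :
  tr (iter n tmulx (a, b, c)) = (a * trl n + b * trl n.+1 + c * trl n.+2)%Z.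
Proof.
elim: n a b c => [|n IH] a b c.
  by rewrite /trl /lamt /=; lia.
by rewrite iterSr [tmulx _]/= IH trlS3; lia.
Qed.

(** * A disc containing the tile *)

Section Tile.
Variables (R : realType) (rho q : R).
Hypothesis rho3 : rho ^+ 3 = rho + 1.
Hypothesis q2 : q ^+ 2 = 3 / 4 * rho ^+ 2 - 1.
Notation lam := (conj_root rho q).
Notation lamN := (conj_modulus rho q).
Let lam3 := lam3 rho3 q2.

Lemma q_neq0 : q != 0.
Proof.
have /andP[h1 h2] := rho_bounds rho3.
apply/eqP => h; move: q2; rewrite h expr0n /= => h3.
have : 17 / 10 < rho ^+ 2 by nra.
lra.
Qed.

Variable F : set R[i].
Hypothesis F_neq0 : F !=set0.
Hypothesis F_compact : compact F.
Hypothesis FE : F = [set lam ^+ 3 * z | z in F] `|` [set lam ^+ 2 * (1 - z) | z in F].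

Lemma F_left z : F z -> F (lam ^+ 3 * z).
Proof. by move=> Fz; rewrite FE; left; exists z. Qed.

Lemma F_right z : F z -> F (lam ^+ 2 * (1 - z)).
Proof. by move=> Fz; rewrite FE; right; exists z. Qed.

Lemma F_cases z : F z ->
  (exists2 y, F y & z = lam ^+ 3 * y) \/ (exists2 y, F y & z = lam ^+ 2 * (1 - y)).
Proof. by rewrite {1}FE => -[] [y Fy <-]; [left | right]; exists y. Qed.

Lemma lamN_bounds : 8688 / 10 ^+ 4 < lamN < 8689 / 10 ^+ 4.
Proof.
have /andP[h1 h2] := rho_bounds rho3; have h3 := lamN2 q2; have h4 := lamN_gt0 rho3 q2.
apply/andP; split; rewrite ltNge; apply/negP => h.
  have : lamN ^+ 2 <= (8688 / 10 ^+ 4) ^+ 2 by nra.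
  rewrite h3; nra.
have : (8689 / 10 ^+ 4) ^+ 2 <= lamN ^+ 2 by nra.
rewrite h3; nra.
Qed.

(* Both branches map the disc of this radius about - lam / 2 into itself. *)
Definition rF : R := 10975 / 10 ^+ 4.

(** The supremum of the distances to [- lam / 2] is finite by compactness, and self-similarity
    bounds it by a contracting affine function of itself. *)
Lemma F_disc z : F z -> nrm (z + lam / 2) <= rF.
Proof.
have /andP[l1 l2] := lamN_bounds; have /andP[r1 r2] := rho_bounds rho3.
have hl2 := lamN2 q2.
pose S := [set nrm (z + lam / 2) | z in F].
have hS : has_sup S.
  split; first by case: F_neq0 => y Fy; exists (nrm (y + lam / 2)), y.
  have [M HM] := compactC_bounded F_compact.
  exists (M + nrm (lam / 2)) => _ [y Fy <-].
  by apply: le_trans (le_normcD _ _) _; rewrite lerD2r HM.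
have ubS y : F y -> nrm (y + lam / 2) <= sup S.
  by move=> Fy; apply: ub_le_sup; [exact: hS.2 | exists y].
move=> Fz; apply: le_trans (ubS _ Fz) _.
have S0 : 0 <= sup S by apply: le_trans (nrm_ge0 _) (ubS _ Fz).
(* The additive terms bound how far each branch moves the centre: by [|lam| ^ 2 / 2] on the left,
   and by [|1 + 2 lam + 2 lam ^ 2| / 2 < 19 / 100] on the right. *)
have step : sup S <= Num.max (lamN ^+ 3 * sup S + lamN ^+ 2 / 2)
                             (lamN ^+ 2 * sup S + 19 / 100).
  apply: ge_sup; first exact: hS.1.
  move=> _ [y Fy <-]; rewrite le_max; case: (F_cases Fy) => -[w Fw ->]; apply/orP.
    left; rewrite (_ : _ + _ = lam ^+ 3 * (w + lam / 2) + - (lam ^+ 2 * 2^-1)); last first.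
      by rewrite (_ : lam ^+ 2 = lam * (lam ^+ 3 - 1)) ?lam3; field.
    apply: le_trans (le_normcD _ _) _; rewrite normcN nrm_lamX lerD//.
      by rewrite ler_wpM2l ?exprn_ge0 ?nrm_ge0 ?ubS.
    by rewrite nrm_half nrm_natpow.
  right; rewrite (_ : _ + _ = - (lam ^+ 2 * (w + lam / 2)) + ev lam (1, 2, 2)%Z / 2); last first.
    rewrite /ev (_ : zr _ 2 = 2)// (_ : zr _ 1 = 1)//.
    transitivity (lam ^+ 2 - lam ^+ 2 * w + lam / 2); first by field.
    transitivity (lam ^+ 2 - lam ^+ 2 * w + lam / 2 + (lam + 1 - lam ^+ 3) / 2); last by field.
    by rewrite lam3; field.
  apply: le_trans (le_normcD _ _) _; rewrite normcN nrm_lamX lerD//.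
    by rewrite ler_wpM2l ?exprn_ge0 ?nrm_ge0 ?ubS.
  have h := nrm_ev rho3 q2 (1, 2, 2)%Z.
  have h0 := nrm_ge0 (ev lam (1, 2, 2)%Z).
  rewrite nrm_half; have h1 : nrm (ev lam (1, 2, 2)%Z) ^+ 2 = 1 + 2 * rho - 2 * rho ^+ 2.
    by rewrite h (_ : tnorm _ = (1, 2, -2)%Z)// /ev (_ : zr _ (-2) = -2)// mulNr.
  rewrite ler_pdivrMr//; rewrite leNgt; apply/negP => h2.
  suff : (38 / 100) ^+ 2 < nrm (ev lam (1, 2, 2)%Z) ^+ 2 by rewrite h1; nra.
  rewrite ltr_pXn2r// ?nnegrE//; lra.
move: step; rewrite le_max => /orP[] h.
  have : lamN ^+ 3 < 656 / 1000 by rewrite exprS hl2; nra.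
  rewrite /rF; nra.
have : lamN ^+ 2 < 756 / 1000 by rewrite hl2; nra.
rewrite /rF; nra.
Qed.
End Tile.

(** * Covering the plane *)

(* Anchors u1 lam + u2 (1 - lam ^ 2), shifted by lam ^ 3 = 1 + lam for the
   reflected tiles. *)
Definition tile_pos (u1 u2 : Z) (b : bool) : tri :=
  if b then (u2, u1, - u2)%Z else (u2 + 1, u1 + 1, - u2)%Z.

Lemma tile_posT p : tr p = 0%Z -> exists u1 u2, p = tile_pos u1 u2 true.
Proof.
case: p => [[a b] c] /= h; exists b, a; congr (_, _, _); lia.
Qed.

Lemma tile_posF p : tr p = 1%Z -> exists u1 u2, p = tile_pos u1 u2 false.
Proof.
case: p => [[a b] c] /= h; exists (b - 1)%Z, (a - 1)%Z; congr (_, _, _); lia.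
Qed.

Lemma shift_window T t : (1 <= T)%Z -> (t <= 0)%Z -> (- 5 * T < t)%Z ->
  exists k, (0 <= k <= 4)%Z /\ (- T < t + k * T <= 0)%Z.
Proof.
move=> T1 t0 h.
case: (Z_lt_le_dec (- T) t) => h1; first by exists 0%Z; lia.
case: (Z_lt_le_dec (- 2 * T) t) => h2; first by exists 1%Z; lia.
case: (Z_lt_le_dec (- 3 * T) t) => h3; first by exists 2%Z; lia.
case: (Z_lt_le_dec (- 4 * T) t) => h4; first by exists 3%Z; lia.
by exists 4%Z; lia.
Qed.

Section Covering.
Variables (R : realType) (rho q : R).
Hypothesis rho3 : rho ^+ 3 = rho + 1.
Hypothesis q2 : q ^+ 2 = 3 / 4 * rho ^+ 2 - 1.
Notation lam := (conj_root rho q).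
Notation lamN := (conj_modulus rho q).
Let lam3 := lam3 rho3 q2.
Variable F : set R[i].
Hypothesis FE : F = [set lam ^+ 3 * z | z in F] `|` [set lam ^+ 2 * (1 - z) | z in F].
Let F_left := F_left FE.
Let F_right := F_right FE.

Definition tile u1 u2 b : set R[i] :=
  [set ev lam (tile_pos u1 u2 b) + sg b * z | z in F].

Definition tiles : set R[i] := [set w | exists u1 u2 b, tile u1 u2 b w].

Lemma tilesT p z : tr p = 0%Z -> F z -> tiles (ev lam p + z).
Proof.
move=> /tile_posT [u1 [u2 ->]] Fz; exists u1, u2, true, z => //.
by rewrite mul1r.
Qed.

Lemma tilesF p z : tr p = 1%Z -> F z -> tiles (ev lam p - z).
Proof.
move=> /tile_posF [u1 [u2 ->]] Fz; exists u1, u2, false, z => //.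
by rewrite mulN1r.
Qed.

Lemma ev_lamt n : ev lam (lamt n) = lam ^+ n.
Proof.
by rewrite ev_iter_mulx// /ev (_ : zr _ 0 = 0)// (_ : zr _ 1 = 1)// !mul0r !addr0 mulr1.
Qed.

(* The tiles of scale [lam ^ n] obtained by subdividing the whole collection are
   exactly those whose anchors have trace in a window of length [trl n]. *)
Lemma subtile n p z : F z ->
  ((- trl n < tr p <= 0)%Z -> tiles (ev lam p + lam ^+ n * z)) /\
  ((1 <= tr p <= trl n)%Z -> tiles (ev lam p - lam ^+ n * z)).
Proof.
elim/ltn_ind: n p z => -[|[|[|n]]] IH p z Fz.
- rewrite !expr0 !mul1r; have -> : trl 0 = 1%Z by [].
  by split=> h; [apply: tilesT | apply: tilesF] => //; lia.
- have -> : trl 1 = 0%Z by [].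
  by split=> h; exfalso; lia.
- have -> : trl 2 = 1%Z by [].
  have e2 : ev lam (lamt 2) = lam ^+ 2 := ev_lamt 2.
  split=> h.
    rewrite (_ : _ + _ = ev lam (tadd p (lamt 2)) - lam ^+ 2 * (1 - z)); last first.
      by rewrite ev_add e2; ring.
    apply: tilesF (F_right Fz); rewrite tr_add; have -> : tr (lamt 2) = 1%Z by [].
    lia.
  rewrite (_ : _ - _ = ev lam (tadd p (topp (lamt 2))) + lam ^+ 2 * (1 - z)); last first.
    by rewrite ev_add ev_opp e2; ring.
  apply: tilesT (F_right Fz); rewrite tr_add tr_opp; have -> : tr (lamt 2) = 1%Z by [].
  lia.
have e3 : ev lam (lamt n.+3) = lam ^+ n.+3 := ev_lamt n.+3.
have lS : lam ^+ n.+3 = lam ^+ n.+1 * lam ^+ 2 by rewrite -exprD addn2.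
have lS' : lam ^+ n.+3 = lam ^+ n * lam ^+ 3 by rewrite -exprD addn3.
have hn : (n < n.+3)%N by lia.
have hn1 : (n.+1 < n.+3)%N by lia.
have t3 : tr (lamt n.+3) = trl n.+3 by [].
have := trlS3 n; split=> h.
  (* The window splits as [trl n.+3 = trl n.+1 + trl n]: traces above [- trl n] belong to left
     branches of pieces of scale [lam ^ n], the others to right branches of reflected pieces of
     scale [lam ^ n.+1]. *)
  have [h1|h1] := Z_lt_le_dec (- trl n) (tr p).
    have := (IH n hn p (lam ^+ 3 * z) (F_left Fz)).1.
    by rewrite lS' -mulrA; apply; lia.
  rewrite (_ : _ + _ = ev lam (tadd p (lamt n.+3)) - lam ^+ n.+1 * (lam ^+ 2 * (1 - z))).
    by apply: (IH n.+1 hn1 _ _ (F_right Fz)).2; rewrite tr_add t3; lia.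
  by rewrite ev_add e3 lS; ring.
have [h1|h1] := Z_lt_le_dec (trl n) (tr p); last first.
  have := (IH n hn p (lam ^+ 3 * z) (F_left Fz)).2.
  by rewrite lS' -mulrA; apply; lia.
rewrite (_ : _ - _ = ev lam (tadd p (topp (lamt n.+3))) + lam ^+ n.+1 * (lam ^+ 2 * (1 - z))).
  by apply: (IH n.+1 hn1 _ _ (F_right Fz)).1; rewrite tr_add tr_opp t3; lia.
by rewrite ev_add ev_opp e3 lS; ring.
Qed.

Lemma zr_floor (x : R) : exists z, zr R z <= x < zr R z + 1.
Proof.
exists (Z_of_int (Num.floor x)); rewrite /zr Z_of_intK.
by have := floor_itv x; rewrite intrD.
Qed.

Lemma zr_le a b : (zr R a <= zr R b) = (a <=? b)%Z.
Proof. by rewrite /zr ler_int; lia. Qed.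

Lemma zr_lt a b : (zr R a < zr R b) = (a <? b)%Z.
Proof. by rewrite /zr ltr_int; lia. Qed.

Lemma anchor_dense n (z : R[i]) : exists p,
  (- trl n.+2 < tr p <= 0)%Z /\ nrm (ev lam p - z) <= 7 * lamN ^+ n.+2.
Proof.
have q0 := q_neq0 rho3 q2; have r0 := rho_gt0 rho3; have r0' := lt0r_neq0 r0.
have l0 : lam != 0 := lam_neq0 rho3 q2.
have hl1 := lamN_lt1 rho3 q2; have hl0 := lamN_gt0 rho3 q2.
have [[g1 g2] [g3 g4]] := trl_growth n.
pose w := z / lam ^+ n.+2.
pose y := complex.Im w / q; pose x := complex.Re w + y * rho / 2.
pose a := zr R (trl n.+2); pose b := zr R (trl n.+3); pose c := zr R (trl n.+4).
have a0 : 0 < a by rewrite -(zr0 R) zr_lt; clear -g1 g2 g3 g4; lia.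
have b0 : 0 < b by rewrite -(zr0 R) zr_lt; clear -g1 g2 g3 g4; lia.
have c0 : 0 < c by rewrite -(zr0 R) zr_lt; clear -g1 g2 g3 g4; lia.
(* By [1 / rho + rho lam + lam ^ 2 = 0], adding [s] times (1 / rho, rho, 1) to real coordinates of
   [w] does not change [w]. The form with coefficients [a], [b], [c] takes the value [D] on this
   relation, so [s] can be chosen to make it vanish. *)
pose D := a / rho + rho * b + c.
have D0 : 0 < D by rewrite /D !addr_gt0// ?mulr_gt0// invr_gt0.
pose s := - (x * a + y * b) / D.
have sum0 : (x + s / rho) * a + (y + s * rho) * b + s * c = 0.
  transitivity (x * a + y * b + s * D); first by rewrite /D; ring.
  by rewrite /s divfK ?lt0r_neq0//; ring.
have [A /andP[A1 A2]] := zr_floor (x + s / rho).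
have [B /andP[B1 B2]] := zr_floor (y + s * rho).
have [C /andP[C1 C2]] := zr_floor s.
have wE : w = (x + s / rho)%:C + (y + s * rho)%:C * lam + s%:C * lam ^+ 2.
  rewrite (lam2E q2) /conj_root; apply/eqP; rewrite eq_complex /=.
  have iE : complex.Im w = y * q by rewrite /y divfK.
  rewrite iE (_ : complex.Re w = x - y * rho / 2); last by rewrite /x; ring.
  by rewrite (rhoV rho3); apply/andP; split; apply/eqP; field.
pose t := tr (iter n.+2 tmulx (A, B, C)).
have tE : zr R t = zr R A * a + zr R B * b + zr R C * c by rewrite /t tr_iter !zrE.
have t1 : (t <= 0)%Z.
  apply/Z.leb_le; rewrite -zr_le tE (zr0 R) -sum0.
  by apply: lerD; [apply: lerD|]; apply: ler_wpM2r => //; exact: ltW.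
have t2 : (- 5 * trl n.+2 < t)%Z.
  have : (- (trl n.+2 + trl n.+3 + trl n.+4) < t)%Z.
    apply/Z.ltb_lt; rewrite -zr_lt tE !zrE -/a -/b -/c -subr_gt0 opprK.
    have : 0 < (zr R A + 1 - (x + s / rho)) * a + (zr R B + 1 - (y + s * rho)) * b + (zr R C + 1 - s) * c.
      by rewrite !addr_gt0// mulr_gt0// subr_gt0.
    by move: sum0; lra.
  by clear -g1 g2 g3 g4; lia.
(* Rounding down loses less than [5 * trl n.+2] of the trace; adding [k <= 4] to the constant
   coordinate repairs this. The three coordinate errors contribute at most 5, 1 and 1, whence the
   factor 7. *)
have [k [k1 k2]] := @shift_window (trl n.+2) t g1 t1 t2.
exists (iter n.+2 tmulx ((A + k)%Z, B, C)); split.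
  by move: k2; rewrite /t !tr_iter; clear; lia.
rewrite ev_iter_mulx//.
have -> : z = lam ^+ n.+2 * w by rewrite /w mulrC divfK ?expf_neq0.
rewrite -mulrBr nrm_lamX mulrC ler_wpM2r ?exprn_ge0 ?(ltW hl0)//.
rewrite wE /ev !zr_complex zrD.
rewrite (_ : _ - _ = ((zr R A - (x + s / rho)) + zr R k)%:C + (zr R B - (y + s * rho))%:C * lam + (zr R C - s)%:C * lam ^+ 2); last first.
  by rewrite !(rmorphB, rmorphD); ring.
apply: le_trans (le_normcD _ _) _; apply: le_trans (lerD (le_normcD _ _) (lexx _)) _.
rewrite (Normc.normcM _ lam) (Normc.normcM _ (lam ^+ 2)) nrm_natpow !nrm_real -/lamN.
have k3 : 0 <= zr R k <= 4.
  by rewrite -(zr0 R) (_ : 4 = zr R 4)// !zr_le; clear -k1; lia.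
have h1 : `|zr R A - (x + s / rho) + zr R k| <= 5 by rewrite ler_norml; lra.
have h2 : `|zr R B - (y + s * rho)| * lamN <= 1.
  apply: le_trans (_ : 1 * 1 <= _); last by rewrite mulr1.
  by apply: ler_pM => //; [exact: ltW|rewrite ler_norml; lra|exact: ltW].
have h3 : `|zr R C - s| * lamN ^+ 2 <= 1.
  apply: le_trans (_ : 1 * 1 <= _); last by rewrite mulr1.
  apply: ler_pM => //; [by rewrite exprn_ge0 ?ltW|rewrite ler_norml; lra|].
  by rewrite exprn_ile1 ?ltW.
by lra.
Qed.

End Covering.

Definition zbox (N : nat) : seq Z :=
  [seq (Z.of_nat i - Z.of_nat N)%Z | i <- iota 0 (N + N).+1].

Lemma mem_zbox N z : (- Z.of_nat N <= z <= Z.of_nat N)%Z -> z \in zbox N.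
Proof.
move=> h; apply/mapP; exists (Z.to_nat (z + Z.of_nat N)); last lia.
by rewrite mem_iota; lia.
Qed.

(** * Local finiteness of the tiles and the covering of the plane *)

Section TileCollection.
Variables (R : realType) (rho q : R).
Hypothesis rho3 : rho ^+ 3 = rho + 1.
Hypothesis q2 : q ^+ 2 = 3 / 4 * rho ^+ 2 - 1.
Notation lam := (conj_root rho q).
Notation lamN := (conj_modulus rho q).
Let lam3 := lam3 rho3 q2.
Variable F : set R[i].
Hypothesis F_neq0 : F !=set0.
Hypothesis F_compact : compact F.
Hypothesis FE : F = [set lam ^+ 3 * z | z in F] `|` [set lam ^+ 2 * (1 - z) | z in F].
Notation tile := (tile rho q F).
Notation tiles := (tiles rho q F).

Lemma F_bounded z : F z -> nrm z <= 2.
Proof.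
move=> Fz; have h := F_disc rho3 q2 F_neq0 F_compact FE Fz.
have hl := lamN_lt1 rho3 q2.
rewrite (_ : z = (z + lam / 2) - lam / 2); last by rewrite addrK.
apply: le_trans (le_normcD _ _) _; rewrite normcN nrm_half -/lamN.
by move: h; rewrite /rF; lra.
Qed.

Lemma zr_bound (x : R) : exists N : nat, forall z, `|zr R z| <= x -> (- Z.of_nat N <= z <= Z.of_nat N)%Z.
Proof.
have [N /andP[N1 N2]] := zr_floor x.
exists (Z.to_nat (N + 1)) => z; rewrite ler_norml => /andP[h1 h2].
have : zr R z <= zr R (N + 1)%Z by apply: le_trans h2 _; rewrite zrD; exact: ltW.
have : zr R (- (N + 1))%Z <= zr R z.
  by apply: le_trans h1; rewrite zrN lerN2 zrD; exact: ltW.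
by rewrite !zr_le; lia.
Qed.

Lemma pos_coords u1 u2 M : nrm (ev lam (tile_pos u1 u2 true)) <= M ->
  `|zr R u1 + zr R u2 * rho| <= M / `|q| /\ `|zr R u2 * rho - zr R u1| <= 2 * M / rho.
Proof.
have q0 := q_neq0 rho3 q2; have r0 := rho_gt0 rho3.
set w := ev lam _ => h; have h2 := nrm_Re w; have h1 := nrm_Im w.
have eI : complex.Im w = (zr R u1 + zr R u2 * rho) * q.
  by rewrite /w (ev_lamE q2) /= !zrE; ring.
have eR : complex.Re w = (zr R u2 * rho - zr R u1) * (rho / 2).
  by rewrite /w (ev_lamE q2) /= !zrE; field.
split.
  by rewrite ler_pdivlMr ?normr_gt0// -normrM -eI; apply: le_trans h1 h.
move: h2; rewrite eR normrM (ger0_norm (_ : 0 <= rho / 2)); last by rewrite divr_ge0// ltW.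
by move=> h2; rewrite ler_pdivlMr//; move: (le_trans h2 h); lra.
Qed.

Lemma pos_bounded M : exists N : nat, forall u1 u2,
  nrm (ev lam (tile_pos u1 u2 true)) <= M ->
  (- Z.of_nat N <= u1 <= Z.of_nat N)%Z /\ (- Z.of_nat N <= u2 <= Z.of_nat N)%Z.
Proof.
have r1 := rho_gt1 rho3.
have [N HN] := zr_bound (M / `|q| + 2 * M / rho).
exists N => u1 u2 /pos_coords [h1 h2]; move: h1 h2; set A := M / `|q|; set B := 2 * M / rho.
rewrite !ler_norml => /andP[h1 h2] /andP[h3 h4].
split; apply: HN; rewrite ler_norml -/A -/B.
  lra.
have h : `|zr R u2 * rho| <= A + B by rewrite ler_norml; lra.
rewrite -ler_norml; apply: le_trans h; rewrite normrM.
by rewrite ler_peMr// ger0_norm ltW// (lt_trans _ r1).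
Qed.

Lemma ev_tile_posF u1 u2 : ev lam (tile_pos u1 u2 false) = lam ^+ 3 + ev lam (tile_pos u1 u2 true).
Proof. rewrite lam3 /= !zrE; ring. Qed.

(** Local finiteness: points of [F] have norm at most 2 and the shift [lam ^ 3] at most 1, so a tile
    reaching the disc of radius [M] has its unshifted anchor in the disc of radius [M + 3]. *)
Lemma tile_bounded M : exists N : nat, forall u1 u2 b w, tile u1 u2 b w -> nrm w <= M ->
  (- Z.of_nat N <= u1 <= Z.of_nat N)%Z /\ (- Z.of_nat N <= u2 <= Z.of_nat N)%Z.
Proof.
have [N HN] := pos_bounded (M + 3).
exists N => u1 u2 b w [z Fz <-] h; apply: HN.
rewrite (_ : ev lam _ = (ev lam (tile_pos u1 u2 b) + sg b * z) + (- (sg b * z) + - (if b then 0 else lam ^+ 3))).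
  apply: le_trans (le_normcD _ _) _; rewrite lerD//.
  apply: le_trans (le_normcD _ _) _; rewrite !normcN nrm_sg.
  have -> : 3 = 2 + 1 :> R by ring.
  rewrite lerD ?F_bounded//; case: b {h}; first by rewrite Normc.normc0.
  by rewrite nrm_natpow exprn_ile1 ?nrm_ge0// ltW// lamN_lt1.
by case: b {h}; rewrite ?ev_tile_posF; ring.
Qed.

Lemma F_closed : closed F. Proof. exact: compactC_closed. Qed.

Lemma tile_closed u1 u2 b : closed (tile u1 u2 b).
Proof.
apply/closed_discP => z H.
have Fy : F (sg b * (z - ev lam (tile_pos u1 u2 b))).
  apply: (closed_discP F).1 F_closed _ _ => r r0; have [_ [w Fw <-] hw] := H r r0.
  exists w => //; rewrite -(nrm_sg b) mulrBr mulrA sgK mul1r.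
  by move: hw; congr (nrm _ < _); ring.
by exists (sg b * (z - ev lam (tile_pos u1 u2 b))) => //; rewrite mulrA sgK mul1r addrC subrK.
Qed.

Lemma pow_lt1 (c e : R) : 0 <= c < 1 -> 0 < e -> exists n, c ^+ n < e.
Proof.
move=> /andP[c0 c1] e0.
have : (fun n => c ^+ n) @ \oo --> (0 : R) by apply: cvg_expr; rewrite ger0_norm.
move=> /cvgrPdist_lt /(_ e e0) [n _ H]; exists n.
by have := H n (leqnn n); rewrite sub0r normrN ger0_norm ?exprn_ge0.
Qed.

Lemma tiles_cover w : tiles w.
Proof.
have hl0 := lamN_gt0 rho3 q2; have hl1 := lamN_lt1 rho3 q2.
have [z Fz] := F_neq0.
have dense r : 0 < r -> exists2 v, tiles v & nrm (v - w) < r.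
  (* The anchor is off by at most [7 |lam| ^ n.+2] and the point of the tile adds [2 |lam| ^ n.+2],
     whence 9. *)
  move=> r0; have [n hn] : exists n, lamN ^+ n < r / 9.
    by apply: pow_lt1; [rewrite ltW | rewrite divr_gt0].
  have [p [p1 p2]] := anchor_dense rho3 q2 n w.
  exists (ev lam p + lam ^+ n.+2 * z); first by apply: (subtile rho3 q2 FE n.+2 p Fz).1.
  rewrite addrAC; apply: le_lt_trans (le_normcD _ _) _.
  apply: le_lt_trans (lerD p2 (lexx _)) _; rewrite nrm_lamX.
  have h1 : lamN ^+ n.+2 * nrm z <= lamN ^+ n.+2 * 2.
    by rewrite ler_wpM2l ?exprn_ge0 ?nrm_ge0 ?F_bounded.
  have h2 : lamN ^+ n.+2 <= lamN ^+ n by apply: ler_wiXn2l; [exact: ltW|exact: ltW|lia].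
  lra.
(* Only finitely many tiles meet the unit disc about [w]; their union is closed and, by density, has
   [w] as a limit. *)
have [N HN] := tile_bounded (nrm w + 1).
pose D := [set` [seq (u, b) | u <- [seq (u1, u2) | u1 <- zbox N, u2 <- zbox N], b <- [:: true; false]]].
have cD : closed (\bigcup_(i in D) tile i.1.1 i.1.2 i.2).
  by apply: closed_bigcup => [|i _]; [exact: finite_seq | exact: tile_closed].
suff [[[u1 u2] b] _ h] : (\bigcup_(i in D) tile i.1.1 i.1.2 i.2) w by exists u1, u2, b.
apply: (closed_discP _).1 cD _ _ => r r0.
have [|v [u1 [u2 [b hv]]] hvw] := dense (Num.min r 1); first by rewrite lt_min r0 ltr01.
move: hvw; rewrite lt_min => /andP[h1 h2]; exists v => //.
exists ((u1, u2), b) => //=.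
have [|b1 b2] := HN u1 u2 b v hv.
  rewrite (_ : v = w + (v - w)); last by rewrite addrC subrK.
  by apply: le_trans (le_normcD _ _) _; rewrite lerD2l ltW.
apply: (allpairs_f pair); last by rewrite !inE; case: (b).
by apply: (allpairs_f pair); rewrite mem_zbox.
Qed.

End TileCollection.

(** * Content of sets with respect to finite covers by discs *)

(* The sum of the x ^ n over the exponents n of the five similarities of the core. *)
Definition moran (R : realType) (x : R) : R := x ^+ 3 + x ^+ 7 + 2 * x ^+ 9 + x ^+ 10.

Section Content.
Variables (R : realType) (s : R).
Implicit Types (E A B : set R[i]) (l : seq (R[i] * R)).

Definition covers l E :=
  (forall d, d \in l -> 0 < d.2) /\
  forall z, E z -> exists2 d, d \in l & nrm (z - d.1) <= d.2.

Definition cost l : R := \sum_(d <- l) d.2 `^ s.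

(* Hausdorff content with finite covers by discs.  As the infimum of the empty
   set is 0, it is meaningful for bounded sets only. *)
Definition disc_content E : R := inf [set cost l | l in covers^~ E].

Definition bounded_plane E := exists M, forall z, E z -> nrm z <= M.

Lemma cost_ge0 l : 0 <= cost l.
Proof. by apply: sumr_ge0 => d _; exact: powR_ge0. Qed.

Lemma cost_mem l d : d \in l -> d.2 `^ s <= cost l.
Proof.
move=> dl; rewrite /cost (big_rem d dl) /= lerDl.
by apply: sumr_ge0 => e _; exact: powR_ge0.
Qed.

Lemma cost_cat l l' : cost (l ++ l') = cost l + cost l'.
Proof. by rewrite /cost big_cat. Qed.

Lemma content_ge0 E : 0 <= disc_content E.
Proof.
rewrite /disc_content; have [->|/set0P h] := eqVneq [set cost l | l in covers^~ E] set0.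
  by rewrite inf0.
by apply: lb_le_inf => // _ [l _ <-]; exact: cost_ge0.
Qed.

Lemma content_le_cost l E : covers l E -> disc_content E <= cost l.
Proof.
move=> h; apply: ge_inf; last by exists l.
by exists 0 => _ [l' _ <-]; exact: cost_ge0.
Qed.

Lemma content_lt E a : bounded_plane E -> disc_content E < a ->
  exists2 l, covers l E & cost l < a.
Proof.
move=> [M HM] h.
have [|_ [l hl <-] hla] := @inf_lt _ [set cost l | l in covers^~ E] a _ h.
  exists (cost [:: (0, Num.max M 1)]), [:: (0, Num.max M 1)] => //; split.
    by move=> d; rewrite inE => /eqP -> /=; rewrite lt_max ltr01 orbT.
  move=> z Ez; exists (0, Num.max M 1); first by rewrite inE.
  by rewrite /= subr0 le_max HM.
by exists l.
Qed.

Lemma content_set0 : disc_content set0 = 0.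
Proof.
apply/eqP; rewrite eq_le content_ge0 andbT.
have /content_le_cost : covers [::] (set0 : set R[i]) by split.
by rewrite /cost big_nil.
Qed.

Definition lip_plane (c : R) (f : R[i] -> R[i]) :=
  forall z w, nrm (f z - f w) <= c * nrm (z - w).

Definition cover_image (c : R) (f : R[i] -> R[i]) l := [seq (f d.1, c * d.2) | d <- l].

Lemma covers_image c f l A : 0 < c -> lip_plane c f -> covers l A ->
  covers (cover_image c f l) [set f z | z in A].
Proof.
move=> c0 lf [l0 lA]; split.
  by move=> _ /mapP[d dl ->] /=; rewrite mulr_gt0// l0.
move=> _ [z /lA [d dl hd] <-]; exists (f d.1, c * d.2).
  by apply/mapP; exists d.
by apply: le_trans (lf _ _) _; rewrite ler_wpM2l// ltW.
Qed.

Lemma cost_image c f l A : 0 < c -> covers l A -> cost (cover_image c f l) = c `^ s * cost l.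
Proof.
move=> c0 [l0 _]; rewrite /cost big_map mulr_sumr big_seq [RHS]big_seq.
apply: eq_bigr => d dl /=; rewrite powRM// ltW//; exact: l0.
Qed.

Lemma covers_cat l l' E A B : covers l A -> covers l' B -> E `<=` A `|` B ->
  covers (l ++ l') E.
Proof.
move=> [l0 lA] [l'0 lB] EAB; split.
  by move=> d; rewrite mem_cat => /orP[/l0|/l'0].
move=> z /EAB [/lA|/lB] [d dl hd]; exists d => //; rewrite mem_cat dl ?orbT//.
Qed.

(** Nearly optimal covers of the two pieces are transported and concatenated. This combines scaling
    and subadditivity in the form that one subdivision step of a state requires. *)
Lemma content_image2 E A B c c' f f' : 0 < c -> 0 < c' ->
  lip_plane c f -> lip_plane c' f' -> bounded_plane A -> bounded_plane B ->
  E `<=` [set f z | z in A] `|` [set f' z | z in B] ->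
  disc_content E <= c `^ s * disc_content A + c' `^ s * disc_content B.
Proof.
move=> c0 c'0 lf lf' bA bB EAB; apply/ler_addgt0Pr => e e0.
pose k := c `^ s + c' `^ s + 1.
have k0 : 0 < k by rewrite /k ltr_wpDl// addr_ge0// powR_ge0.
have [|l lA hl] := @content_lt A (disc_content A + e / k) bA; first by rewrite ltrDl divr_gt0.
have [|l' lB hl'] := @content_lt B (disc_content B + e / k) bB; first by rewrite ltrDl divr_gt0.
have := content_le_cost (covers_cat (covers_image c0 lf lA) (covers_image c'0 lf' lB) EAB).
rewrite cost_cat (cost_image _ c0 lA) (cost_image _ c'0 lB) => /le_trans; apply.
apply: le_trans (_ : c `^ s * (disc_content A + e / k) + c' `^ s * (disc_content B + e / k) <= _).
  by apply: lerD; apply: ler_wpM2l (ltW _) => //; exact: powR_ge0.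
have h : (c `^ s + c' `^ s) * (e / k) <= e.
  rewrite mulrCA ger_pMr// ler_pdivrMr// mul1r /k; lra.
move: h; lra.
Qed.

Lemma content_image E A c f : 0 < c -> lip_plane c f -> bounded_plane A ->
  E `<=` [set f z | z in A] -> disc_content E <= c `^ s * disc_content A.
Proof.
move=> c0 lf bA EA.
have lid : lip_plane 1 (@id R[i]) by move=> z w; rewrite mul1r.
have b0 : bounded_plane (set0 : set R[i]) by exists 0.
have := @content_image2 E A set0 c 1 f id c0 ltr01 lf lid bA b0.
rewrite content_set0 mulr0 addr0; apply.
by rewrite image_set0 setU0.
Qed.

End Content.

(** * Intersections of two tiles *)

(* The state [(k, e, d)] stands for the intersection of [F] with
   [e lam ^ k F + d]. *)
Definition state : Type := nat * bool * tri.

(** Normalises the intersection of [lam ^ j F] and [e lam ^ k F + d] by pulling back along the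
    similarity of the larger set, which becomes [F]. The first component is the exponent of the
    ratio. *)
Definition rescale (j k : nat) (e : bool) (d : tri) : nat * state :=
  if (j <= k)%N then (j, (k - j, e, iter j tdivx d))%N
  else (k, (j - k, e, tsg (~~ e) (iter k tdivx d)))%N.

Definition succL (st : state) : nat * state :=
  let: (k, e, d) := st in rescale 3 k e d.

(** The reflection sending z to [lam ^ 2 - z] turns the right branch of [F] into [lam ^ 2 F],
    flipping the sign of the other set. *)
Definition succR (st : state) : nat * state :=
  let: (k, e, d) := st in rescale 2 k (~~ e) (tadd (0, 0, 1)%Z (topp d)).

(* Twice the distance between the centres of the discs containing the two sets
   of the state. *)
Definition far_vec (st : state) : tri :=
  let: (k, e, d) := st in
  tadd (tadd (tadd d d) (0, 1, 0)%Z) (tsg (~~ e) (lamt k.+1)).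

(* The discs are disjoint: 19.5 > (4 rF) ^ 2, and the integers of seven digits
   enclose 10 ^ 6 rho and 10 ^ 6 rho ^ 2. *)
Definition far (st : state) : bool :=
  let: (a, b, c) := tnorm (far_vec st) in
  (19500000 <=? a * 1000000 + b * (if 0 <=? b then 1324717 else 1324718)
     + c * (if 0 <=? c then 1754870 else 1754880))%Z.

(** A certificate of emptiness: after at most [n] subdivisions all pieces lie in disjoint discs.
    Nested conditionals let evaluation stop early. *)
Fixpoint dead (n : nat) (st : state) : bool :=
  if far st then true else
  if n is n'.+1 then if dead n' (succL st).2 then dead n' (succR st).2 else false
  else false.

Section Neighbours.
Variables (R : realType) (rho q : R).
Hypothesis rho3 : rho ^+ 3 = rho + 1.
Hypothesis q2 : q ^+ 2 = 3 / 4 * rho ^+ 2 - 1.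
Notation lam := (conj_root rho q).
Notation lamN := (conj_modulus rho q).
Let lam3 := lam3 rho3 q2.
Variable F : set R[i].
Hypothesis F_neq0 : F !=set0.
Hypothesis F_compact : compact F.
Hypothesis FE : F = [set lam ^+ 3 * z | z in F] `|` [set lam ^+ 2 * (1 - z) | z in F].
Let F_bounded := F_bounded rho3 q2 F_neq0 F_compact FE.

Definition inter (j k : nat) (e : bool) (d : R[i]) : set R[i] :=
  [set z | (exists2 y, F y & z = lam ^+ j * y) /\
           (exists2 y, F y & z = sg e * (lam ^+ k * y) + d)].

Definition isect (st : state) : set R[i] := let: (k, e, d) := st in inter 0 k e (ev lam d).

Lemma isectF st z : isect st z -> F z.
Proof. by case: st => [[k e] d] [[y Fy ->] _]; rewrite expr0 mul1r. Qed.

Lemma isect_bounded st : bounded_plane (isect st).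
Proof. by exists 2 => z /isectF /F_bounded. Qed.

Definition similar (n : nat) (f : R[i] -> R[i]) :=
  exists e w, forall z, f z = sg e * (lam ^+ n * z) + w.

Lemma similar_lip n f : similar n f -> lip_plane (lamN ^+ n) f.
Proof.
move=> [e [w h]] z z'; rewrite !h.
rewrite (_ : _ - _ = sg e * (lam ^+ n * (z - z'))); last by ring.
by rewrite nrm_sg nrm_lamX.
Qed.

Lemma rescaleP j k e d : exists2 f, similar (rescale j k e d).1 f &
  inter j k e (ev lam d) `<=` [set f z | z in isect (rescale j k e d).2].
Proof.
have l0 n : lam ^+ n != 0 by rewrite expf_neq0// (lam_neq0 rho3 q2).
rewrite /rescale; case: ifPn => [jk|kj] /=.
  exists (fun z => lam ^+ j * z); first by exists true, 0 => z; rewrite mul1r addr0.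
  move=> z [[y Fy ->] [y' Fy' e']]; exists y => //; split; first by exists y; rewrite ?expr0 ?mul1r.
  exists y' => //; apply: (mulfI (l0 j)).
  rewrite e' mulrDr (ev_iter_divx _ _ lam3) -{1}(subnKC jk) exprD.
  by congr (_ + _); ring.
rewrite -ltnNge in kj.
exists (fun z => sg e * (lam ^+ k * z) + ev lam d); first by exists e, (ev lam d).
move=> z [[y Fy ->] [y' Fy' e']]; exists y' => //; split; first by exists y'; rewrite ?expr0 ?mul1r.
exists y => //; rewrite ev_sg.
have h : sg e * (lam ^+ k * y') + lam ^+ k * ev lam (iter k tdivx d) = lam ^+ k * (lam ^+ (j - k) * y).
  by rewrite (ev_iter_divx _ _ lam3) mulrA -exprD subnKC -?e' 1?ltnW.
apply: (mulfI (l0 k)); case: e h {e'} => /= h; rewrite /sg ?mul1r ?mulN1r mulrDr.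
  by rewrite -h /sg mul1r mulrN addrK.
by move: h; rewrite /sg !mulN1r mulrN => <-; ring.
Qed.

Lemma isect_split st : exists f g,
  [/\ similar (succL st).1 f, similar (succR st).1 g &
    isect st `<=` [set f z | z in isect (succL st).2] `|` [set g z | z in isect (succR st).2]].
Proof.
case: st => [[k e] d] /=.
have [f sf hf] := rescaleP 3 k e d.
have [g [e' [w hg]] hg'] := rescaleP 2 k (~~ e) (tadd (0, 0, 1)%Z (topp d)).
exists f, (fun z => lam ^+ 2 - g z); split => //.
  by exists (~~ e'), (lam ^+ 2 - w) => z; rewrite hg; case: (e'); rewrite /sg /=; ring.
move=> z [[y Fy ->] [y' Fy' h]]; rewrite expr0 mul1r in h *.
have [[v Fv yv]|[v Fv yv]] := F_cases FE Fy.
  by left; apply: hf; split; [exists v | exists y'].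
right.
have [|u hu e2] := hg' (lam ^+ 2 - y).
  split; first by exists v => //; rewrite yv; ring.
  exists y' => //; rewrite h ev_add ev_opp (_ : ev lam (0, 0, 1)%Z = lam ^+ 2).
    by case: (e); rewrite /sg /=; ring.
  by rewrite /= (zr0 _) zr1; ring.
by exists u => //; rewrite e2; ring.
Qed.

Lemma far_isect st : far st -> isect st = set0.
Proof.
have /andP[r1 r2] := rho_bounds rho3; have hl1 := lamN_lt1 rho3 q2.
have hl0 := lamN_gt0 rho3 q2.
move=> hfar; rewrite -subset0 => z hz; exfalso.
have Fz := isectF hz.
have h19 : 195 / 10 <= nrm (ev lam (far_vec st)) ^+ 2.
  rewrite (nrm_ev rho3 q2).
  move: hfar; rewrite /far; case: (tnorm _) => [[a b] c] /=.
  rewrite -(zr_le R) !zrE.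
  have -> : zr R 19500000 = 195 / 10 * 10 ^+ 6.
    by rewrite (_ : 19500000 = 195 * 10 * 10 * 10 * 10 * 10)%Z // !zrM
      (_ : zr R 10 = 10)// (_ : zr R 195 = 195)//; field.
  have -> : zr R 1000000 = 10 ^+ 6.
    by rewrite (_ : 1000000 = 10 * 10 * 10 * 10 * 10 * 10)%Z // !zrM (_ : zr R 10 = 10)//; ring.
  have zrK (x y : Z) : zr R (x * 1000 + y)%Z = zr R x * 1000 + zr R y.
    by rewrite zrD zrM (_ : zr R 1000 = 1000).
  (* The approximation of [rho] is rounded according to the sign of its coefficient, so the integer
     test only underestimates the norm. *)
  have hb : zr R b * zr R (if (0 <=? b)%Z then 1324717 else 1324718)%Z <= zr R b * rho * 10 ^+ 6.
    case: ifP; rewrite -(zr_le R) zr0 => hb.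
      rewrite (_ : 1324717 = 1324 * 1000 + 717)%Z// zrK (_ : zr R 1324 = 1324)// (_ : zr R 717 = 717)//.
      rewrite -mulrA ler_wpM2l//; lra.
    rewrite (_ : 1324718 = 1324 * 1000 + 718)%Z// zrK (_ : zr R 1324 = 1324)// (_ : zr R 718 = 718)//.
    rewrite -mulrA ler_wnM2l//; [by rewrite leNgt; apply/negP => /ltW; rewrite hb | lra].
  have hc : zr R c * zr R (if (0 <=? c)%Z then 1754870 else 1754880)%Z <= zr R c * rho ^+ 2 * 10 ^+ 6.
    case: ifP; rewrite -(zr_le R) zr0 => hc.
      rewrite (_ : 1754870 = 1754 * 1000 + 870)%Z// zrK (_ : zr R 1754 = 1754)// (_ : zr R 870 = 870)//.
      rewrite -mulrA ler_wpM2l//; nra.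
    rewrite (_ : 1754880 = 1754 * 1000 + 880)%Z// zrK (_ : zr R 1754 = 1754)// (_ : zr R 880 = 880)//.
    rewrite -mulrA ler_wnM2l//; [by rewrite leNgt; apply/negP => /ltW; rewrite hc | nra].
  move: hb hc; set B := zr R b * zr R _; set C := zr R c * zr R _ => hb hc hh.
  rewrite -(ler_pM2r (_ : 0 < (10 ^+ 6 : R))) ?exprn_gt0//.
  apply: le_trans hh _; lra.
have : nrm (ev lam (far_vec st)) <= 4 * rF R.
  move: hz; case: (st) => [[k e] d] [_ [y Fy e']].
  rewrite /far_vec !ev_add ev_sg (ev_lamt rho3 q2) (_ : ev lam (0, 1, 0)%Z = lam); last first.
    by rewrite /= (zr0 _) zr1; ring.
  rewrite (_ : _ + _ = (z + lam / 2) + (z + lam / 2) + - (sg e * (lam ^+ k * (y + lam / 2)) + sg e * (lam ^+ k * (y + lam / 2)))); last first.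
    by rewrite e' exprS; case: (e); rewrite /sg /=; field.
  have hd w : F w -> nrm (w + lam / 2) <= rF R by move=> Fw; exact: (F_disc rho3 q2 F_neq0 F_compact FE).
  have h1 := hd z Fz.
  have h2 : nrm (sg e * (lam ^+ k * (y + lam / 2))) <= rF R.
    rewrite nrm_sg nrm_lamX; apply: le_trans (hd y Fy).
    by rewrite ler_piMl ?nrm_ge0// exprn_ile1 ?ltW.
  apply: le_trans (le_normcD _ _) _; rewrite normcN.
  apply: le_trans (lerD (le_normcD _ _) (le_normcD _ _)) _; lra.
move=> h; have h0 := nrm_ge0 (ev lam (far_vec st)).
have : nrm (ev lam (far_vec st)) ^+ 2 <= (4 * rF R) ^+ 2 by rewrite ler_pXn2r ?nnegrE// (le_trans h0).
rewrite /rF; lra.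
Qed.

Lemma dead_isect n st : dead n st -> isect st = set0.
Proof.
elim: n st => [|n IH] st /=; case: ifP => [/far_isect//|_ //].
case: ifP => // /IH hL /IH hR.
rewrite -subset0; have [f [g [_ _ h]]] := isect_split st.
by apply: subset_trans h _; rewrite hL hR !image_set0 setU0.
Qed.

End Neighbours.

(** One of the two halves is certified empty, so the intersection is contained in a single scaled
    copy of another state. *)
Definition only_succ (st : state) (n : nat) (st' : state) : bool :=
  (succL st == (n, st')) && dead 14 (succR st).2 ||
  (succR st == (n, st')) && dead 14 (succL st).2.

Definition two_succ (st : state) (n : nat) (st' : state) (m : nat) (st'' : state) : bool :=
  (succL st == (n, st')) && (succR st == (m, st'')).

(* The pairs of distinct tiles of the collection that may meet. *)
Definition contacts : seq state :=
  [:: (0, false, (0, -1, 1)%Z); (0, false, (0, 0, 1)%Z); (0, false, (1, 0, 0)%Z);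
      (0, false, (1, 1, 0)%Z); (0, true, (-1, -1, 1)%Z); (0, true, (-1, 0, 1)%Z);
      (0, true, (0, -1, 0)%Z); (0, true, (0, 1, 0)%Z); (0, true, (1, 0, -1)%Z);
      (0, true, (1, 1, -1)%Z)]%N.

Definition contact_check (u1 u2 : Z) (b : bool) : bool :=
  let st := (0%N, b, tile_pos u1 u2 b) in
  if [&& b, u1 == 0%Z & u2 == 0%Z] then true
  else if st \in contacts then true else dead 14 st.

(** The box of radius 9 contains every relative anchor at which two tiles can meet, as
    [neighbour_null] shows; outside the list, subdivision to depth 14 separates the tiles. *)
Lemma contacts_complete :
  all (fun u1 => all (fun u2 => all (contact_check u1 u2) [:: true; false]) (zbox 9)) (zbox 9).
Proof. by vm_compute. Qed.

(** * Vanishing content of the overlaps of distinct tiles *)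

Section NullContacts.
Variables (R : realType) (rho q : R).
Hypothesis rho3 : rho ^+ 3 = rho + 1.
Hypothesis q2 : q ^+ 2 = 3 / 4 * rho ^+ 2 - 1.
Notation lam := (conj_root rho q).
Notation lamN := (conj_modulus rho q).
Variable F : set R[i].
Hypothesis F_neq0 : F !=set0.
Hypothesis F_compact : compact F.
Hypothesis FE : F = [set lam ^+ 3 * z | z in F] `|` [set lam ^+ 2 * (1 - z) | z in F].
Variable s : R.
Let x : R := lamN `^ s.
Hypothesis x_lt1 : x < 1.
Hypothesis moran_lt1 : moran x < 1.
Notation h st := (disc_content s (isect rho q F st)).

Lemma ratio_gt0 : 0 < x. Proof. by rewrite powR_gt0// (lamN_gt0 rho3 q2). Qed.

Lemma powR_lamNX n : (lamN ^+ n) `^ s = x ^+ n.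
Proof.
have l0 := ltW (lamN_gt0 rho3 q2).
by rewrite -powR_mulrn// powRAC powR_mulrn// powR_ge0.
Qed.

Lemma isect_content_ge0 st : 0 <= h st. Proof. exact: content_ge0. Qed.

Lemma dead_content n st : dead n st -> h st = 0.
Proof. by move=> /(dead_isect rho3 q2 F_neq0 F_compact FE) ->; exact: content_set0. Qed.

Lemma isect_content_split st : h st <= x ^+ (succL st).1 * h (succL st).2 + x ^+ (succR st).1 * h (succR st).2.
Proof.
have [f [g [sf sg' fg]]] := isect_split rho3 q2 FE st.
have hb := isect_bounded rho3 q2 F_neq0 F_compact FE.
have l0 n : 0 < lamN ^+ n by rewrite exprn_gt0// (lamN_gt0 rho3 q2).
have := content_image2 s (l0 _) (l0 _) (similar_lip sf) (similar_lip sg') (hb _) (hb _) fg.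
by rewrite !powR_lamNX.
Qed.

Lemma only_succ_content st n st' : only_succ st n st' -> h st <= x ^+ n * h st'.
Proof.
have := isect_content_split st => hs.
by move=> /orP[] /andP[/eqP e /dead_content hd]; move: hs; rewrite e hd mulr0 ?addr0 ?add0r.
Qed.

Lemma two_succ_content st n st' m st'' : two_succ st n st' m st'' ->
  h st <= x ^+ n * h st' + x ^+ m * h st''.
Proof. by have := isect_content_split st => + /andP[/eqP e /eqP e']; rewrite e e'. Qed.

Lemma only_succ_content0 st n st' : only_succ st n st' -> h st' = 0 -> h st = 0.
Proof.
by move=> /only_succ_content + e; rewrite e mulr0 => ?; apply/eqP; rewrite eq_le isect_content_ge0 andbT.
Qed.

Lemma two_succ_content0 st n st' m st'' : two_succ st n st' m st'' -> h st' = 0 -> h st'' = 0 -> h st = 0.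
Proof.
by move=> /two_succ_content + e e'; rewrite e e' !mulr0 addr0 => ?; apply/eqP; rewrite eq_le isect_content_ge0 andbT.
Qed.

Notation H k e a b c := (h (k%N, e, (a, b, c)%Z)).
Notation only k e a b c n k' e' a' b' c' :=
  (@only_succ_content (k%N, e, (a, b, c)%Z) n%N (k'%N, e', (a', b', c')%Z) isT).
Notation only0 k e a b c n k' e' a' b' c' :=
  (@only_succ_content0 (k%N, e, (a, b, c)%Z) n%N (k'%N, e', (a', b', c')%Z) isT).
Notation two k e a b c n k' e' a' b' c' m k'' e'' a'' b'' c'' :=
  (@two_succ_content (k%N, e, (a, b, c)%Z) n%N (k'%N, e', (a', b', c')%Z) m%N (k''%N, e'', (a'', b'', c'')%Z) isT).
Notation two0 k e a b c n k' e' a' b' c' m k'' e'' a'' b'' c'' :=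
  (@two_succ_content0 (k%N, e, (a, b, c)%Z) n%N (k'%N, e', (a', b', c')%Z) m%N (k''%N, e'', (a'', b'', c'')%Z) isT).

Lemma content_chain (a b c : R) n m : a <= x ^+ n * b -> b <= x ^+ m * c -> a <= x ^+ (n + m) * c.
Proof.
move=> ab bc; apply: le_trans ab _; rewrite exprD -mulrA ler_wpM2l//.
by rewrite exprn_ge0// ltW// ratio_gt0.
Qed.

Lemma contraction_eq0 (a k : R) : 0 <= a -> k < 1 -> a <= k * a -> a = 0.
Proof.
move=> a0 k1 ak; apply/eqP; rewrite eq_le a0 andbT leNgt; apply/negP => a0'.
by move: ak; rewrite -subr_ge0 -{2}[a]mul1r -mulrBl pmulr_lge0// subr_ge0 leNgt k1.
Qed.

(* States met along a cycle without branching: single points. *)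
Lemma point_content0 : H 1 false 1 1 (-1) = 0.
Proof.
have e := content_chain (content_chain (content_chain (only 1 false 1 1 (-1) 1 2 false 0 (-1) 1)
  (only 2 false 0 (-1) 1 2 0 true (-1) 0 1))
  (only 0 true (-1) 0 1 0 2 false 1 0 0))
  (only 2 false 1 0 0 2 1 false 1 1 (-1)).
apply: contraction_eq0 (isect_content_ge0 _) _ e.
by rewrite exprn_ilt1// ?ltW// ratio_gt0.
Qed.

(** The state with exponent 2, positive sign and zero translation is the core. States leading only
    to points vanish; the remaining ones are eliminated until the content [l] of the core satisfies
    [l <= moran x * l]. *)
Lemma core_content0 : H 2 true 0 0 0 = 0.
Proof.
have t1 := point_content0.
have t2 := only0 2 false 1 0 0 2 1 false 1 1 (-1) t1.
have t3 := only0 1 false 0 1 0 1 2 false 1 0 0 t2.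
have t4 := only0 3 true (-1) (-1) 1 2 1 false 0 1 0 t3.
have t5 := only0 0 true 1 1 (-1) 0 3 true (-1) (-1) 1 t4.
have t6 := only0 2 false (-1) 0 1 2 0 true 1 1 (-1) t5.
have x0 := ratio_gt0.
set l := H 2 true 0 0 0.
have hh := two 1 true 0 0 0 1 2 true 0 0 0 1 1 false 0 1 0.
rewrite t3 mulr0 addr0 -/l in hh.
have hf := content_chain (only 1 false 0 0 1 1 1 true 0 0 0) hh.
have hi := content_chain (only 1 true (-1) (-1) 1 1 1 false 0 0 1) hf.
have hg := two 1 false 1 0 0 1 2 false (-1) 0 1 1 1 true (-1) (-1) 1.
rewrite t6 mulr0 add0r in hg.
have hj := content_chain (only 1 true 0 (-1) 1 1 1 false 1 0 0) (content_chain hg hi).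
have hm := content_chain (only 2 true 1 0 (-1) 2 1 true 0 (-1) 1) hj.
have hn := content_chain (only 3 false 0 0 1 2 1 true 0 0 0) hh.
have hb := two 0 false 0 0 1 0 3 false 0 0 1 0 2 true 0 0 0.
have hk := only 2 true 0 (-1) 0 2 0 false 0 0 1.
have ha := only 0 false 0 (-1) 1 0 2 true 0 (-1) 0.
have ho := two 3 false 1 0 0 3 0 false 0 (-1) 1 2 1 true 0 (-1) 1.
have hc := two 0 false 1 0 0 0 3 false 1 0 0 0 2 true 1 0 (-1).
(* The edge that closes the loop: the core splits into a state bounded by [hh] and one bounded by
   [hc'], both multiples of [l]. *)
have hl := two 2 true 0 0 0 2 1 true 0 0 0 2 0 false 1 0 0.
rewrite !expr0 !mul1r -/l in hb ha hc hl.
have hb' : H 0 false 0 0 1 <= (x ^+ 3 + 1) * l.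
  by apply: le_trans hb _; rewrite mulrDl mul1r lerD2r.
have ha' : H 0 false 0 (-1) 1 <= (x ^+ 5 + x ^+ 2) * l.
  apply: le_trans ha _; apply: le_trans hk _.
  rewrite (_ : x ^+ 5 + x ^+ 2 = x ^+ 2 * (x ^+ 3 + 1)); last by ring.
  by rewrite -mulrA ler_wpM2l// exprn_ge0// ltW.
have hc' : H 0 false 1 0 0 <= (x ^+ 8 + x ^+ 5 + 2 * x ^+ 7) * l.
  apply: le_trans hc _; apply: le_trans (lerD ho hm) _.
  apply: le_trans (_ : x ^+ 3 * ((x ^+ 5 + x ^+ 2) * l) + x ^+ 2 * (x ^+ 5 * l) + x ^+ 7 * l <= _).
    by rewrite lerD2r lerD// ler_wpM2l// exprn_ge0// ltW.
  by rewrite le_eqVlt; apply/orP; left; apply/eqP; ring.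
apply: (contraction_eq0 (isect_content_ge0 _) moran_lt1); rewrite /moran.
apply: le_trans hl _.
apply: le_trans (_ : x ^+ 2 * (x ^+ 1 * l) + x ^+ 2 * ((x ^+ 8 + x ^+ 5 + 2 * x ^+ 7) * l) <= _).
  by rewrite lerD// ler_wpM2l// exprn_ge0// ltW.
by rewrite le_eqVlt; apply/orP; left; apply/eqP; rewrite -/l; ring.
Qed.

(** Once the core and the points are null, vanishing propagates backwards along the edges of the
    graph to all ten contacts. *)
Lemma contact_content0 st : st \in contacts -> h st = 0.
Proof.
have t1 := point_content0.
have t2 := only0 2 false 1 0 0 2 1 false 1 1 (-1) t1.
have t3 := only0 1 false 0 1 0 1 2 false 1 0 0 t2.
have t4 := only0 3 true (-1) (-1) 1 2 1 false 0 1 0 t3.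
have t5 := only0 0 true 1 1 (-1) 0 3 true (-1) (-1) 1 t4.
have t6 := only0 2 false (-1) 0 1 2 0 true 1 1 (-1) t5.
have t7 := only0 0 true (-1) 0 1 0 2 false 1 0 0 t2.
have t8 := only0 2 false 0 (-1) 1 2 0 true (-1) 0 1 t7.
have t9 := only0 3 true (-1) 0 1 2 1 false 1 1 (-1) t1.
have t10 := only0 0 true 1 0 (-1) 0 3 true (-1) 0 1 t9.
have t11 := only0 2 false 1 1 0 2 1 false 0 1 0 t3.
have t12 := only0 0 true (-1) (-1) 1 0 2 false 1 1 0 t11.
have t13 := only0 3 true 0 1 0 3 0 true 1 1 (-1) t5.
have l := core_content0.
have hh := two0 1 true 0 0 0 1 2 true 0 0 0 1 1 false 0 1 0 l t3.
have hf := only0 1 false 0 0 1 1 1 true 0 0 0 hh.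
have hi := only0 1 true (-1) (-1) 1 1 1 false 0 0 1 hf.
have hg := two0 1 false 1 0 0 1 2 false (-1) 0 1 1 1 true (-1) (-1) 1 t6 hi.
have hj := only0 1 true 0 (-1) 1 1 1 false 1 0 0 hg.
have hm := only0 2 true 1 0 (-1) 2 1 true 0 (-1) 1 hj.
have hn := only0 3 false 0 0 1 2 1 true 0 0 0 hh.
have hb := two0 0 false 0 0 1 0 3 false 0 0 1 0 2 true 0 0 0 hn l.
have hk := only0 2 true 0 (-1) 0 2 0 false 0 0 1 hb.
have ha := only0 0 false 0 (-1) 1 0 2 true 0 (-1) 0 hk.
have ho := two0 3 false 1 0 0 3 0 false 0 (-1) 1 2 1 true 0 (-1) 1 ha hj.
have hc := two0 0 false 1 0 0 0 3 false 1 0 0 0 2 true 1 0 (-1) ho hm.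
have hp := only0 3 false 1 1 0 3 0 false 1 0 0 hc.
have hd := only0 0 false 1 1 0 0 3 false 1 1 0 hp.
have hq := two0 3 true 0 (-1) 0 3 0 true (-1) (-1) 1 2 1 false 0 0 1 t12 hf.
have he := two0 0 true 0 1 0 0 3 true 0 (-1) 0 0 2 false 0 (-1) 1 hq t8.
have hr := two0 2 false 0 1 1 2 1 false 0 0 1 2 0 true 1 0 (-1) hf t10.
have he' := two0 0 true 0 (-1) 0 0 3 true 0 1 0 0 2 false 0 1 1 t13 hr.
rewrite /contacts !inE.
by repeat (case/predU1P => [->//|]); move=> /eqP ->.
Qed.

Lemma neighbour_null u1 u2 b : ~~ [&& b, u1 == 0%Z & u2 == 0%Z] ->
  h (0%N, b, tile_pos u1 u2 b) = 0.
Proof.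
move=> hn; have /andP[r1 r2] := rho_bounds rho3; have q0 := q_neq0 rho3 q2.
have [->|/set0P [z [/= hz [y Fy e]]]] := eqVneq (isect rho q F (0%N, b, tile_pos u1 u2 b)) set0.
  exact: content_set0.
have Fz : F z by case: hz => v Fv ->; rewrite expr0 mul1r.
have hb := F_bounded rho3 q2 F_neq0 F_compact FE.
(* Two points of [F], each of norm at most 2, and the possible shift [lam ^ 3] of norm at most 1. *)
have hp : nrm (ev lam (tile_pos u1 u2 true)) <= 5.
  rewrite (_ : ev _ _ = z + - (sg b * y) + - (if b then 0 else lam ^+ 3)); last first.
    rewrite e expr0 mul1r; case: (b); rewrite ?(ev_tile_posF rho3 q2); ring.
  have -> : 5 = 2 + 2 + 1 :> R by ring.
  apply: le_trans (le_normcD _ _) _; apply: lerD.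
    by apply: le_trans (le_normcD _ _) _; rewrite normcN nrm_sg lerD// hb.
  rewrite normcN; case: (b); first by rewrite Normc.normc0.
  by rewrite nrm_natpow exprn_ile1 ?nrm_ge0// ltW// lamN_lt1.
(* Turns the bounds of [pos_coords] into [5 / |q| < 9] and [10 / rho < 8], so both coordinates fall
   in the box that was searched. *)
have qb : 56 / 100 < `|q|.
  rewrite ltNge; apply/negP => hq; have : `|q| ^+ 2 <= (56 / 100) ^+ 2 by rewrite lerXn2r ?nnegrE.
  by rewrite -normrX ger0_norm ?sqr_ge0// q2; nra.
have [c1 c2] := pos_coords rho3 q2 hp.
have c1' : `|zr R u1 + zr R u2 * rho| < 9.
  by apply: le_lt_trans c1 _; rewrite ltr_pdivrMr ?normr_gt0//; lra.
have c2' : `|zr R u2 * rho - zr R u1| < 8.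
  by apply: le_lt_trans c2 _; rewrite ltr_pdivrMr; lra.
have b1 : `|zr R u1| <= 9 by move: c1' c2'; rewrite !ltr_norml ler_norml; lra.
have b2 : `|zr R u2| <= 9.
  have : `|zr R u2 * rho| <= 9 by move: c1' c2'; rewrite !ltr_norml ler_norml; lra.
  by apply: le_trans; rewrite normrM ler_peMr// ger0_norm; lra.
have inb u : `|zr R u| <= 9 -> u \in zbox 9.
  rewrite ler_norml (_ : 9 = zr R 9)// -zrN !zr_le => /andP[h1 h2].
  by apply: mem_zbox; clear -h1 h2; lia.
have bb : b \in [:: true; false] by rewrite !inE; case: (b).
have := allP (allP (allP contacts_complete u1 (inb _ b1)) u2 (inb _ b2)) b bb.
rewrite /contact_check (negbTE hn); have [/contact_content0 //|_] := boolP ((0%N, b, tile_pos u1 u2 b) \in contacts).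
exact: dead_content.
Qed.

End NullContacts.

(** * The core and its five similarities *)

(* [(e, n, p)] stands for the affine map z |-> e x ^ n z + p. *)
Definition affine : Type := bool * nat * tri.

Definition acomp (f g : affine) : affine :=
  let: (e, n, p) := f in let: (e', n', p') := g in
  (e == e', (n + n')%N, tadd p (tsg e (iter n tmulx p'))).

Definition aid : affine := (true, 0%N, (0, 0, 0)%Z).
Definition asquare : affine := (true, 2%N, (0, 0, 0)%Z).

(* [true] is the left branch x ^ 3 z, [false] the right branch x ^ 2 (1 - z). *)
Definition branch (b : bool) : affine :=
  if b then (true, 3%N, (0, 0, 0)%Z) else (false, 2%N, (0, 0, 1)%Z).

Definition branches (w : seq bool) : affine := foldr (fun b f => acomp (branch b) f) aid w.

(* [(g, swap, u, v)]: the similarity g maps the pair (F, x ^ 2 F) to the pair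
   of subtiles of addresses u and v, in the opposite order if swap is true. *)
Definition gen_table : seq (affine * bool * seq bool * seq bool) :=
  [:: (true, 3%N, (0, 0, 0)%Z, false, [:: true], [:: true]);
      (true, 10%N, (-1, -2, -1)%Z, false,
        [:: false; true; false; true], [:: true; false; false; true]);
      (false, 7%N, (1, 2, 2)%Z, true,
        [:: false; true; false; false], [:: true; false]);
      (false, 9%N, (1, 2, 2)%Z, false,
        [:: false; true; false; false], [:: false; false; false; true]);
      (true, 9%N, (-1, -2, -1)%Z, true,
        [:: false; false; false; false; true], [:: true; false; false])].

Definition gen_entry (i : 'I_5) := nth (aid, false, [::], [::]) gen_table i.
Definition gen i : affine := (gen_entry i).1.1.1.
Definition gen_swap i : bool := (gen_entry i).1.1.2.
Definition gen_fst i : seq bool := (gen_entry i).1.2.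
Definition gen_snd i : seq bool := (gen_entry i).2.
Definition gen_exp i : nat := (gen i).1.2.

Lemma ord5P (P : 'I_5 -> Prop) :
  P (@Ordinal 5 0 isT) -> P (@Ordinal 5 1 isT) -> P (@Ordinal 5 2 isT) ->
  P (@Ordinal 5 3 isT) -> P (@Ordinal 5 4 isT) -> forall i, P i.
Proof.
by move=> p0 p1 p2 p3 p4 [[|[|[|[|[|i]]]]] hi] //; rewrite (bool_irrelevance hi isT).
Qed.

(** Checked in Z[x] / (x ^ 3 - x - 1), so the identities hold at [lam], where the geometry takes
    place, and also at the real conjugate [rho], where ping-pong is played. *)
Lemma gen_fstE i : if gen_swap i then gen i = acomp asquare (branches (gen_snd i))
  else gen i = branches (gen_fst i).
Proof. by elim/ord5P: i; vm_compute. Qed.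

Lemma gen_sndE i : if gen_swap i then acomp (gen i) asquare = branches (gen_fst i)
  else acomp (gen i) asquare = acomp asquare (branches (gen_snd i)).
Proof. by elim/ord5P: i; vm_compute. Qed.

Definition gens (w : seq 'I_5) : affine := foldr (fun i f => acomp (gen i) f) aid w.
Definition gens_swap (w : seq 'I_5) : bool := foldr (fun i b => gen_swap i (+) b) false w.

Fixpoint addresses (w : seq 'I_5) : seq bool * seq bool :=
  if w is i :: w' then
    let uv := addresses w' in
    if gen_swap i then (gen_fst i ++ uv.2, gen_snd i ++ uv.1)
    else (gen_fst i ++ uv.1, gen_snd i ++ uv.2)
  else ([::], [::]).

(** The address pairs of the table form a prefix code: any two entries disagree at a letter that
    both prescribe in the same component. Hence the first generator can be read off. *)
Lemma addresses_inj : injective addresses.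
Proof.
elim=> [|i w IH] [|j w'] //.
- by elim/ord5P: j.
- by elim/ord5P: i.
have step : addresses (i :: w) = addresses (j :: w') ->
    i = j /\ addresses w = addresses w'.
  rewrite /=; case: (addresses w) => u v; case: (addresses w') => u' v'.
  by elim/ord5P: i; elim/ord5P: j => /= h; first [discriminate h | case: h => -> ->].
by move=> /step [-> /IH ->].
Qed.

Section AffineEval.
Variables (A : comNzRingType) (x : A).
Hypothesis x3 : x ^+ 3 = x + 1.

Definition app (f : affine) (z : A) : A :=
  let: (e, n, p) := f in sg e * (x ^+ n * z) + ev x p.

Arguments app : simpl never.

Lemma app_comp f g z : app (acomp f g) z = app f (app g z).
Proof.
case: f g => [[e n] p] [[e' n'] p']; rewrite /app /=.
rewrite ev_add ev_sg ev_iter_mulx// exprD.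
by case: e e' => [] []; rewrite /sg /=; ring.
Qed.

Lemma app_id z : app aid z = z.
Proof. by rewrite /app /= (zr0 _) /sg; ring. Qed.

Lemma app_square z : app asquare z = x ^+ 2 * z.
Proof. by rewrite /app /= (zr0 _) /sg; ring. Qed.

Lemma app_left z : app (branch true) z = x ^+ 3 * z.
Proof. by rewrite /app /= (zr0 _) /sg; ring. Qed.

Lemma app_right z : app (branch false) z = x ^+ 2 * (1 - z).
Proof. by rewrite /app /= (zr0 _) zr1 /sg; ring. Qed.

Lemma app_branches_cons b w z : app (branches (b :: w)) z = app (branch b) (app (branches w) z).
Proof. exact: app_comp. Qed.

Lemma app_branches_cat u v z : app (branches (u ++ v)) z = app (branches u) (app (branches v) z).
Proof. by elim: u => [|b u IH]; rewrite ?app_id// cat_cons !app_branches_cons IH. Qed.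

Lemma app_gens_cons i w z : app (gens (i :: w)) z = app (gen i) (app (gens w) z).
Proof. exact: app_comp. Qed.

Lemma app_gen i z : app (gen i) z =
  if gen_swap i then x ^+ 2 * app (branches (gen_snd i)) z else app (branches (gen_fst i)) z.
Proof. by have := gen_fstE i; case: ifP => _ ->; rewrite ?app_comp ?app_square. Qed.

Lemma app_gen_square i z : app (gen i) (x ^+ 2 * z) =
  if gen_swap i then app (branches (gen_fst i)) z else x ^+ 2 * app (branches (gen_snd i)) z.
Proof.
rewrite -app_square -app_comp; have := gen_sndE i.
by case: ifP => _ ->; rewrite ?app_comp ?app_square.
Qed.

Lemma app_gens w z :
  app (gens w) z = (if gens_swap w then x ^+ 2 * app (branches (addresses w).2) z
                    else app (branches (addresses w).1) z) /\
  app (gens w) (x ^+ 2 * z) = (if gens_swap w then app (branches (addresses w).1) z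
                    else x ^+ 2 * app (branches (addresses w).2) z).
Proof.
elim: w => [|i w [IH1 IH2]]; first by rewrite /= app_id app_id.
rewrite !app_gens_cons IH1 IH2 /=.
case: (gens_swap w); case s: (gen_swap i) => /=;
  by split; rewrite ?app_gen_square ?app_gen s ?app_branches_cat.
Qed.

End AffineEval.
Arguments app : simpl never.

(** * Ping-pong on the unit interval for the real conjugates *)

Section PingPong.
Variables (R : realType) (rho : R).
Hypothesis rho3 : rho ^+ 3 = rho + 1.
Notation app := (app rho).

Lemma branches_rcons w b z : app (branches (rcons w b)) z = app (branches w) (app (branch b) z).
Proof. by rewrite -cats1 app_branches_cat// app_branches_cons// app_id. Qed.

(** The real branches are the two laps of a tent map, which cut the unit interval at
    [rho ^- 3 = 1 - rho ^- 2]. *)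
Lemma branch_surj b t : exists2 z, app (branch b) z = t &
  (0 < t < 1 -> if b then 0 < z < rho ^- 3 else rho ^- 3 < z < 1).
Proof.
have r0 := rho_gt0 rho3; have r3 : 0 < rho ^+ 3 by rewrite exprn_gt0.
have r2 : 0 < rho ^+ 2 by rewrite exprn_gt0.
case: b; [exists (t / rho ^+ 3) | exists (1 - t / rho ^+ 2)].
- by rewrite app_left mulrC divfK ?lt0r_neq0.
- by move=> /andP[t0 t1]; rewrite divr_gt0//= ltr_pdivrMr// mulVf ?lt0r_neq0.
- by rewrite app_right subKr mulrC divfK ?lt0r_neq0.
move=> /andP[t0 t1]; apply/andP; split; last by rewrite ltrBlDr ltrDl divr_gt0.
have -> : rho ^- 3 = 1 - rho ^- 2.
  apply: (mulfI (lt0r_neq0 r3)); rewrite divff ?lt0r_neq0// mulrBr mulr1.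
  by rewrite {2}exprSr mulrAC divff ?lt0r_neq0// mul1r rho3 addrAC subrr add0r.
by rewrite ltrD2l ltrN2 ltr_pdivrMr// mulVf ?lt0r_neq0.
Qed.

Lemma branches_fst w b t : 0 < t < 1 -> exists z, app (branches (rcons w b)) z = t /\
  if b then 0 < z < rho ^- 3 else rho ^- 3 < z < 1.
Proof.
have r0 := rho_gt0 rho3; have r1 := rho_gt1 rho3.
have r3 : rho ^- 3 < 1 by rewrite invf_lt1 ?exprn_gt0// exprn_egt1.
elim: w b t => [|c w IH] b t t01.
  have [z hz h] := branch_surj b t.
  by exists z; rewrite branches_rcons app_id; split=> //; exact: h.
have [y hy h] := branch_surj c t.
have y01 : 0 < y < 1.
  have r3' : 0 < rho ^- 3 by rewrite invr_gt0 exprn_gt0.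
  by case: (c) (h t01) => /andP[h1 h2]; rewrite ?h1 ?h2 ?(lt_trans r3' h1) ?(lt_trans h2 r3).
have [z [hz1 hz2]] := IH b y y01.
by exists z; rewrite rcons_cons app_branches_cons// hz1 hy.
Qed.

Lemma app_inj f : injective (app f).
Proof.
case: f => [[e n] p] z z' /addIr.
have h : sg e != 0 :> R by case: (e); rewrite /sg ?oppr_eq0 oner_eq0.
by move=> /(mulfI h) /mulfI; apply; rewrite expf_neq0// lt0r_neq0// rho_gt0.
Qed.

(* Ping-pong: the inverses of the two real branches map the unit interval to
   disjoint intervals, so the last letter can be read off the map. *)
Lemma branches_inj u v : app (branches u) =1 app (branches v) -> u = v.
Proof.
have r0 := rho_gt0 rho3; have r1 := rho_gt1 rho3.
have r3 : rho ^- 3 < 1 by rewrite invf_lt1 ?exprn_gt0// exprn_egt1.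
have r3' : 0 < rho ^- 3 by rewrite invr_gt0 exprn_gt0.
have nil_rcons w b : ~ (app aid =1 app (branches (rcons w b))).
  (* The point is taken in the interval of the other letter, which a word ending in [b] cannot
     fix. *)
  move=> h; pose t := if b then (rho ^- 3 + 1) / 2 else rho ^- 3 / 2.
  have t01 : 0 < t < 1 by rewrite /t; case: (b); apply/andP; split; lra.
  have [z [hz hb]] := branches_fst w b t01.
  move: hb; rewrite -(app_id rho z) h hz /t; case: (b) => /andP[]; lra.
elim/last_ind: u v => [|u a IH] v; elim/last_ind: v => [|v b _] //.
- by move=> /nil_rcons.
- by move=> h; exfalso; apply: (nil_rcons u a) => z; rewrite h.
move=> h; have ab : a = b.
  have t01 : 0 < (2^-1 : R) < 1 by rewrite invr_gt0 ltr0n invf_lt1// ltr1n.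
  have [z [hz hb]] := branches_fst u a t01.
  have [y [hy hb']] := branches_fst v b t01.
  have zy : z = y by apply: (@app_inj (branches (rcons u a))); rewrite hz h hy.
  move: hb hb'; rewrite zy; case: (a); case: (b) => // /andP[h1 h2] /andP[h3 h4]; lra.
rewrite ab (IH v) // => z; have [y <- _] := branch_surj b z.
by rewrite -!branches_rcons -ab h ab.
Qed.

(** Equal maps with equal swaps induce the same two address maps on the real line; ping-pong
    recovers both addresses and the prefix code recovers the word. *)
Lemma gens_inj w w' : gens w = gens w' -> gens_swap w = gens_swap w' -> w = w'.
Proof.
have r2 : rho ^+ 2 != 0 by rewrite expf_neq0// lt0r_neq0// rho_gt0.
move=> e es; apply: addresses_inj.
have h1 z := (app_gens rho3 w z).1; have h2 z := (app_gens rho3 w z).2.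
have h1' z := (app_gens rho3 w' z).1; have h2' z := (app_gens rho3 w' z).2.
rewrite e in h1 h2; rewrite es in h1 h2.
case: (addresses w) (addresses w') h1 h2 h1' h2' => u v [u' v'] /= h1 h2 h1' h2'.
have -> : u = u'.
  apply: branches_inj => z; move: (h1 z) (h2 z); rewrite h1' h2'.
  by case: (gens_swap w').
have -> : v = v' => //.
apply: branches_inj => z; move: (h1 z) (h2 z); rewrite h1' h2'.
by case: (gens_swap w') => [/(mulfI r2)|_ /(mulfI r2)].
Qed.

End PingPong.

(** * Lower bound for the content of the core *)

(* The words whose similarity ratio first drops to at most x ^ n, for fuel f >= n. *)
Fixpoint cut (f n : nat) : seq (seq 'I_5) :=
  if f is f'.+1 then
    if n is 0 then [:: [::]]
    else [seq i :: w | i <- enum 'I_5, w <- cut f' (n - gen_exp i)]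
  else [:: [::]].

Definition wexp (w : seq 'I_5) : nat := (gens w).1.2.

Lemma wexp_cons i w : wexp (i :: w) = (gen_exp i + wexp w)%N.
Proof. by rewrite /wexp /gen_exp /=; case: (gen i) => [[e n] p]; case: (gens w) => [[e' n'] p']. Qed.

Lemma gen_exp_bounds i : (3 <= gen_exp i <= 10)%N.
Proof. by elim/ord5P: i. Qed.

(** Before its last letter the word has exponent below [n], and a letter adds at most 10, whence the
    excess 9. *)
Lemma cut_wexp f n w : (n <= f)%N -> w \in cut f n -> (n <= wexp w <= n + 9)%N.
Proof.
elim: f n w => [|f IH] n w nf; first by rewrite inE => /eqP ->; move: nf; rewrite leqn0 => /eqP ->.
case: n nf => [|n] nf; first by rewrite inE => /eqP ->.
move=> /allpairsPdep [i [v [_ vc ->]]]; rewrite wexp_cons.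
have := gen_exp_bounds i; have [le|gt] := leqP n.+1 (gen_exp i).
  have e : (n.+1 - gen_exp i = 0)%N by apply/eqP.
  have -> : v = [::] by move: vc; rewrite e; case: (f) => [|f']; rewrite inE => /eqP.
  by rewrite /wexp /=; lia.
by have := IH (n.+1 - gen_exp i)%N v _ vc; lia.
Qed.

Lemma cut_uniq f n : uniq (cut f n).
Proof.
elim: f n => [|f IH] [|n] //=; apply: allpairs_uniq_dep => //.
- by rewrite enum_uniq.
- by move=> [i w] [j v] _ _ [-> ->].
Qed.

Lemma mem_bools b : b \in [:: true; false]. Proof. by case: b. Qed.

Lemma taddI p p' r : tadd p r = tadd p' r -> p = p'.
Proof.
case: p p' r => [[a b] c] [[a' b'] c'] [[a'' b''] c''] [] h1 h2 h3.
by congr (_, _, _); lia.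
Qed.

Lemma iter_tdivx_inj n : injective (iter n tdivx).
Proof. by elim: n => // n IH p p' /= /(can_inj tdivxK) /IH. Qed.

Section LowerBound.
Variables (R : realType) (rho q : R).
Hypothesis rho3 : rho ^+ 3 = rho + 1.
Hypothesis q2 : q ^+ 2 = 3 / 4 * rho ^+ 2 - 1.
Notation lam := (conj_root rho q).
Notation lamN := (conj_modulus rho q).
Let lam3 := lam3 rho3 q2.
Variable F : set R[i].
Hypothesis F_neq0 : F !=set0.
Hypothesis F_compact : compact F.
Hypothesis FE : F = [set lam ^+ 3 * z | z in F] `|` [set lam ^+ 2 * (1 - z) | z in F].
Let F_left := F_left FE.
Let F_right := F_right FE.
Let F_bounded := F_bounded rho3 q2 F_neq0 F_compact FE.
Notation capp := (app lam).

Definition core : set R[i] := [set z | F z /\ exists2 y, F y & z = lam ^+ 2 * y].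

Lemma F_branches w z : F z -> F (capp (branches w) z).
Proof.
elim: w => [|b w IH] Fz; first by rewrite app_id.
by rewrite app_branches_cons//; case: b; rewrite ?app_left ?app_right;
  [exact/F_left/IH | exact/F_right/IH].
Qed.

(** A generator carries the pair ([F], [lam ^ 2 F]) to subtiles of the same two sets, possibly
    exchanged, so common points go to common points. *)
Lemma core_gen i z : core z -> core (capp (gen i) z).
Proof.
move=> [Fz [y Fy e]]; split.
  have [e1 e2] := (app_gen lam3 i z, app_gen_square lam3 i y).
  case s : (gen_swap i) e1 e2 => e1 e2; last by rewrite e1; exact: F_branches.
  by rewrite e e2; exact: F_branches.
have [e1 e2] := (app_gen lam3 i z, app_gen_square lam3 i y).
case s : (gen_swap i) e1 e2 => e1 e2.
  by exists (capp (branches (gen_snd i)) z) => //; exact: F_branches.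
by exists (capp (branches (gen_snd i)) y); [exact: F_branches | rewrite e e2].
Qed.

Lemma F_zero : F 0.
Proof.
have [z Fz] := F_neq0.
have FX n : F (lam ^+ (3 * n) * z).
  elim: n => [|n IH]; first by rewrite muln0 expr0 mul1r.
  by rewrite mulnS exprD -mulrA; exact: F_left.
apply: (closed_discP F).1 (F_closed F_compact) _ _ => r r0.
have hl0 := lamN_gt0 rho3 q2; have hl1 := lamN_lt1 rho3 q2.
have [n hn] : exists n, lamN ^+ n < r / 2 by apply: pow_lt1; [rewrite ltW | rewrite divr_gt0].
exists (lam ^+ (3 * n) * z) => //; rewrite subr0 nrm_lamX.
apply: le_lt_trans (_ : lamN ^+ n * 2 < r); last by rewrite -ltr_pdivlMr.
apply: ler_pM; rewrite ?exprn_ge0 ?nrm_ge0 ?(ltW hl0) ?F_bounded//.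
by apply: ler_wiXn2l; rewrite ?(ltW hl0) ?(ltW hl1)//; lia.
Qed.

Lemma core_zero : core 0.
Proof. by split; [exact: F_zero | exists 0; rewrite ?mulr0//; exact: F_zero]. Qed.

Variable s : R.
Hypothesis s0 : 0 < s.
Let x : R := lamN `^ s.
Hypothesis moran_eq1 : moran x = 1.

Let x0 : 0 < x. Proof. by rewrite powR_gt0// (lamN_gt0 rho3 q2). Qed.
Let x1 : x < 1.
Proof.
rewrite ltNge; apply/negP => h; have h3 : 1 <= x ^+ 3 by rewrite exprn_ege1.
have : 0 < x ^+ 7 by rewrite exprn_gt0.
have : 0 < x ^+ 9 by rewrite exprn_gt0.
have : 0 < x ^+ 10 by rewrite exprn_gt0.
by move: moran_eq1 h3; rewrite /moran; lra.
Qed.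

Lemma weights1 : \sum_(i < 5) x ^+ gen_exp i = 1.
Proof. by rewrite !big_ord_recr big_ord0 -moran_eq1 /moran /gen_exp /=; ring. Qed.

Definition hit (U : set R[i]) : R := `[< exists2 z, core z & U z >]%:R.
Definition pre (f : affine) (U : set R[i]) : set R[i] := [set z | U (capp f z)].

(** A finite-depth substitute for the self-similar measure: the total Bernoulli weight of the words
    of length [n] whose image of the core meets [U]. *)
Fixpoint mass (n : nat) (U : set R[i]) : R :=
  if n is n'.+1 then \sum_(i < 5) x ^+ gen_exp i * mass n' (pre (gen i) U) else hit U.

Fixpoint cut_mass (f n : nat) (U : set R[i]) : R :=
  if f is f'.+1 then
    if n is 0 then hit U
    else \sum_(i < 5) x ^+ gen_exp i * cut_mass f' (n - gen_exp i) (pre (gen i) U)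
  else hit U.

Lemma hit_le1 U : hit U <= 1.
Proof. by rewrite /hit; case: asboolP. Qed.

Lemma hit_pre i U : hit (pre (gen i) U) <= hit U.
Proof.
rewrite /hit; case: asboolP => [[z cz Uz]|_]; last exact: ler0n.
by case: asboolP => // h; exfalso; apply: h; exists (capp (gen i) z) => //; exact: core_gen.
Qed.

Lemma mass_hit n U : mass n U <= hit U.
Proof.
elim: n U => [|n IH] U //=.
apply: le_trans (_ : \sum_(i < 5) x ^+ gen_exp i * hit U <= _).
  by apply: ler_sum => i _; rewrite ler_wpM2l ?exprn_ge0 ?(ltW x0)// (le_trans (IH _))// hit_pre.
by rewrite -mulr_suml weights1 mul1r.
Qed.

Lemma mass_core n U : core `<=` U -> mass n U = 1.
Proof.
elim: n U => [|n IH] U h /=.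
  rewrite /hit; case: asboolP => // h'; exfalso; apply: h'; exists 0; first exact: core_zero.
  exact/h/core_zero.
rewrite -[RHS]weights1; apply: eq_bigr => i _; rewrite IH ?mulr1// => z cz.
exact/h/core_gen.
Qed.

Lemma massU n U V : mass n (U `|` V) <= mass n U + mass n V.
Proof.
elim: n U V => [|n IH] U V /=; last first.
  rewrite -big_split /=; apply: ler_sum => i _; rewrite -mulrDr.
  by rewrite ler_wpM2l ?exprn_ge0 ?(ltW x0)//; exact: IH.
rewrite /hit; case: asboolP => [[z cz [Uz|Vz]]|_]; last by rewrite addr_ge0// ler0n.
  case: (asboolP (exists2 z, core z & U z)) => [_|h]; first by rewrite lerDl ler0n.
  by exfalso; apply: h; exists z.
case: (asboolP (exists2 z, core z & V z)) => [_|h]; first by rewrite lerDr ler0n.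
by exfalso; apply: h; exists z.
Qed.

(** Words of the cut have at most [f] letters, so depth [N] refines them all, and by [mass_hit]
    refining only lowers the mass. *)
Lemma mass_cut f n N U : (f <= N)%N -> mass N U <= cut_mass f n U.
Proof.
elim: f n N U => [|f IH] n N U fN /=; first exact: mass_hit.
case: n => [|n]; first exact: mass_hit.
case: N fN => // N fN /=; apply: ler_sum => i _.
by rewrite ler_wpM2l ?exprn_ge0 ?(ltW x0)// IH.
Qed.

Lemma cut_massE f n U : cut_mass f n U = \sum_(w <- cut f n) x ^+ wexp w * hit (pre (gens w) U).
Proof.
have base V : hit V = \sum_(w <- [:: [::]]) x ^+ wexp w * hit (pre (gens w) V).
  rewrite big_seq1 /wexp /= expr0 mul1r; congr hit.
  by apply/seteqP; split => z; rewrite /pre /= app_id.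
elim: f n U => [|f IH] n U //=; case: n => [|n] //.
rewrite big_allpairs_dep big_enum /=; apply: eq_bigr => i _.
rewrite IH mulr_sumr; apply: eq_bigr => w _.
rewrite wexp_cons exprD mulrA; congr (_ * hit _).
by apply/seteqP; split => z; rewrite /pre /= app_comp.
Qed.

Lemma linear_bound (a b c r B D E : R) : 1 <= r <= 2 -> 2 <= 3 * r ^+ 2 - 1 ->
  `|b - c * r| <= D -> `|a - b * r / 2 + c * (1 - r ^+ 2 / 2)| <= B ->
  `|a + b * r + c * r ^+ 2| <= E -> 
  [/\ `|a| <= 100 * (B + D + E), `|b| <= 100 * (B + D + E) & `|c| <= 100 * (B + D + E)].
Proof.
move=> /andP[r1 r2] r3 h1 h2 h3.
have B0 := le_trans (normr_ge0 _) h2; have D0 := le_trans (normr_ge0 _) h1.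
have E0 := le_trans (normr_ge0 _) h3.
have hc : `|c| <= B + 3 * D + E.
  have e : c * (3 * r ^+ 2 - 1) = (a + b * r + c * r ^+ 2) - (a - b * r / 2 + c * (1 - r ^+ 2 / 2))
     - 3 / 2 * r * (b - c * r) by field.
  have h : `|c| * 2 <= `|c * (3 * r ^+ 2 - 1)|.
    by rewrite normrM (@ger0_norm _ (3 * r ^+ 2 - 1)) ?ler_wpM2l//; lra.
  have h4 : `|3 / 2 * r * (b - c * r)| <= 3 * D.
    rewrite normrM ger0_norm; last by lra.
    by apply: ler_pM => //; lra.
  have := ler_normB (a + b * r + c * r ^+ 2 - (a - b * r / 2 + c * (1 - r ^+ 2 / 2))) (3 / 2 * r * (b - c * r)).
  have := ler_normB (a + b * r + c * r ^+ 2) (a - b * r / 2 + c * (1 - r ^+ 2 / 2)).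
  move: h; rewrite e; lra.
have hb : `|b| <= 2 * B + 7 * D + 2 * E.
  rewrite (_ : b = (b - c * r) + c * r); last by ring.
  have : `|c * r| <= (B + 3 * D + E) * 2 by rewrite normrM ler_pM// ger0_norm//; lra.
  have := ler_normD (b - c * r) (c * r); lra.
have ha : `|a| <= 10 * B + 40 * D + 10 * E.
  rewrite (_ : a = (a + b * r + c * r ^+ 2) - b * r - c * r ^+ 2); last by ring.
  have h5 : `|b * r| <= (2 * B + 7 * D + 2 * E) * 2 by rewrite normrM ler_pM// ger0_norm//; lra.
  have h6 : `|c * r ^+ 2| <= (B + 3 * D + E) * 4.
    by rewrite normrM ler_pM// ger0_norm ?sqr_ge0//; nra.
  have := ler_normB (a + b * r + c * r ^+ 2 - b * r) (c * r ^+ 2).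
  have := ler_normB (a + b * r + c * r ^+ 2) (b * r); lra.
split; lra.
Qed.

(** Z[x] is a lattice under the real and complex embeddings jointly, so bounding both leaves
    finitely many elements. *)
Lemma coords_bounded (B B' : R) : exists K : nat, forall p : tri,
  nrm (ev lam p) <= B -> `|ev rho p| <= B' ->
  p \in [seq (ab, c) | ab <- [seq (a, b) | a <- zbox K, b <- zbox K], c <- zbox K].
Proof.
have /andP[r1 r2] := rho_bounds rho3; have q0 := q_neq0 rho3 q2.
have [K HK] := zr_bound (100 * (B + B / `|q| + B')).
exists K => -[[a b] c] h h'.
have [|||||ha hb hc] := @linear_bound (zr R a) (zr R b) (zr R c) rho B (B / `|q|) B'.
- by apply/andP; split; lra.
- by nra.
- rewrite ler_pdivlMr ?normr_gt0// -normrM; apply: le_trans h.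
  by have := nrm_Im (ev lam (a, b, c)); rewrite {1}(ev_lamE q2) [complex.Im _]/= mulrC.
- apply: le_trans h.
  by have := nrm_Re (ev lam (a, b, c)); rewrite {1}(ev_lamE q2) [complex.Re _]/=.
- exact: h'.
apply: (allpairs_f pair); last exact/mem_zbox/HK.
by apply: (allpairs_f pair); exact/mem_zbox/HK.
Qed.

(** The subtracted 8 makes the induction close: [8 a - 8 + a (8 b - 8) = 8 a b - 8]. *)
Lemma gens_real_bound w : `|ev rho (gens w).2| <= 8 * rho ^+ wexp w - 8.
Proof.
have /andP[r1 r2] := rho_bounds rho3; have r0 := rho_gt0 rho3.
elim: w => [|i w IH]; first by rewrite /wexp /= (zr0 _) !mul0r !addr0 normr0 mulr1 subrr.
rewrite wexp_cons.
have gi : `|ev rho (gen i).2| <= 8 * rho ^+ gen_exp i - 8.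
  have r3 : 2 <= rho ^+ 3 by rewrite rho3; lra.
  have rn n : (3 <= n)%N -> 2 <= rho ^+ n.
    by move=> hn; apply: le_trans r3 _; apply: ler_weXn2l => //; lra.
  have rsq : rho ^+ 2 < 176 / 100 by nra.
  have rsq0 : 0 < rho ^+ 2 by rewrite exprn_gt0.
  apply: le_trans (_ : 8 <= _); last first.
    by have /andP[/rn h _] := gen_exp_bounds i; lra.
  have E0 : `|ev rho (0, 0, 0)%Z| <= 8 by rewrite /ev (zr0 _) !mul0r !addr0 normr0.
  have E1 : `|ev rho (1, 2, 2)%Z| <= 8.
    rewrite /ev (_ : zr _ 1 = 1)// (_ : zr _ 2 = 2)// ler_norml; clear IH; lra.
  have E2 : `|ev rho (-1, -2, -1)%Z| <= 8.
    rewrite /ev (_ : zr _ (-1) = -1)// (_ : zr _ (-2) = -2)// ler_norml; clear IH; lra.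
  by elim/ord5P: i {IH}.
rewrite /gens /= -/(gens w); move: gi IH; rewrite /gen_exp /wexp.
case: (gen i) => [[e n] p]; case: (gens w) => [[e' n'] p'] /= gi IH.
rewrite ev_add ev_sg (ev_iter_mulx _ _ rho3); apply: le_trans (ler_normD _ _) _.
have -> : `|sg e * (rho ^+ n * ev rho p')| = rho ^+ n * `|ev rho p'|.
  rewrite !normrM (ger0_norm (_ : 0 <= rho ^+ n)) ?exprn_ge0 ?(ltW r0)//.
  by case: (e); rewrite /sg ?normrN normr1 mul1r.
apply: le_trans (lerD gi (ler_wpM2l _ IH)) _; first by rewrite exprn_ge0 ?ltW.
by rewrite exprD; lra.
Qed.

(** Words are told apart by finitely many keys: swap, sign, excess exponent, and the anchor relative
    to that of one fixed word, divided by [x ^ n]. The relative anchor is bounded at both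
    embeddings. *)
Lemma filter_bound : exists M : nat, forall n (z : R[i]) U,
  U `<=` [set w | nrm (w - z) <= lamN ^+ n] ->
  (size [seq w <- cut n n | `[< exists2 y, core y & pre (gens w) U y >]] <= M)%N.
Proof.
have l0 := lamN_gt0 rho3 q2; have l1 := lamN_lt1 rho3 q2; have r0 := rho_gt0 rho3.
(* Differences of two anchors: each lies within [3 |lam| ^ n] of [z], and its real conjugate is at
   most [8 rho ^ (n + 9)]. *)
have [K HK] := coords_bounded 6 (16 * rho ^+ 9).
pose box := [seq (ab, c) | ab <- [seq (a, b) | a <- zbox K, b <- zbox K], c <- zbox K].
pose keys := [seq (bk, p) | bk <- [seq (b, k) | b <- [seq (b1, b2) | b1 <- [:: true; false], b2 <- [:: true; false]], k <- iota 0 10], p <- box].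
exists (size keys) => n z U hU.
set sq := (X in size X).
pose p0 := iter n tdivx (gens (head [::] sq)).2.
pose key w := (gens_swap w, (gens w).1.1, (wexp w - n)%N, tadd (iter n tdivx (gens w).2) (topp p0)).
have near w : w \in sq -> nrm (ev lam (gens w).2 - z) <= 3 * lamN ^+ n /\ (n <= wexp w <= n + 9)%N.
  rewrite mem_filter => /andP[/asboolP [y [Fy _] hy] wc].
  have wb := cut_wexp (leqnn n) wc; split=> //.
  have /= := hU _ hy; rewrite /app; move: wb; rewrite /wexp; case: (gens w) => [[e k] p] /= /andP[kn _] h.
  rewrite (_ : _ - z = (sg e * (lam ^+ k * y) + ev lam p - z) - sg e * (lam ^+ k * y)); last by ring.
  apply: le_trans (le_normcD _ _) _; rewrite normcN nrm_sg nrm_lamX.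
  have : lamN ^+ k * nrm y <= lamN ^+ n * 2.
    by apply: ler_pM; rewrite ?exprn_ge0 ?nrm_ge0 ?F_bounded ?(ltW l0)// ler_wiXn2l// ltW.
  by move: h; lra.
have rb w : w \in sq -> `|ev rho (gens w).2| <= 8 * rho ^+ (n + 9).
  move=> /near [_ /andP[_ h]]; apply: le_trans (gens_real_bound w) _.
  have : rho ^+ wexp w <= rho ^+ (n + 9) by apply: ler_weXn2l => //; exact/ltW/rho_gt1.
  by lra.
rewrite -(size_map key); apply: uniq_leq_size.
  rewrite map_inj_in_uniq; first by rewrite filter_uniq// cut_uniq.
  move=> w w' /near [_ /andP[h1 _]] /near [_ /andP[h1' _]] [e1 e2 e3 e4].
  apply: (gens_inj rho3) => //.
  have e5 := taddI e4.
  have e6 : wexp w = wexp w' by rewrite -(subnK h1) -(subnK h1') e3.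
  move: e2 (iter_tdivx_inj e5) e6; rewrite /wexp.
  by case: (gens w) => [[? ?] ?]; case: (gens w') => [[? ?] ?] /= -> -> ->.
move=> _ /mapP[w wsq ->]; have [h1 /andP[h2 h3]] := near w wsq.
have p0sq : head [::] sq \in sq by case: (sq) wsq => //= a l _; rewrite inE eqxx.
have [h1' _] := near _ p0sq.
apply: (allpairs_f pair).
  apply: (allpairs_f pair); last by rewrite mem_iota; clear -h2 h3; lia.
  by apply: (allpairs_f pair); exact: mem_bools.
apply: HK; rewrite ev_add ev_opp.
  rewrite -(ler_pM2l (_ : 0 < lamN ^+ n)) ?exprn_gt0// -nrm_lamX mulrBr !(ev_iter_divx _ _ lam3).
  rewrite (_ : _ - _ = (ev lam (gens w).2 - z) - (ev lam (gens (head [::] sq)).2 - z)); last by ring.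
  apply: le_trans (le_normcD _ _) _; rewrite normcN; lra.
rewrite -(ler_pM2l (_ : 0 < rho ^+ n)) ?exprn_gt0//.
rewrite -{1}(gtr0_norm (_ : 0 < rho ^+ n)) ?exprn_gt0// -normrM mulrBr !(ev_iter_divx _ _ rho3).
apply: le_trans (ler_normB _ _) _; have := rb _ wsq; have := rb _ p0sq.
by rewrite exprD; lra.
Qed.

Lemma cut_mass_bound : exists2 M : R, 0 < M & forall n (z : R[i]) U,
  U `<=` [set w | nrm (w - z) <= lamN ^+ n] -> cut_mass n n U <= M * x ^+ n.
Proof.
have [M HM] := filter_bound; exists M.+1%:R => // n z U hU.
rewrite cut_massE; apply: le_trans (_ : M%:R * x ^+ n <= _); last first.
  by rewrite ler_wpM2r ?exprn_ge0 ?(ltW x0)// ler_nat.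
pose P w := `[< exists2 y, core y & pre (gens w) U y >].
rewrite (bigID P) /= [X in _ + X]big1 ?addr0; last first.
  by move=> w; rewrite /P /hit => /negbTE ->; rewrite mulr0.
apply: le_trans (_ : \sum_(w <- cut n n | P w) x ^+ n <= _).
  rewrite big_seq_cond [X in _ <= X]big_seq_cond; apply: ler_sum => w /andP[wc _].
  have /andP[h _] := cut_wexp (leqnn n) wc.
  rewrite -[X in _ <= X]mulr1; apply: ler_pM; rewrite ?exprn_ge0 ?(ltW x0)//.
  - by apply: ler_wiXn2l; rewrite ?(ltW x0) ?(ltW x1).
  - exact: hit_le1.
rewrite big_const_seq -size_filter iter_addr_0 -[X in X <= _]mulr_natl ler_wpM2r ?exprn_ge0 ?(ltW x0)//.
by rewrite ler_nat; apply: HM hU.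
Qed.

(** The Frostman estimate. The threshold [N0] depends on the disc because the cut at its scale must
    be reached. *)
Lemma mass_disc : exists2 K : R, 0 < K & forall d : R[i] * R, 0 < d.2 ->
  exists N0, forall N, (N0 <= N)%N -> mass N [set w | nrm (w - d.1) <= d.2] <= K * d.2 `^ s.
Proof.
have l0 := lamN_gt0 rho3 q2; have l1 := lamN_lt1 rho3 q2.
have [M M0 HM] := cut_mass_bound.
exists (1 + M / x); first by rewrite addr_gt0// divr_gt0.
move=> [z r] /= r0; have [r1|r1] := ltP 1 r.
  exists 0%N => N _; apply: le_trans (mass_hit _ _) _; apply: le_trans (hit_le1 _) _.
  have h : 1 <= r `^ s.
    have := @ge0_ler_powR _ s (ltW s0) 1 r; rewrite powR1 !nnegrE.
    by apply; rewrite ?ltW.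
  have h2 : 0 <= M / x by rewrite ltW// divr_gt0.
  by rewrite mulrDl mul1r; have := mulr_ge0 h2 (le_trans ler01 h); lra.
(* The least such [n] gives [|lam| ^ n.+1 < r <= |lam| ^ n]; comparing [x ^ n] with [r ^ s] costs
   the factor [1 / x]. *)
have ex : exists n, lamN ^+ n.+1 < r.
  have [n hn] : exists n, lamN ^+ n < r by apply: pow_lt1; rewrite // ltW.
  exists n; apply: le_lt_trans hn; apply: ler_wiXn2l; rewrite ?(ltW l0) ?(ltW l1)//.
pose n := ex_minn ex.
have [n1 n2] : lamN ^+ n.+1 < r /\ r <= lamN ^+ n.
  rewrite /n; case: ex_minnP => -[|m] hm hmin; first by rewrite expr0.
  by split=> //; rewrite leNgt; apply/negP => /hmin; rewrite ltnn.
exists n => N nN; apply: le_trans (mass_cut n _ nN) _.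
have /HM : [set w | nrm (w - z) <= r] `<=` [set w | nrm (w - z) <= lamN ^+ n].
  by move=> w /= /le_trans; apply.
move=> /le_trans; apply.
have h : x ^+ n.+1 <= r `^ s.
  have lnn : 0 <= lamN ^+ n.+1 by rewrite exprn_ge0// ltW.
  have -> : x ^+ n.+1 = (lamN ^+ n.+1) `^ s.
    by rewrite -[lamN ^+ _]powR_mulrn ?(ltW l0)// powRAC powR_mulrn// powR_ge0.
  by rewrite ge0_ler_powR ?nnegrE ?(ltW s0) ?(ltW n1)// ltW.
rewrite mulrDl mul1r; apply: le_trans (_ : M / x * r `^ s <= _); last by rewrite lerDr powR_ge0.
apply: le_trans (_ : M / x * x ^+ n.+1 <= _).
  by rewrite exprS mulrA divfK ?lt0r_neq0.
by rewrite ler_wpM2l// ltW// divr_gt0.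
Qed.

(** Mass distribution principle: a finite cover admits a common depth at which its discs satisfy the
    Frostman estimate, while their union has mass 1. *)
Lemma core_cost : exists2 c0 : R, 0 < c0 & forall l, covers l core -> c0 <= cost s l.
Proof.
have [K K0 HK] := mass_disc; exists K^-1; first by rewrite invr_gt0.
have main l : (forall d, d \in l -> 0 < d.2) -> exists N0, forall N, (N0 <= N)%N ->
    mass N [set w | exists2 d, d \in l & nrm (w - d.1) <= d.2] <= K * cost s l.
  elim: l => [|d l IH] hl.
    exists 0%N => N _; rewrite /cost big_nil mulr0; apply: le_trans (mass_hit _ _) _.
    by rewrite /hit; case: asboolP => // -[z _ [d]].
  have [|N1 H1] := IH; first by move=> d' h; apply: hl; rewrite inE h orbT.
  have [|N2 H2] := HK d; first by apply: hl; rewrite inE eqxx.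
  exists (maxn N1 N2) => N; rewrite geq_max => /andP[/H1 h1 /H2 h2].
  rewrite /cost big_cons mulrDr -/(cost s l); apply: le_trans (lerD h2 h1).
  apply: le_trans (massU _ _ _); rewrite le_eqVlt; apply/orP; left; apply/eqP; congr mass.
  apply/seteqP; split => [w [d']|w [h|[d' dl h]]].
  - by rewrite inE => /predU1P[->|dl] h; [left | right; exists d'].
  - by exists d; rewrite ?inE ?eqxx.
  - by exists d'; rewrite ?inE ?dl ?orbT.
move=> l [l0 hl]; have [N0 HN] := main l l0.
have := HN N0 (leqnn _); rewrite mass_core; last by move=> z /hl.
by move=> h; rewrite -[K^-1]mul1r ler_pdivrMr// mulrC.
Qed.

End LowerBound.

(** * The dominant root and the numerical values *)

Section DominantRoot.
Variable R : realType.

Lemma mu_polyE (K : comNzRingType) (w : K) : (mu_poly K).[w] =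
  w ^+ 10 - w ^+ 7 - 4 * w ^+ 5 - 4 * w ^+ 4 - w ^+ 3 - 4 * w ^+ 2 - 4 * w + 1.
Proof.
by rewrite /mu_poly !(hornerD, hornerN, hornerZ, hornerXn, hornerX, hornerC).
Qed.

(** The Moran equation for [1 / y], multiplied by [y ^ 10]. *)
Definition char_poly_root (K : nzRingType) (y : K) :=
  y ^+ 10 = y ^+ 7 + y ^+ 3 + 2 * y + 1.

Lemma mu_poly_sqr (K : comNzRingType) (y : K) : (mu_poly K).[y ^+ 2] =
  (y ^+ 10 - (y ^+ 7 + y ^+ 3 + 2 * y + 1)) *
  ((- y) ^+ 10 - ((- y) ^+ 7 + (- y) ^+ 3 + 2 * (- y) + 1)).
Proof. by rewrite mu_polyE; ring. Qed.

Lemma theta_exists : exists th : R,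
  1 + 270 / 10 ^+ 3 + 36 / 10 ^+ 6 + 245 / 10 ^+ 9 < th <
  1 + 270 / 10 ^+ 3 + 36 / 10 ^+ 6 + 246 / 10 ^+ 9 /\ char_poly_root th.
Proof.
set a : R := 1 + _ + _ + 245 / _; set b : R := 1 + _ + _ + 246 / _.
pose p : {poly R} := 'X^10 - 'X^7 - 'X^3 - 2 *: 'X - 1.
have pE y : p.[y] = y ^+ 10 - y ^+ 7 - y ^+ 3 - 2 * y - 1.
  by rewrite /p !(hornerD, hornerN, hornerZ, hornerXn, hornerX, hornerC).
have pa : p.[a] < 0 by rewrite pE /a; lra.
have pb : 0 < p.[b] by rewrite pE /b; lra.
have [||x /andP[ax xb] /rootP px] := @poly_ivt _ p a b.
- by rewrite /a /b; lra.
- by rewrite !ltW.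
have xa : x != a by apply/eqP => e; move: pa; rewrite -e px ltxx.
have bx : b != x by apply/eqP => e; move: pb; rewrite e px ltxx.
exists x; rewrite !lt_neqAle eq_sym xa ax eq_sym bx xb; split=> //.
by move: px; rewrite pE /char_poly_root; lra.
Qed.

Lemma mul_itv (x y a b c d l h : R) : 0 < a -> 0 < c -> a < x < b -> c < y < d ->
  l <= a * c -> b * d <= h -> l < x * y < h.
Proof.
move=> a0 c0 /andP[ax xb] /andP[cy yd] l1 h1; apply/andP; split.
  by apply: le_lt_trans l1 _; apply: ltr_pM => //; exact: ltW.
apply: lt_le_trans h1; apply: ltr_pM => //; [exact/ltW/(lt_trans a0) | exact/ltW/(lt_trans c0)].
Qed.

Lemma pow20_itv (th : R) :
  1 + 612 / 10 ^+ 3 + 992 / 10 ^+ 6 + 62 / 10 ^+ 9 < th ^+ 2 <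
    1 + 612 / 10 ^+ 3 + 992 / 10 ^+ 6 + 68 / 10 ^+ 9 -> 119 + 212 / 10 ^+ 3 + 638 / 10 ^+ 6 < th ^+ 20 <
  119 + 212 / 10 ^+ 3 + 644 / 10 ^+ 6.
Proof.
move=> e2.
have e4 : 2 + 601 / 10 ^+ 3 + 743 / 10 ^+ 6 + 391 / 10 ^+ 9 < th ^+ 2 * th ^+ 2 <
  2 + 601 / 10 ^+ 3 + 743 / 10 ^+ 6 + 413 / 10 ^+ 9.
  by apply: (mul_itv _ _ e2 e2); lra.
have e8 : 6 + 769 / 10 ^+ 3 + 68 / 10 ^+ 6 + 671 / 10 ^+ 9 < th ^+ 4 * th ^+ 4 <
   6 + 769 / 10 ^+ 3 + 68 / 10 ^+ 6 + 789 / 10 ^+ 9.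
  by rewrite -exprD in e4; apply: (mul_itv _ _ e4 e4); clear; lra.
have e10 : 10 + 918 / 10 ^+ 3 + 454 / 10 ^+ 6 + 32 / 10 ^+ 9 < th ^+ 8 * th ^+ 2 <
  10 + 918 / 10 ^+ 3 + 454 / 10 ^+ 6 + 266 / 10 ^+ 9.
  by rewrite -exprD in e8; apply: (mul_itv _ _ e8 e2); clear; lra.
have -> : th ^+ 20 = th ^+ 10 * th ^+ 10 by rewrite -exprD.
by rewrite -exprD in e10; apply: (mul_itv _ _ e10 e10); clear; lra.
Qed.

Lemma sqr_lower (x a b : R) n : 0 <= a -> b <= a ^+ 2 -> a <= x ^+ n -> b <= x ^+ (n + n).
Proof.
move=> a0 ba ax; apply: le_trans ba _; rewrite exprD -expr2.
by rewrite ler_pXn2r ?nnegrE// (le_trans a0).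
Qed.

(** Repeated squaring; with [(1 - y / 64) ^ 64 <= exp (- y)] at [y = 28 / 100] it yields the lower
    bound on [ln rho]. *)
Lemma pow64_lower : (754 / 10 ^+ 3 + 96 / 10 ^+ 5) <= (1 - 28 / 6400 : R) ^+ 64.
Proof.
have s2 : (991 / 10 ^+ 3 + 26 / 10 ^+ 5) <= (1 - 28 / 6400 : R) ^+ 2 by lra.
have s4 : (982 / 10 ^+ 3 + 59 / 10 ^+ 5) <= (1 - 28 / 6400 : R) ^+ 4.
  by apply: (sqr_lower _ _ s2); clear; lra.
have s8 : (965 / 10 ^+ 3 + 48 / 10 ^+ 5) <= (1 - 28 / 6400 : R) ^+ 8.
  by apply: (sqr_lower _ _ s4); clear; lra.
have s16 : (932 / 10 ^+ 3 + 15 / 10 ^+ 5) <= (1 - 28 / 6400 : R) ^+ 16.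
  by apply: (sqr_lower _ _ s8); clear; lra.
have s32 : (868 / 10 ^+ 3 + 89 / 10 ^+ 5) <= (1 - 28 / 6400 : R) ^+ 32.
  by apply: (sqr_lower _ _ s16); clear; lra.
apply: (sqr_lower _ _ s32); clear; lra.
Qed.

Variable th : R.
Hypothesis th_bounds : 1 + 270 / 10 ^+ 3 + 36 / 10 ^+ 6 + 245 / 10 ^+ 9 < th <
  1 + 270 / 10 ^+ 3 + 36 / 10 ^+ 6 + 246 / 10 ^+ 9.
Hypothesis th_root : char_poly_root th.

Lemma th2_bounds : 1 + 612 / 10 ^+ 3 + 992 / 10 ^+ 6 + 62 / 10 ^+ 9 < th ^+ 2 <
  1 + 612 / 10 ^+ 3 + 992 / 10 ^+ 6 + 68 / 10 ^+ 9.
Proof. by rewrite expr2; apply: (mul_itv _ _ th_bounds th_bounds); lra. Qed.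

Lemma th20_bounds : 119 + 212 / 10 ^+ 3 + 638 / 10 ^+ 6 < th ^+ 20 <
  119 + 212 / 10 ^+ 3 + 644 / 10 ^+ 6.
Proof. exact/pow20_itv/th2_bounds. Qed.

Lemma th_gt1 : 1 < th. Proof. by case/andP: th_bounds; lra. Qed.

Lemma moran_th : moran th^-1 = 1.
Proof.
have t0 : th != 0 by rewrite lt0r_neq0// (lt_trans _ th_gt1).
have : (th ^+ 7 + th ^+ 3 + 2 * th + 1) / th ^+ 10 = 1 by rewrite -th_root divff// expf_neq0.
by move=> e; transitivity ((th ^+ 7 + th ^+ 3 + 2 * th + 1) / th ^+ 10) => //; rewrite /moran; field.
Qed.

Lemma moran_lt (x y : R) : 0 <= x -> x < y -> moran x < moran y.
Proof.
move=> x0 xy; have h n : x ^+ n.+1 < y ^+ n.+1 by rewrite ltr_pXn2r ?nnegrE// (le_trans x0) ?ltW.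
by rewrite /moran; have := h 2; have := h 6; have := h 8; have := h 9; lra.
Qed.

(** Divided by [r ^ 10], the inequality reads [moran r^-1 >= 1 = moran th^-1], and [moran] is
    increasing. *)
Lemma root_le_th (r : R) : 0 < r -> r ^+ 10 <= r ^+ 7 + r ^+ 3 + 2 * r + 1 -> r <= th.
Proof.
move=> r0 h; rewrite leNgt; apply/negP => thr.
have t0 : 0 < th := lt_trans ltr01 th_gt1.
have : moran r^-1 < 1 by rewrite -moran_th moran_lt ?invr_ge0 ?ltW// ltf_pV2.
rewrite (_ : moran r^-1 = (r ^+ 7 + r ^+ 3 + 2 * r + 1) / r ^+ 10); last first.
  by rewrite /moran; field; rewrite lt0r_neq0.
by rewrite ltr_pdivrMr ?exprn_gt0// mul1r ltNge h.
Qed.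

Lemma mu_dominant : dominant_root (mu_poly R[i]) (th ^+ 2)%:C.
Proof.
split.
  apply/rootP; rewrite rmorphXn /= mu_poly_sqr.
  rewrite (_ : th%:C ^+ 10 - _ = (th ^+ 10 - (th ^+ 7 + th ^+ 3 + 2 * th + 1))%:C); last first.
    by rewrite !(rmorphB, rmorphD, rmorphM, rmorphXn, rmorph1, rmorph_nat).
  by rewrite th_root subrr mul0r.
move=> w /rootP rw wmu.
(* Of the two square roots of [w], one annihilates the first factor of [mu_poly_sqr] and may be
   chosen. *)
have [y [yw hy]] : exists y : R[i], y ^+ 2 = w /\ char_poly_root y.
  move: rw; rewrite -(sqr_sqrtc w) mu_poly_sqr => /eqP; rewrite mulf_eq0 => /orP[] /eqP /subr0_eq e.
    by exists (sqrtc w).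
  by exists (- sqrtc w); rewrite sqrrN.
have t0 : 0 < th := lt_trans ltr01 th_gt1.
rewrite !normC_nrm ltcR nrm_real ger0_norm ?sqr_ge0// -yw nrm_natpow.
have y0 : 0 < nrm y.
  rewrite lt_neqAle nrm_ge0 andbT eq_sym; apply/eqP => /Normc.eq0_normc e.
  by move: hy; rewrite /char_poly_root e !expr0n /= mulr0 !add0r => /esym /eqP; rewrite oner_eq0.
have h1 : nrm y ^+ 10 <= nrm y ^+ 7 + nrm y ^+ 3 + nrm (2 * y + 1).
  rewrite -!nrm_natpow hy -addrA; apply: le_trans (le_normcD _ _) _.
  by rewrite lerD2r le_normcD.
have n2 : nrm (2 : R[i]) = 2.
  by rewrite (_ : 2 = 2%:C) ?nrm_real ?ger0_norm// rmorph_nat.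
have h2 : nrm (2 * y + 1) <= 2 * nrm y + 1.
  by apply: le_trans (le_normcD _ _) _; rewrite Normc.normc1 Normc.normcM n2.
have h3 : nrm y <= th by apply: root_le_th => //; move: h1 h2; lra.
rewrite ltr_pXn2r ?nnegrE ?(ltW y0) ?(ltW t0)// lt_neqAle h3 andbT.
(* Equality of moduli leaves no slack in the triangle inequality, so [|2 y + 1| = 2 th + 1], which
   forces [y = th]. *)
apply/eqP => yth; move: wmu; apply/negP/negPn/eqP; rewrite -yw.
suff -> : y = th%:C by rewrite rmorphXn.
have h4 : 2 * th + 1 <= nrm (2 * y + 1).
  by move: h1; rewrite yth th_root; lra.
have h5 : (2 * th + 1) ^+ 2 <= nrm (2 * y + 1) ^+ 2.
  by rewrite ler_pXn2r ?nnegrE ?nrm_ge0//; lra.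
move: h5 yth; case: (y) => a b.
have -> : 2 * (a +i* b) + 1 = (2 * a + 1) +i* (2 * b).
  rewrite (_ : 2 = 2%:C); last by rewrite rmorph_nat.
  by apply/eqP; rewrite eq_complex /=; apply/andP; split; apply/eqP; ring.
rewrite nrm_sqr [complex.Re _]/= [complex.Im _]/= => h5 yth.
have e : a ^+ 2 + b ^+ 2 = th ^+ 2 by rewrite -yth nrm_sqr.
have ae : th <= a.
  have : (2 * a + 1) ^+ 2 + (2 * b) ^+ 2 = 4 * th ^+ 2 + 4 * a + 1 by rewrite -e; ring.
  by move: h5; lra.
have b0 : b = 0.
  apply/eqP; rewrite -sqrf_eq0 eq_le sqr_ge0 andbT.
  have : th ^+ 2 <= a ^+ 2 by rewrite ler_pXn2r ?nnegrE// ltW// (lt_le_trans t0).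
  by move: e; lra.
rewrite b0; congr (_ +i* _); apply/eqP; rewrite eq_le ae andbT.
move: e; rewrite b0 expr0n addr0 => e.
by rewrite -(@ler_pXn2r _ 2) ?nnegrE ?e//; apply/ltW => //; apply: lt_le_trans ae.
Qed.

Variable rho : R.
Hypothesis rho3 : rho ^+ 3 = rho + 1.

Lemma ln_le_sub1 (x : R) : 0 < x -> ln x <= x - 1.
Proof. by move=> x0; rewrite -{1}(subrKC 1 x) le_ln1Dx// ltrBrDl subrr. Qed.

Lemma expR_pow_le (y : R) n : 0 <= 1 - y -> (1 - y) ^+ n <= expR (- (n%:R * y)).
Proof.
move=> y1; rewrite -mulrN expRM_natl; apply: lerXn2r; rewrite ?nnegrE ?expR_ge0//.
exact: expR_ge1Dx.
Qed.

Lemma ln_rho_bounds : 28 / 100 <= ln rho <= 29 / 100.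
Proof.
have /andP[r1 r2] := rho_bounds rho3; have r0 := rho_gt0 rho3.
apply/andP; split.
  rewrite -ler_expR lnK ?posrE//.
  have h64 : (1 - 28 / 6400 : R) ^+ 64 <= expR (- (28 / 100)).
    rewrite (_ : 28 / 100 = 64%:R * (28 / 6400)); last by field.
    by apply: expR_pow_le; lra.
  have hp : 1 / rho <= (1 - 28 / 6400 : R) ^+ 64.
    rewrite ler_pdivrMr//.
    apply: le_trans (ler_wpM2r (ltW r0) pow64_lower); clear h64; lra.
  move: (le_trans hp h64); rewrite expRN div1r lef_pV2 ?posrE ?expR_gt0//.
rewrite -ler_expR lnK ?posrE//.
apply: le_trans (_ : (1 + 29 / 800) ^+ 8 <= _).
  lra.
have := @expR_pow_le (- (29 / 800)) 8; rewrite mulrN !opprK => /(_ _) /le_trans; apply; first by lra.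
by rewrite ler_expR; lra.
Qed.

Lemma rho_fine : 1 + 324 / 10 ^+ 3 + 717 / 10 ^+ 6 + 95 / 10 ^+ 8 < rho <
  1 + 324 / 10 ^+ 3 + 717 / 10 ^+ 6 + 96 / 10 ^+ 8.
Proof.
apply/andP; split; [apply: (rho_gt rho3)|apply: (rho_lt rho3)].
- lra.
- lra.
- lra.
- lra.
Qed.

Lemma rho17_bounds : 119 + 151 / 10 ^+ 3 + 137 / 10 ^+ 6 < rho ^+ 17 <
  119 + 151 / 10 ^+ 3 + 141 / 10 ^+ 6.
Proof.
have r17 : rho ^+ 17 = 21 + 37 * rho + 28 * rho ^+ 2.
  have e4 : rho ^+ 4 = rho ^+ 2 + rho by rewrite exprSr rho3; ring.
  have e8 : rho ^+ 8 = 2 * rho ^+ 2 + 3 * rho + 2.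
    rewrite (exprM _ 4 2) e4 (_ : _ ^+ 2 = rho ^+ 4 + 2 * rho ^+ 3 + rho ^+ 2); last by ring.
    by rewrite e4 rho3; ring.
  have e16 : rho ^+ 16 = 4 * rho ^+ 4 + 12 * rho ^+ 3 + 17 * rho ^+ 2 + 12 * rho + 4.
    by rewrite (exprM _ 8 2) e8; ring.
  have e16' : rho ^+ 16 = 21 * rho ^+ 2 + 28 * rho + 16 by rewrite e16 e4 rho3; ring.
  rewrite exprSr e16' (_ : _ * rho = 21 * rho ^+ 3 + 28 * rho ^+ 2 + 16 * rho); last by ring.
  by rewrite rho3; ring.
have rr := rho_fine.
have ru : 1 + 754 / 10 ^+ 3 + 877 / 10 ^+ 6 + 64 / 10 ^+ 8 < rho * rho <
    1 + 754 / 10 ^+ 3 + 877 / 10 ^+ 6 + 68 / 10 ^+ 8.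
  by apply: (mul_itv _ _ rr rr); clear r17; lra.
by rewrite r17 expr2; lra.
Qed.

(** The ratio is close to 17 / 10, so [th ^ 20] and [rho ^ 17] nearly agree; [ln x <= x - 1] applied
    to both quotients is sharp there, and only a coarse enclosure of [ln rho] is needed. *)
Lemma ratio_approx : approx5 (2 * ln (th ^+ 2) / ln (rho ^+ 2)) (1 + 700 / 10 ^+ 3 + 18 / 10 ^+ 5).
Proof.
have /andP[r1 r2] := rho_bounds rho3; have r0 := rho_gt0 rho3.
have t0 : 0 < th := lt_trans ltr01 th_gt1.
have /andP[l1 l2] := ln_rho_bounds.
have /andP[t1 t2] := th20_bounds.
have t20 : 0 < th ^+ 20 by rewrite exprn_gt0.
have p17 : 0 < rho ^+ 17 by rewrite exprn_gt0.
have lt20 : ln (th ^+ 20) = 10 * ln (th ^+ 2).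
  by rewrite (exprM _ 2 10) (lnXn 10) ?exprn_gt0// mulr_natl.
have lr17 : ln (rho ^+ 17) = 17 * ln rho by rewrite (lnXn 17)// mulr_natl.
have /andP[b1 b2] := rho17_bounds.
have up : 10 * ln (th ^+ 2) - 17 * ln rho <= 5175 / 10 ^+ 7.
  rewrite -lt20 -lr17 -ln_div ?posrE//; apply: le_trans (ln_le_sub1 _) _; first by rewrite divr_gt0.
  rewrite lerBlDr ler_pdivrMr//; lra.
have lo : 17 * ln rho - 10 * ln (th ^+ 2) <= - (510 / 10 ^+ 6).
  rewrite -lt20 -lr17 -ln_div ?posrE//; apply: le_trans (ln_le_sub1 _) _; first by rewrite divr_gt0.
  rewrite lerBlDr ler_pdivrMr//; lra.
have u0 : 0 < ln rho by lra.
rewrite /approx5 (lnXn 2 r0) mulr2n.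
rewrite (_ : _ - _ = (ln (th ^+ 2) - (1 + 700 / 10 ^+ 3 + 18 / 10 ^+ 5) * ln rho) / ln rho); last first.
  by field; rewrite lt0r_neq0.
rewrite normrM normfV (gtr0_norm u0) ler_pdivrMr//.
have -> : ((2 * 10 ^+ 5)^-1 : R) = 5 / 10 ^+ 6 by field.
move: l1 l2 up lo; set u := ln rho; set v := ln (th ^+ 2) => l1 l2 up lo.
by rewrite ler_norml; apply/andP; split; lra.
Qed.

Lemma alpha_approx : approx5 (rho + 1) (2 + 324 / 10 ^+ 3 + 72 / 10 ^+ 5).
Proof. by have /andP[r1 r2] := rho_bounds rho3; rewrite /approx5 ler_norml; lra. Qed.

Lemma mu_approx : approx5 (th ^+ 2) (1 + 612 / 10 ^+ 3 + 99 / 10 ^+ 5).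
Proof. by have /andP[r1 r2] := th2_bounds; rewrite /approx5 ler_norml; lra. Qed.

End DominantRoot.

(** * Hausdorff measure and finite covers *)

Section HausdorffCriteria.
Variable R : realType.
Implicit Types (E U : set R[i]) (s d : R).
Local Open Scope ereal_scope.

Lemma powR_le_exp (d a b : R) : (0 <= d <= 1)%R -> (0 <= a <= b)%R -> (0 < b)%R -> (d `^ b <= d `^ a)%R.
Proof.
move=> /andP[d0 d1] /andP[a0 ab] b0; have [->|dn0] := eqVneq d 0%R.
  by rewrite powR0 ?lt0r_neq0// powR_ge0.
rewrite /powR (negbTE dn0) ler_expR ler_wnM2r//; exact: ln_le0.
Qed.

Lemma diam_disc (z : R[i]) r U : U `<=` [set w | (nrm (w - z) <= r)%R] -> diam U <= (r + r)%:E.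
Proof.
move=> h; apply: ge_ereal_sup => _ [[v w] [/= /h hv /h hw] <-]; rewrite lee_fin.
by apply: le_trans (nrm_triangle v z w) _; rewrite lerD// nrm_sub.
Qed.

Lemma diam_ge U z w : U z -> U w -> (nrm (z - w))%:E <= diam U.
Proof. by move=> Uz Uw; apply: ereal_sup_ubound; exists (z, w). Qed.

Lemma diam_ge0 U : U !=set0 -> 0 <= diam U.
Proof. by move=> [z Uz]; have := diam_ge Uz Uz; rewrite subrr Normc.normc0. Qed.

Lemma gauge_ge0 s U : 0 <= hausdorff_gauge s U.
Proof. by rewrite /hausdorff_gauge; case: ifP => // _; exact: poweR_ge0. Qed.

Lemma gauge_disc s z r U : (0 <= s)%R -> (0 <= r)%R -> U `<=` [set w | (nrm (w - z) <= r)%R] ->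
  hausdorff_gauge s U <= ((r + r) `^ s)%:E.
Proof.
move=> s0 r0 h; rewrite /hausdorff_gauge; case: ifPn => [_|/set0P U0].
  by rewrite lee_fin powR_ge0.
rewrite -poweR_EFin; apply: gt0_ler_poweR => //; last exact: diam_disc h.
- by rewrite in_itv /= diam_ge0//= leey.
- by rewrite in_itv /= lee_fin addr_ge0//= leey.
Qed.

(** A cover of tiny cost consists of tiny discs, each term being at most the sum, so vanishing
    content controls the premeasure at every scale. *)
Lemma hausdorff_measure_content0 s E : (0 < s)%R -> bounded_plane E ->
  disc_content s E = 0%R -> hausdorff_measure s E = 0.
Proof.
move=> s0 bE cE.
have ge0 d : 0 <= hausdorff_premeasure s d E.
  apply: le_ereal_inf_tmp => _ [U _ <-]; apply: nneseries_ge0 => n _ _; exact: gauge_ge0.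
have le0 d : (0 < d)%R -> hausdorff_premeasure s d E <= 0.
  move=> d0; apply/lee_addgt0Pr => e e0; rewrite add0e.
  pose k := (2 `^ s)%R; have k0 : (0 < k)%R by rewrite powR_gt0.
  have [|l [l0 lE] hl] := @content_lt _ s E (Num.min e (d `^ s) / k)%R bE.
    by rewrite cE divr_gt0// lt_min e0 powR_gt0.
  move: hl; rewrite ltr_pdivlMr// lt_min => /andP[hl1 hl2].
  have r2 r : (0 <= r)%R -> ((r + r) `^ s = r `^ s * k)%R.
    by move=> r0; rewrite -powRM// mulr_natr mulr2n.
  (* Past the end of [l] the sets are empty, so the default pair never contributes. *)
  pose U n := [set w | (n < size l)%N /\ (nrm (w - (nth (0, 0)%R l n).1) <= (nth (0, 0)%R l n).2)%R].
  have Usub n : (n < size l)%N -> U n `<=` [set w | (nrm (w - (nth (0, 0)%R l n).1) <= (nth (0, 0)%R l n).2)%R].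
    by move=> _ w [].
  have rn n : (n < size l)%N -> (0 < (nth (0, 0)%R l n).2)%R by move=> nl; apply: l0; exact: mem_nth.
  have Uempty n : (size l <= n)%N -> U n = set0.
    by move=> ln; rewrite -subset0 => w []; rewrite ltnNge ln.
  apply: le_trans (_ : \sum_(0 <= n <oo) hausdorff_gauge s (U n) <= _).
    apply: ereal_inf_lbound; exists U => //; split.
      move=> z /lE [c cl hc]; exists (index c l) => //.
      by rewrite /U /= index_mem nth_index.
    move=> n; have [ln|nl] := leqP (size l) n.
      rewrite Uempty// /diam (_ : [set _ | _ in _] = set0) ?ereal_sup0 ?leNye//.
      by rewrite -subset0 => _ [p [[]]].
    apply: le_trans (diam_disc (Usub _ nl)) _; rewrite lee_fin.
    have r0 := ltW (rn n nl).
    rewrite leNgt; apply/negP => dr.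
    have : (d `^ s < ((nth (0, 0) l n).2 + (nth (0, 0) l n).2) `^ s)%R by rewrite gt0_ltr_powR// ?nnegrE ?addr_ge0// ltW.
    apply/negP; rewrite -leNgt r2//; apply: le_trans (ltW hl2); rewrite ler_wpM2r ?(ltW k0)//.
    by apply: cost_mem; exact: mem_nth.
  apply: lime_le; first by apply: is_cvg_nneseries => n _ _; exact: gauge_ge0.
  apply: nearW => n; apply: le_trans (_ : \sum_(0 <= i < size l) hausdorff_gauge s (U i) <= _).
    have [nl|ln] := leqP n (size l).
      rewrite (big_cat_nat _ nl)//=; apply: leeDl; apply: sume_ge0 => i _; exact: gauge_ge0.
    rewrite (big_cat_nat _ (ltnW ln))//= [X in _ + X]big1_seq ?adde0// => i /andP[_].
    by rewrite mem_index_iota => /andP[/Uempty -> _]; rewrite /hausdorff_gauge eqxx.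
  apply: le_trans (_ : (cost s l * k)%:E <= _); last by rewrite lee_fin ltW.
  rewrite /cost (big_nth (0, 0)%R) mulr_suml -sumEFin big_seq [X in _ <= X]big_seq.
  apply: lee_sum => i; rewrite mem_index_iota => /andP[_ il].
  rewrite -(r2 _ (ltW (rn _ il))).
  by apply: gauge_disc (ltW s0) (ltW (rn _ il)) (Usub _ il).
apply/eqP; rewrite eq_le; apply/andP; split.
  by apply: ge_ereal_sup => _ [d d0 <-]; exact: le0.
apply: le_trans (ge0 1%R) _; apply: ereal_sup_ubound; by exists 1%R => /=.
Qed.

Lemma sum_geometric_le (e : R) n : (0 <= e)%R -> (\sum_(i < n) e / 2 ^+ i.+1 <= e)%R.
Proof.
move=> e0; suff -> : (\sum_(i < n) e / 2 ^+ i.+1 = e - e / 2 ^+ n)%R.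
  by rewrite gerBl divr_ge0// exprn_ge0.
elim: n => [|n IH]; first by rewrite big_ord0 expr0 divr1 subrr.
by rewrite big_ord_recr /= IH exprS; field; rewrite expf_neq0.
Qed.

(** A cheap countable cover is thickened to open discs; compactness extracts a finite one, of cost
    below [c0]. Working at scale 1 allows the exponent to be raised from [s] to [s0]. *)
Lemma hausdorff_measure_neq0 (s0 c0 : R) E s : (0 < s0)%R -> (0 < c0)%R -> compact E ->
  (forall l, covers l E -> (c0 <= cost s0 l)%R) -> (0 <= s <= s0)%R -> hausdorff_measure s E != 0.
Proof.
move=> s00 c00 cE hE ss0; apply/eqP => h0.
pose k := (2 `^ s0)%R; have k0 : (0 < k)%R by rewrite powR_gt0.
pose e := (c0 / (4 * k))%R; have e0 : (0 < e)%R by rewrite divr_gt0// mulr_gt0.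
have : hausdorff_premeasure s 1 E < e%:E.
  apply: le_lt_trans (_ : 0 < _); last by rewrite lte_fin.
  by rewrite -h0; apply: ereal_sup_ubound; exists 1%R => /=.
move=> /ereal_inf_lt [_ [U [EU dU] <-] hU].
pose c n := if pselect (U n !=set0) is left h then projT1 (cid h) else 0%R.
pose d n : R := if U n == set0 then 0%R else fine (diam (U n)).
have dE n : U n !=set0 -> (d n)%:E = diam (U n) /\ (0 <= d n <= 1)%R.
  move=> h; have := diam_ge0 h; have := dU n; rewrite /d; case: eqP => [e'|_].
    by move: h; rewrite e' => -[].
  by case: (diam (U n)) => [r| |] //=; rewrite !lee_fin => -> ->.
have d01 n : (0 <= d n <= 1)%R.
  have [e'|/set0P /dE [_]//] := eqVneq (U n) set0.
  by rewrite /d e' eqxx lexx ler01.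
(* A positive radius for sets of zero diameter, with summable cost; the factor 2 in [r] makes the
   discs open neighbourhoods of the sets. *)
pose t n : R := ((e / 2 ^+ n.+1) `^ s0^-1)%R.
have t0 n : (0 < t n)%R by rewrite powR_gt0// divr_gt0// exprn_gt0.
have ts n : (t n `^ s0 = e / 2 ^+ n.+1)%R.
  by rewrite -powRrM mulVf ?lt0r_neq0// powRr1// divr_ge0 ?ltW// exprn_gt0.
pose r n : R := (2 * Num.max (d n) (t n))%R.
have rt n : (0 < r n)%R by rewrite mulr_gt0// lt_max t0 orbT.
have [|N HN] := @finite_disc_cover _ E c r cE.
  move=> z /EU [n _ Uz]; exists n; rewrite /c; case: pselect => [h|h]; last first.
    by exfalso; apply: h; exists z.
  case: cid => w Uw /=; have [d1 _] := dE n h.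
  have : (nrm (z - w) <= d n)%R by rewrite -lee_fin d1; exact: diam_ge.
  move=> /le_lt_trans; apply; rewrite /r.
  have : (d n <= Num.max (d n) (t n))%R by rewrite le_max lexx.
  have : (0 < Num.max (d n) (t n))%R by rewrite lt_max t0 orbT.
  by lra.
have /hE : covers [seq (c n, r n) | n <- index_iota 0 N] E.
  split; first by move=> _ /mapP[n _ ->]; exact: rt.
  move=> z /HN [n nN h]; exists (c n, r n); last exact: ltW.
  by apply/mapP; exists n; rewrite // mem_index_iota.
apply/negP; rewrite -ltNge.
have rs n : (r n `^ s0 <= k * (d n `^ s0 + t n `^ s0))%R.
  have [dn1 _] := andP (d01 n).
  rewrite /r powRM ?le_max ?(ltW (t0 n)) ?orbT//; apply: ler_wpM2l; first exact: ltW.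
  have h1 := powR_ge0 (d n) s0; have h2 := powR_ge0 (t n) s0.
  by rewrite /Num.max; case: ifP => _; lra.
have gs n : (d n `^ s0)%:E <= hausdorff_gauge s (U n).
  rewrite /hausdorff_gauge /d; case: eqP => [_|/eqP/set0P h].
    by rewrite powR0 ?lt0r_neq0.
  have [d1 d2] := dE n h; rewrite -d1 poweR_EFin lee_fin.
  have -> : fine (d n)%:E = d n by [].
  by rewrite powR_le_exp.
have ds : (\sum_(0 <= n < N) d n `^ s0 < e)%R.
  rewrite -lte_fin; apply: le_lt_trans hU.
  apply: le_trans (nneseries_lim_ge N _); last by move=> n _ _; exact: gauge_ge0.
  by rewrite -sumEFin; apply: lee_sum => n _; exact: gs.
rewrite /cost big_map /=.
apply: le_lt_trans (_ : \sum_(0 <= n < N) k * (d n `^ s0 + t n `^ s0) < _)%R.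
  by apply: ler_sum => n _; exact: rs.
rewrite -mulr_sumr big_split /=.
have : (\sum_(0 <= n < N) t n `^ s0 <= e)%R.
  by under eq_bigr do rewrite ts; rewrite big_mkord; apply: sum_geometric_le; exact: ltW.
move: ds; set A := (\sum_(_ <= _ < _) _)%R; set B := (\sum_(_ <= _ < _) _)%R => hA hB.
apply: lt_le_trans (_ : k * (e + e) <= _)%R; first by rewrite ltr_pM2l// ltr_leD.
by rewrite /e (_ : k * _ = c0 / 2)%R; [lra | field; rewrite lt0r_neq0].
Qed.

Lemma hausdorff_dimE E (s0 : R) : (0 < s0)%R ->
  (forall s, (s0 < s)%R -> hausdorff_measure s E = 0) ->
  (forall s, (0 <= s <= s0)%R -> hausdorff_measure s E != 0) ->
  hausdorff_dim E = s0%:E.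
Proof.
move=> s00 up lo; apply/eqP; rewrite eq_le; apply/andP; split.
  apply/lee_addgt0Pr => e e0; apply: ereal_inf_lbound; exists (s0 + e)%R => //=.
  by split; [rewrite addr_ge0 ?ltW | apply: up; rewrite ltrDl].
apply: le_ereal_inf_tmp => _ [s [/= s1 s2] <-]; rewrite lee_fin leNgt; apply/negP => ss0.
by have := lo s; rewrite s2 eqxx s1 (ltW ss0) => /(_ isT).
Qed.

End HausdorffCriteria.

(** * Null sets of the plane *)

Section PlaneMeasure.
Variable R : realType.
Notation mu2 := ((@lebesgue_measure R) \x (@lebesgue_measure R))%E.

Definition plane (E : set R[i]) : set (R * R) := [set p | E (p.1 +i* p.2)].

Definition square (d : R[i] * R) : set (R * R) :=
  `[complex.Re d.1 - d.2, complex.Re d.1 + d.2] `*` `[complex.Im d.1 - d.2, complex.Im d.1 + d.2].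

Lemma measurable_square d : measurable (square d).
Proof. by apply: measurableX; exact: measurable_itv. Qed.

Lemma measure_square d : 0 < d.2 -> mu2 (square d) = (4 * d.2 ^+ 2)%:E.
Proof.
move=> d0.
have h (x : R) : lebesgue_measure (`[x - d.2, x + d.2] : set R) = (d.2 + d.2)%:E.
  rewrite lebesgue_measure_itv /= lte_fin (_ : x - d.2 < x + d.2); last by lra.
  by rewrite -EFinB; congr (_%:E); ring.
pose A := (`[complex.Re d.1 - d.2, complex.Re d.1 + d.2])%classic.
pose B := (`[complex.Im d.1 - d.2, complex.Im d.1 + d.2])%classic.
transitivity (lebesgue_measure A * lebesgue_measure B)%E.
  by apply: product_measure1E; exact: measurable_itv.
by rewrite /A /B !h -EFinM; congr (_%:E); ring.
Qed.

Fixpoint squares (l : seq (R[i] * R)) : set (R * R) :=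
  if l is d :: l' then square d `|` squares l' else set0.

Lemma measurable_squares l : measurable (squares l).
Proof.
elim: l => [|d l IH]; first exact: measurable0.
by apply: measurableU => //; exact: measurable_square.
Qed.

Lemma measure_squares l : (forall d, d \in l -> 0 < d.2) ->
  (mu2 (squares l) <= (4 * cost 2 l)%:E)%E.
Proof.
elim: l => [|d l IH] hl; first by rewrite /= measure0 /cost big_nil mulr0.
apply: (@le_trans _ _ (mu2 (square d) + mu2 (squares l))%E).
  by apply: measureU2; [exact: measurable_square | exact: measurable_squares].
have d0 : 0 < d.2 by apply: hl; rewrite inE eqxx.
rewrite /cost big_cons mulrDr EFinD leeD//.
  by rewrite measure_square// powR_mulrn// ltW.
by apply: IH => d' dl; apply: hl; rewrite inE dl orbT.
Qed.

Lemma covers_squares l E : covers l E -> plane E `<=` squares l.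
Proof.
move=> [_ hl] [x y] /= /hl [d dl hd].
suff : square d (x, y).
  by elim: l dl {hl} => // d' l IH; rewrite inE => /predU1P[->|/IH h] sd; [left | right; exact: h].
have h1 : `|x - complex.Re d.1| <= d.2.
  by apply: le_trans hd; have := nrm_Re ((x +i* y) - d.1); case: (d.1).
have h2 : `|y - complex.Im d.1| <= d.2.
  by apply: le_trans hd; have := nrm_Im ((x +i* y) - d.1); case: (d.1).
by move: h1 h2; rewrite !ler_norml => h1 h2; split; rewrite /= in_itv /=; lra.
Qed.

Lemma content0_negligible E : bounded_plane E -> disc_content 2 E = 0 ->
  mu2.-negligible (plane E).
Proof.
move=> bE cE.
have ex n : exists l, covers l E /\ cost 2 l < (4 * n.+1%:R)^-1.
  have [|l hl cl] := @content_lt _ 2 E (4 * n.+1%:R)^-1 bE; last by exists l.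
  by rewrite cE invr_gt0 mulr_gt0.
pose l n := projT1 (cid (ex n)).
have [lc ll] : (forall n, covers (l n) E) /\ (forall n, cost 2 (l n) < (4 * n.+1%:R)^-1).
  by split=> n; have [] := projT2 (cid (ex n)).
exists (\bigcap_n squares (l n)); split.
- by apply: bigcapT_measurable => n; exact: measurable_squares.
- apply/eqP; rewrite eq_le measure_ge0 andbT; apply/lee_addgt0Pr => e e0; rewrite add0e.
  pose n := Num.truncn e^-1.
  have hn : e^-1 < n.+1%:R by exact: truncnS_gt.
  apply: le_trans (_ : (mu2 (squares (l n)) <= _)%E).
    apply: le_measure; rewrite ?inE//.
    + by apply: bigcapT_measurable => k; exact: measurable_squares.
    + exact: measurable_squares.
    + exact: bigcap_inf.
  apply: le_trans (measure_squares (lc n).1) _; rewrite lee_fin.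
  apply: le_trans (_ : 4 * (4 * n.+1%:R)^-1 <= _); first by rewrite ler_wpM2l// ltW.
  rewrite invfM mulrA divff// mul1r -(invrK e) lef_pV2 ?posrE ?invr_gt0// ltW//.
- by move=> p Ep n _; exact: (covers_squares (lc n)).
Qed.

Lemma plane_not_negligible : ~ mu2.-negligible (setT : set (R * R)).
Proof.
move=> [A [mA A0 hA]]; pose d : R[i] * R := (0, 1).
have : (mu2 (square d) <= mu2 A)%E.
  by apply: le_measure; rewrite ?inE//; [exact: measurable_square | move=> p _; exact: hA].
by rewrite A0 measure_square// lee_fin /= expr1n mulr1; lra.
Qed.

Lemma plane_negligibleS (A B : set (R * R)) : B `<=` A -> mu2.-negligible A -> mu2.-negligible B.
Proof. by move=> BA [C [mC nC hC]]; exists C; split=> //; exact: subset_trans hC. Qed.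

Lemma plane_negligible_ex (I : countType) (A : I -> set (R * R)) :
  (forall i, mu2.-negligible (A i)) -> mu2.-negligible [set p | exists i, A i p].
Proof.
move=> h; apply: (@plane_negligibleS
    (\bigcup_n (if unpickle n is Some i then A i else set0))).
  by move=> p [i Aip]; exists (pickle i); rewrite ?pickleK.
apply: negligible_bigcup => n; case: unpickle => [i|]; first exact: h.
exact: negligible_set0.
Qed.

End PlaneMeasure.

(** * The dimension of the boundary *)

Lemma content_bigU (R : realType) (s : R) (I : eqType) (r : seq I) (A : I -> set R[i]) :
  (forall i, i \in r -> bounded_plane (A i) /\ disc_content s (A i) = 0) ->
  bounded_plane [set z | exists2 i, i \in r & A i z] /\
  disc_content s [set z | exists2 i, i \in r & A i z] = 0.
Proof.
have lid : lip_plane (1 : R) (@id R[i]) by move=> z w; rewrite mul1r.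
elim: r => [|i r IH] h.
  rewrite (_ : [set z | _] = set0); last by rewrite -subset0 => z [].
  by rewrite content_set0; split=> //; exists 0.
have [j jr|bU cU] := IH; first by apply: h; rewrite inE jr orbT.
have [bA cA] : bounded_plane (A i) /\ disc_content s (A i) = 0 by apply: h; rewrite inE eqxx.
split.
  have [M HM] := bU; have [N HN] := bA; exists (Num.max M N) => z [j].
  rewrite inE le_max => /predU1P[->|jr] Az; first by rewrite (HN z) ?orbT.
  by rewrite (HM z)//; exists j.
apply/eqP; rewrite eq_le content_ge0 andbT.
have := @content_image2 _ s [set z | exists2 j, j \in i :: r & A j z] (A i) [set z | exists2 j, j \in r & A j z]
  1 1 id id ltr01 ltr01 lid lid bA bU.
rewrite cA cU !mulr0 addr0; apply=> z [j]; rewrite inE => /predU1P[->|jr] Az; [left | right].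
  by exists z.
by exists z => //; exists j.
Qed.

Section Dimension.
Variables (R : realType) (rho q : R).
Hypothesis rho3 : rho ^+ 3 = rho + 1.
Hypothesis q2 : q ^+ 2 = 3 / 4 * rho ^+ 2 - 1.
Notation lam := (conj_root rho q).
Notation lamN := (conj_modulus rho q).
Let lam3 := lam3 rho3 q2.
Variable F : set R[i].
Hypothesis F_neq0 : F !=set0.
Hypothesis F_compact : compact F.
Hypothesis FE : F = [set lam ^+ 3 * z | z in F] `|` [set lam ^+ 2 * (1 - z) | z in F].
Let F_left := F_left FE.
Let F_right := F_right FE.
Notation tile := (tile rho q F).
Let F_bounded := F_bounded rho3 q2 F_neq0 F_compact FE.
Let F_closed := F_closed F_compact.
Let l0 := lamN_gt0 rho3 q2.
Let l1 := lamN_lt1 rho3 q2.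

Lemma tile_bound u1 u2 b : bounded_plane (tile u1 u2 b).
Proof.
exists (nrm (ev lam (tile_pos u1 u2 b)) + 2) => _ [z Fz <-].
by apply: le_trans (le_normcD _ _) _; rewrite nrm_sg lerD2l F_bounded.
Qed.

Section Null.
Variable s : R.
Hypothesis x_lt1 : lamN `^ s < 1.
Hypothesis moran_lt1 : moran (lamN `^ s) < 1.

Lemma content_isometry A B e w : bounded_plane B ->
  A `<=` [set sg e * z + w | z in B] -> disc_content s B = 0 -> disc_content s A = 0.
Proof.
move=> bB AB cB; apply/eqP; rewrite eq_le content_ge0 andbT.
have lf : lip_plane (1 : R) (fun z => sg e * z + w).
  move=> z z'; rewrite (_ : _ - _ = sg e * (z - z')); last by ring.
  by rewrite nrm_sg mul1r.
by have := content_image s ltr01 lf bB AB; rewrite cB mulr0.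
Qed.

Lemma tile_inter_null u1 u2 b v1 v2 b' : (u1, u2, b) != (v1, v2, b') ->
  disc_content s (tile u1 u2 b `&` tile v1 v2 b') = 0.
Proof.
move=> hn.
(* The relative index after the first tile is moved back to [F]; a reflected first tile reverses its
   sign. *)
pose w1 := if b then (v1 - u1)%Z else (u1 - v1)%Z.
pose w2 := if b then (v2 - u2)%Z else (u2 - v2)%Z.
have hd : ev lam (tile_pos w1 w2 (b == b')) = sg b * (ev lam (tile_pos v1 v2 b') - ev lam (tile_pos u1 u2 b)).
  rewrite /w1 /w2; case: (b); case: (b') => /=; rewrite /sg !zrE; ring.
apply: (@content_isometry _ (isect rho q F (0%N, b == b', tile_pos w1 w2 (b == b'))) b (ev lam (tile_pos u1 u2 b))).
- exact: isect_bounded.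
- move=> w [[z Fz e1] [z' Fz' e2]]; exists z; last by rewrite -e1 addrC.
  split; first by exists z; rewrite ?expr0 ?mul1r.
  exists z' => //; rewrite hd expr0 mul1r.
  have -> : z = sg b * (w - ev lam (tile_pos u1 u2 b)) by rewrite -e1 addrAC subrr add0r mulrA sgK mul1r.
  by rewrite -e2; case: (b); case: (b'); rewrite /sg /=; ring.
apply: (neighbour_null rho3 q2 F_neq0 F_compact FE x_lt1 moran_lt1).
apply/negP => /and3P[/eqP bb /eqP h1 /eqP h2]; move/negP: hn; apply; apply/eqP.
rewrite bb; move: h1 h2; rewrite /w1 /w2 => h1 h2; congr (_, _, _); case: (b) h1 h2; lia.
Qed.

(** A point of [F] in no other tile is interior: the finitely many other tiles nearby form a closed
    set missing it, so [F] alone covers a neighbourhood. The boundary thus lies in finitely many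
    null overlaps. *)
Lemma boundary_content : bounded_plane (boundary F) /\ disc_content s (boundary F) = 0.
Proof.
have F_tile : tile 0 0 true = F.
  apply/seteqP; split => [_ [z Fz <-]|z Fz].
    by rewrite /= (zr0 _) !mul0r !add0r mul1r.
  by exists z => //; rewrite /= (zr0 _) !mul0r !add0r mul1r.
have [N HN] := tile_bounded rho3 q2 F_neq0 F_compact FE 3.
pose D := [seq i <- [seq (u, b) | u <- [seq (u1, u2) | u1 <- zbox N, u2 <- zbox N], b <- [:: true; false]]
             | i != (0%Z, 0%Z, true)].
have [i iD|bU cU] := @content_bigU _ s _ D (fun i => F `&` tile i.1.1 i.1.2 i.2).
  split; first by exists 2 => z [/F_bounded].
  move: iD; rewrite mem_filter => /andP[i0 _]; rewrite -{1}F_tile tile_inter_null//.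
  by case: i i0 => [[u1 u2] b]; rewrite eq_sym.
have bB : bounded_plane (boundary F).
  by exists 2 => z [cz _]; apply: F_bounded; exact: F_closed.
split=> //; apply: (@content_isometry _ _ true 0 bU _ cU) => z [cz iz].
have Fz : F z by exact: F_closed.
exists z; last by rewrite mul1r addr0.
apply: contrapT => hz; apply: iz.
pose W := \bigcup_(i in [set` D]) tile i.1.1 i.1.2 i.2.
have cW : closed W by apply: closed_bigcup => [|i _]; [exact: finite_seq | exact: tile_closed].
have [r r0 hr] : exists2 r, 0 < r & forall w, nrm (w - z) < r -> ~ W w.
  apply/(nbhs_discP z (~` W)); apply: open_nbhs_nbhs; split; first exact: closed_openC.
  by move=> [i iD iz]; apply: hz; exists i.
apply/nbhs_discP; exists (Num.min r 1); first by rewrite lt_min r0 ltr01.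
move=> w; rewrite lt_min => /andP[wr w1].
have [u1 [u2 [b hw]]] := tiles_cover rho3 q2 F_neq0 F_compact FE w.
have [|h1 h2] := HN u1 u2 b w hw.
  rewrite (_ : w = (w - z) + z); last by rewrite subrK.
  apply: le_trans (le_normcD _ _) _; rewrite (_ : 3 = 1 + 2); last by ring.
  by apply: lerD; [exact: ltW | exact: F_bounded].
have [e|ne] := eqVneq (u1, u2, b) (0%Z, 0%Z, true).
  by move: hw; case: e => -> -> ->; rewrite F_tile.
exfalso; apply: (hr w wr); exists ((u1, u2), b) => //=.
rewrite mem_filter ne andTb; apply: (allpairs_f pair); last exact: mem_bools.
by apply: (allpairs_f pair); exact: mem_zbox.
Qed.

End Null.

Lemma small_copy n z : F z -> exists f, (n <= f.1.2)%N /\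
  (forall y, F y -> F (app lam f y)) /\ exists2 y, F y & app lam f y = z.
Proof.
elim: n z => [|n IH] z Fz.
  by exists aid; split=> //; split=> [y|]; [rewrite app_id | exists z; rewrite ?app_id].
have step b y : F y -> z = app lam (branch b) y -> exists f, (n < f.1.2)%N /\
  (forall y, F y -> F (app lam f y)) /\ exists2 y, F y & app lam f y = z.
  move=> Fy ->; have [f [nf [fF [y' Fy' e]]]] := IH y Fy.
  exists (acomp (branch b) f); split; last split.
  - by case: f {fF e} nf => [[e k] p] /=; case: b; rewrite /=; lia.
  - move=> v Fv; rewrite app_comp//; case: (b); rewrite ?app_left ?app_right.
      exact/F_left/fF.
    exact/F_right/fF.
  - by exists y' => //; rewrite app_comp// e.
have [[y Fy e]|[y Fy e]] := F_cases FE Fz.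
  by apply: (step true y Fy); rewrite app_left.
by apply: (step false y Fy); rewrite app_right.
Qed.

Lemma lamN_sqr_powR : lamN `^ 2 = rho ^+ 2 - 1.
Proof. by rewrite powR_mulrn ?(ltW l0)// lamN2. Qed.

Lemma moran_two : lamN `^ 2 < 1 /\ moran (lamN `^ 2) < 1.
Proof.
have /andP[r1 r2] := rho_bounds rho3; rewrite lamN_sqr_powR; split; first by nra.
have h0 : 0 <= rho ^+ 2 - 1 by nra.
have h1 : rho ^+ 2 - 1 < 755 / 10 ^+ 3 by nra.
by apply: lt_trans (moran_lt h0 h1) _; rewrite /moran; lra.
Qed.

(** Countably many isometric copies of [F] cover the plane, which is not a null set. *)
Lemma F_content2 : disc_content 2 F <> 0.
Proof.
move=> cF; apply: (@plane_not_negligible R).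
apply: (@plane_negligibleS _ [set p | exists i : Z * Z * bool, plane (tile i.1.1 i.1.2 i.2) p]).
  move=> [a b] _; have [u1 [u2 [e h]]] := tiles_cover rho3 q2 F_neq0 F_compact FE (a +i* b).
  by exists (u1, u2, e).
apply: plane_negligible_ex => -[[u1 u2] b].
apply: content0_negligible; first exact: tile_bound.
apply: (@content_isometry 2 _ F b (ev lam (tile_pos u1 u2 b))) => //; first by exists 2.
by move=> _ [z Fz <-]; exists z => //; rewrite addrC.
Qed.

(** The point lies in [F] and in the distinct tile [lam ^ 2 - F]. Were it interior to [F], a small
    copy of that tile around it would lie in their overlap, which is null for [s = 2]. *)
Lemma core_boundary z : core rho q F z -> boundary F (lam ^+ 2 - z).
Proof.
move=> [Fz [y Fy ey]]; have [x1 m1] := moran_two.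
have Fw : F (lam ^+ 2 - z).
  by rewrite ey (_ : _ - _ = lam ^+ 2 * (1 - y)); [exact: F_right | ring].
split; first exact: subset_closure.
move=> /nbhs_discP [r r0 hr].
have [n hn] : exists n, lamN ^+ n < r / 4 by apply: pow_lt1; rewrite ?(ltW l0) ?divr_gt0.
have [f [nf [fF [y0 Fy0 fy0]]]] := small_copy n Fz.
have sub : [set lam ^+ 2 - app lam f v | v in F] `<=` isect rho q F (0%N, false, (0, 0, 1)%Z).
  move=> _ [v Fv <-]; split.
    exists (lam ^+ 2 - app lam f v); last by rewrite expr0 mul1r.
    apply: hr; rewrite -fy0.
    rewrite (_ : _ - _ = app lam f y0 - app lam f v); last by ring.
    case: f nf {fF fy0} => [[e k] p] /= nk; rewrite /app.
    rewrite (_ : _ - _ = sg e * (lam ^+ k * (y0 - v))); last by ring.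
    rewrite nrm_sg nrm_lamX; apply: le_lt_trans (_ : lamN ^+ n * 4 < _); last by rewrite -ltr_pdivlMr.
    apply: ler_pM; rewrite ?exprn_ge0 ?nrm_ge0 ?(ltW l0)//.
      by apply: ler_wiXn2l; rewrite ?(ltW l0) ?(ltW l1).
    apply: le_trans (le_normcD _ _) _; rewrite normcN (_ : 4 = 2 + 2); last by ring.
    by rewrite lerD// F_bounded.
  exists (app lam f v); first exact: fF.
  by rewrite expr0 mul1r /sg /= (zr0 _) zr1; ring.
have c0 : disc_content 2 (isect rho q F (0%N, false, (0, 0, 1)%Z)) = 0.
  by apply: (contact_content0 rho3 q2 F_neq0 F_compact FE x1 m1).
have bI := isect_bounded rho3 q2 F_neq0 F_compact FE (0%N, false, (0, 0, 1)%Z).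
apply: F_content2; apply/eqP; rewrite eq_le content_ge0 andbT.
case: f sub {nf fF fy0} => [[e k] p] sub.
have lk : lam ^+ k != 0 by rewrite expf_neq0// (lam_neq0 rho3 q2).
(* The inverse of the embedding in [sub]: it expands a part of the null overlap back onto [F]. *)
pose g w := lam ^- k * (sg e * (lam ^+ 2 - w - ev lam p)).
have lg : lip_plane (lamN ^- k) g.
  move=> w w'; rewrite /g (_ : _ - _ = lam ^- k * (sg e * (w' - w))); last by ring.
  by rewrite Normc.normcM nrm_sg Normc.normcV nrm_natpow nrm_sub.
have := @content_image _ 2 F _ _ g _ lg bI; rewrite c0 mulr0; apply; first by rewrite invr_gt0 exprn_gt0.
move=> v Fv; exists (lam ^+ 2 - app lam (e, k, p) v); first by apply: sub; exists v.
rewrite /g /app (_ : _ - ev lam p = sg e * (lam ^+ k * v)); last by ring.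
by rewrite (mulrA (sg e)) sgK mul1r mulKf.
Qed.

Variable th : R.
Hypothesis th_bounds : 1 + 270 / 10 ^+ 3 + 36 / 10 ^+ 6 + 245 / 10 ^+ 9 < th <
  1 + 270 / 10 ^+ 3 + 36 / 10 ^+ 6 + 246 / 10 ^+ 9.
Hypothesis th_root : char_poly_root th.
Let s0 : R := 2 * ln (th ^+ 2) / ln (rho ^+ 2).

Let th_gt0 : 0 < th. Proof. exact: lt_trans ltr01 (th_gt1 th_bounds). Qed.
Let ln_th_gt0 : 0 < ln th. Proof. by rewrite ln_gt0// (th_gt1 th_bounds). Qed.
Let ln_rho_gt0 : 0 < ln rho. Proof. by rewrite ln_gt0// (rho_gt1 rho3). Qed.

Lemma s0E : s0 = 2 * ln th / ln rho.
Proof.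
have n0 : ln rho != 0 by rewrite lt0r_neq0.
rewrite /s0 !lnXn ?(rho_gt0 rho3)// -[ln th *+ 2]mulr_natl -[ln rho *+ 2]mulr_natl.
by field.
Qed.

Lemma s0_gt0 : 0 < s0. Proof. by rewrite s0E divr_gt0// mulr_gt0. Qed.

Lemma ln_lamN : ln lamN = - (ln rho / 2).
Proof.
have : ln (lamN ^+ 2) = - ln rho by rewrite lamN2// -rhoV// lnV ?posrE// rho_gt0.
by rewrite lnXn// mulr2n; lra.
Qed.

Lemma lamN_s0 : lamN `^ s0 = th^-1.
Proof.
rewrite /powR (negbTE (lt0r_neq0 l0)) ln_lamN s0E.
rewrite (_ : _ * _ = - ln th); last by field; rewrite lt0r_neq0.
by rewrite expRN lnK ?posrE.
Qed.

Lemma moran_above s : s0 < s -> lamN `^ s < 1 /\ moran (lamN `^ s) < 1.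
Proof.
move=> hs; have h : lamN `^ s < th^-1.
  rewrite -lamN_s0 /powR (negbTE (lt0r_neq0 l0)) ltr_expR ltr_nM2r// ln_lamN.
  by rewrite oppr_lt0 divr_gt0.
split; first by apply: lt_trans h _; rewrite invf_lt1// (th_gt1 th_bounds).
by rewrite -(moran_th th_bounds th_root); apply: moran_lt => //; exact: powR_ge0.
Qed.

(** At [s0] the Moran sum equals 1. Above it the overlaps are null; at it the core, which an
    isometry carries into the boundary, has covers of cost bounded below. *)
Lemma dim_boundary : hausdorff_dim (boundary F) = s0%:E.
Proof.
apply: hausdorff_dimE; first exact: s0_gt0.
  move=> s hs; have [x1 m1] := moran_above hs.
  have [bB cB] := boundary_content x1 m1.
  by apply: hausdorff_measure_content0 => //; exact: lt_trans s0_gt0 hs.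
have m1 : moran (lamN `^ s0) = 1 by rewrite lamN_s0 (moran_th th_bounds th_root).
have [c0 c00 hc] := core_cost rho3 q2 F_neq0 F_compact FE s0_gt0 m1.
move=> s hs; apply: (hausdorff_measure_neq0 s0_gt0 c00 _ _ hs).
  apply: (subclosed_compact _ F_compact); last by move=> z [cz _]; exact: F_closed.
  rewrite /boundary setDE; apply: closedI; first exact: closed_closure.
  by apply: open_closedC; exact: open_interior.
move=> l hl.
have lf : lip_plane (1 : R) (fun z => lam ^+ 2 - z).
  move=> z z'; have -> : lam ^+ 2 - z - (lam ^+ 2 - z') = z' - z by ring.
  by rewrite mul1r nrm_sub.
have := hc (cover_image 1 (fun z => lam ^+ 2 - z) l).
rewrite (cost_image s0 _ ltr01 hl) powR1 mul1r; apply.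
have [h1 h2] := covers_image ltr01 lf hl; split=> // z cz; apply: h2.
by exists (lam ^+ 2 - z); [exact: core_boundary | ring].
Qed.

End Dimension.

(** * The tiling *)

Section FieldOfAlpha.
Variables (R : realType) (a : R) (psi : R -> R[i]).
Hypothesis psiP : field_embedding (Qadjoin a) psi.
Notation K := (Qadjoin a).

Lemma Qadjoin_gen : K a.
Proof. by move=> S [_ hS]; exact: hS. Qed.

Lemma Qadjoin1 : K 1.
Proof. by move=> S [[h _ _] _]; rewrite -in_setE. Qed.

Lemma QadjoinB x y : K x -> K y -> K (x - y).
Proof.
move=> Kx Ky S hS; have [[_ h _] _] := hS.
by rewrite -in_setE; apply: h; rewrite in_setE; [exact: Kx | exact: Ky].
Qed.

Lemma QadjoinV x y : K x -> K y -> K (x / y).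
Proof.
move=> Kx Ky S hS; have [[_ _ h] _] := hS.
by rewrite -in_setE; apply: h; rewrite in_setE; [exact: Kx | exact: Ky].
Qed.

Lemma QadjoinM x y : K x -> K y -> K (x * y).
Proof.
move=> Kx Ky; rewrite -[y]invrK -(div1r y); apply: QadjoinV => //.
by apply: QadjoinV => //; exact: Qadjoin1.
Qed.

Lemma psi1 : psi 1 = 1. Proof. by case: psiP. Qed.

Lemma psiD x y : K x -> K y -> psi (x + y) = psi x + psi y.
Proof. by case: psiP => _ h _ Kx Ky; apply: h; rewrite in_setE. Qed.

Lemma psiM x y : K x -> K y -> psi (x * y) = psi x * psi y.
Proof. by case: psiP => _ _ h Kx Ky; apply: h; rewrite in_setE. Qed.

Lemma psiB x y : K x -> K y -> psi (x - y) = psi x - psi y.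
Proof.
move=> Kx Ky; have := psiD (QadjoinB Kx Ky) Ky; rewrite subrK => ->.
by rewrite addrK.
Qed.

End FieldOfAlpha.

Section Conjugates.
Variable R : realType.

Lemma rho_unique (r t : R) : r ^+ 3 = r + 1 -> t ^+ 3 = t + 1 -> r = t.
Proof.
move=> r3 t3; have r1 := rho_gt1 r3; have t1 := rho_gt1 t3.
apply/eqP; rewrite -subr_eq0; apply/eqP.
have h : (r - t) * (r ^+ 2 + r * t + t ^+ 2 - 1) = 0.
  by rewrite (_ : _ * _ = (r ^+ 3 - r) - (t ^+ 3 - t)); [rewrite r3 t3; ring | ring].
have /eqP := h; rewrite mulf_eq0 => /orP[/eqP //|/eqP h2]; nra.
Qed.

(** For [l = p + i q], the imaginary part gives [q ^ 2 = 3 p ^ 2 - 1]; the real part then makes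
    [- 2 p] a real root of [x ^ 3 = x + 1], which can only be [rho]. *)
Lemma conjugateE (rho : R) (l : R[i]) : rho ^+ 3 = rho + 1 -> l ^+ 3 = l + 1 ->
  complex.Im l != 0 -> l = conj_root rho (complex.Im l) /\ complex.Im l ^+ 2 = 3 / 4 * rho ^+ 2 - 1.
Proof.
move=> r3; case: l => p q /= l3 q0.
have [e1 e2] : p ^+ 3 - 3 * p * q ^+ 2 = p + 1 /\ 3 * p ^+ 2 * q - q ^+ 3 = q.
  move: l3; rewrite exprS expr2 => /eqP; rewrite eq_complex /= addr0 => /andP[/eqP h1 /eqP h2].
  by split; lra.
have q2 : q ^+ 2 = 3 * p ^+ 2 - 1.
  apply: (mulfI q0); rewrite -exprS mulrBr mulr1 -{3}e2; ring.
have pr : (- 2 * p) ^+ 3 = - 2 * p + 1.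
  by move: e1; rewrite q2 => e1; rewrite (_ : _ ^+ 3 = p ^+ 3 - 3 * p * (3 * p ^+ 2 - 1) - 3 * p); [rewrite e1; ring | ring].
have pE := rho_unique r3 pr; split; last by rewrite q2 pE; field.
by rewrite /conj_root pE; congr (_ +i* _); field.
Qed.

End Conjugates.

Section Tiling.
Variables (R : realType) (rho q : R).
Hypothesis rho3 : rho ^+ 3 = rho + 1.
Hypothesis q2 : q ^+ 2 = 3 / 4 * rho ^+ 2 - 1.
Notation lam := (conj_root rho q).
Notation lamN := (conj_modulus rho q).
Let lam3 := lam3 rho3 q2.
Variable F : set R[i].
Hypothesis F_neq0 : F !=set0.
Hypothesis F_compact : compact F.
Hypothesis FE : F = [set lam ^+ 3 * z | z in F] `|` [set lam ^+ 2 * (1 - z) | z in F].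
Notation tile := (tile rho q F).
Variables (psi : R -> R[i]) (alpha beta : R).
Hypothesis psi_alpha : psi alpha = lam ^+ 3.
Hypothesis psi_gen1 : psi (alpha - beta) = lam + 1 - lam ^+ 2.
Hypothesis psi_gen2 : psi (alpha - beta ^+ 2) = 1 - lam ^+ 2.
Notation X := (Xi psi alpha beta).
Notation Y := (tent_tiles psi alpha F).

Lemma intr_zr (A : comNzRingType) (n : int) : (n%:~R : A) = zr A (Z_of_int n).
Proof. by rewrite /zr Z_of_intK. Qed.

(** The generators differ by [lam], so they span the same lattice as [lam] and [1 - lam ^ 2]. *)
Lemma XiP x : X x <-> exists u1 u2, x = ev lam (tile_pos u1 u2 true).
Proof.
split=> [[[u1 u2] _ <-]|[u1 [u2 ->]]].
  exists (Z_of_int u1), (Z_of_int u1 + Z_of_int u2)%Z.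
  by rewrite psi_gen1 psi_gen2 !intr_zr /= !zrE; ring.
exists (int_of_Z u1, int_of_Z (u2 - u1)%Z) => //=.
by rewrite psi_gen1 psi_gen2 !intr_zr !int_of_ZK /= !zrE; ring.
Qed.

Lemma tent_tilesE u1 u2 b : Y (ev lam (tile_pos u1 u2 true), b) = tile u1 u2 b.
Proof.
have e := ev_tile_posF rho3 q2 u1 u2.
rewrite /tent_tiles /tile; cbn [fst snd]; case: b.
  by apply/seteqP; split=> _ [z Fz <-]; exists z; rewrite ?mul1r.
rewrite e; set x := ev lam _.
apply/seteqP; split=> [_ [_ [z Fz <-] <-]|_ [z Fz <-]].
  by exists z => //; rewrite psi_alpha mulN1r; ring.
exists (lam ^+ 3 - z); first by exists z; rewrite ?psi_alpha.
by rewrite mulN1r; ring.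
Qed.

Lemma tile_compact u1 u2 b : compact (tile u1 u2 b).
Proof.
apply: continuous_compact F_compact; apply: continuous_subspaceT => z A /= /nbhs_discP [r r0 h].
apply/nbhs_discP; exists r => // w hw; apply: h.
rewrite (_ : _ - _ = sg b * (w - z)); last by ring.
by rewrite nrm_sg.
Qed.

Lemma tiling_finite (B : set R[i]) : compact B ->
  finite_set [set i | (X `*` [set: bool]) i /\ B `&` Y i !=set0].
Proof.
move=> cB; have [M HM] := compactC_bounded cB.
have [N HN] := tile_bounded rho3 q2 F_neq0 F_compact FE M.
pose D := [seq (u, b) | u <- [seq (u1, u2) | u1 <- zbox N, u2 <- zbox N], b <- [:: true; false]].
apply: (@sub_finite_set _ _ [set (ev lam (tile_pos i.1.1 i.1.2 true), i.2) | i in [set` D]]).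
  move=> [x b] /= [[/XiP [u1 [u2 ->]] _] [w [Bw]]]; rewrite tent_tilesE => hw.
  have [h1 h2] := HN u1 u2 b w hw (HM w Bw).
  exists ((u1, u2), b) => //=.
  apply: (allpairs_f pair); last exact: mem_bools.
  by apply: (allpairs_f pair); exact: mem_zbox.
by apply: finite_image; exact: finite_seq.
Qed.

Lemma tiling_ae : ae_complex (fun x => exists! i, (X `*` [set: bool]) i /\ Y i x).
Proof.
have [x1 m1] := moran_two rho3 q2.
rewrite /ae_complex /almost_everywhere.
apply: (@plane_negligibleS _ [set p | exists t : (Z * Z * bool) * (Z * Z * bool),
  plane (if t.1 == t.2 then set0 else tile t.1.1.1 t.1.1.2 t.1.2 `&` tile t.2.1.1 t.2.1.2 t.2.2) p]).
  move=> [a b] /= nu.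
  have [u1 [u2 [c hc]]] := tiles_cover rho3 q2 F_neq0 F_compact FE (a +i* b).
  apply: contrapT => hn; apply: nu; exists (ev lam (tile_pos u1 u2 true), c); split.
    by split; [split=> //=; apply/XiP; exists u1, u2 | rewrite tent_tilesE].
  move=> [x c'] [[/= /XiP [v1 [v2 ->]] _]]; rewrite tent_tilesE => hv.
  have [e|ne] := eqVneq (u1, u2, c) (v1, v2, c').
    by case: e => -> -> ->.
  by exfalso; apply: hn; exists ((u1, u2, c), (v1, v2, c')); rewrite /= (negbTE ne).
apply: plane_negligible_ex => -[[[u1 u2] c] [[v1 v2] c']].
apply: content0_negligible.
  case: ifP => _; first by exists 0.
  have [M HM] := tile_bound rho3 q2 F_neq0 F_compact FE u1 u2 c.
  by exists M => z [/HM].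
case: ifPn => [_|ne]; first exact: content_set0.
exact: (tile_inter_null rho3 q2 F_neq0 F_compact FE x1 m1).
Qed.

Lemma tent_proper_tiling : proper_tiling (X `*` [set: bool]) Y.
Proof.
split.
- by move=> [x b] [/= /XiP [u1 [u2 ->]] _]; rewrite tent_tilesE; exact: tile_compact.
- rewrite -subTset => w _; have [u1 [u2 [b h]]] := tiles_cover rho3 q2 F_neq0 F_compact FE w.
  exists (ev lam (tile_pos u1 u2 true), b); last by rewrite tent_tilesE.
  by split=> //; apply/XiP; exists u1, u2.
- exact: tiling_finite.
- exact: tiling_ae.
Qed.

End Tiling.

Theorem theorem5p5 (R : realType) (alpha beta : R) (alpha' : R[i])
    (psi : R -> R[i]) (F : set R[i])
    (alphaP : root (alpha_poly R) alpha)
    (betaE : beta = alpha / (alpha - 1))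
    (alpha'P : galois_conjugate alpha alpha')
    (alpha'_nonreal : complex.Im alpha' != 0)
    (psiP : field_embedding (Qadjoin alpha) psi)
    (psi_alpha : psi alpha = alpha')
    (FP : is_tent_tile psi alpha beta F) :
  [/\ approx5 alpha (2 + 324 / 10 ^+ 3 + 72 / 10 ^+ 5),
      exists mu : R,
        [/\ dominant_root (mu_poly R[i]) mu%:C,
            approx5 mu (1 + 612 / 10 ^+ 3 + 99 / 10 ^+ 5),
            hausdorff_dim (boundary F) = (2 * ln mu / ln beta)%:E
          & approx5 (2 * ln mu / ln beta) (1 + 700 / 10 ^+ 3 + 18 / 10 ^+ 5)]
    & proper_tiling (Xi psi alpha beta `*` [set: bool])
        (tent_tiles psi alpha F)].
Proof.
(* Substituting [t = rho + 1] turns [t ^ 3 - 3 t ^ 2 + 2 t - 1] into [rho ^ 3 - rho - 1]. *)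
pose rho := alpha - 1; have aE : alpha = rho + 1 by rewrite subrK.
have rho3 : rho ^+ 3 = rho + 1.
  move: alphaP; rewrite /alpha_poly => /rootP.
  rewrite !(hornerD, hornerN, hornerZ, hornerXn, hornerX, hornerC) aE => h.
  by apply/eqP; rewrite -subr_eq0 -h; apply/eqP; ring.
have r0 : rho != 0 by rewrite lt0r_neq0// rho_gt0.
have bE : beta = rho * rho by rewrite betaE -/rho aE -rho3 exprSr expr2 mulfK.
have K1 := @Qadjoin1 R alpha; have Ka := @Qadjoin_gen R alpha.
have Kr : Qadjoin alpha rho by exact: QadjoinB.
have Kb : Qadjoin alpha beta by rewrite bE; exact: QadjoinM.
have Kb2 : Qadjoin alpha (beta ^+ 2) by rewrite expr2; exact: QadjoinM.
pose l := psi rho.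
have lE : l = alpha' - 1 by rewrite /l (psiB psiP)// (psi1 psiP) psi_alpha.
have l3 : l ^+ 3 = l + 1.
  rewrite /l -{1}[LHS]/(l ^+ 3) -(psi1 psiP) -(psiD psiP)// -rho3 !exprS !expr0 !mulr1.
  by rewrite !(psiM psiP)//; exact: QadjoinM.
have lim : complex.Im l != 0 by rewrite lE; case: (alpha') alpha'_nonreal => a b; rewrite /= subr0.
have [lamE q2] := conjugateE rho3 l3 lim.
set q := complex.Im l in lamE q2.
have pa : psi alpha = conj_root rho q ^+ 3 by rewrite -lamE l3 lE psi_alpha subrK.
have pb : psi beta = conj_root rho q ^+ 2 by rewrite bE (psiM psiP)// -/l -lamE expr2.
have l3' := lam3 rho3 q2.
have pg1 : psi (alpha - beta) = conj_root rho q + 1 - conj_root rho q ^+ 2 by rewrite (psiB psiP)// pa pb l3'.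
have pg2 : psi (alpha - beta ^+ 2) = 1 - conj_root rho q ^+ 2.
  rewrite (psiB psiP)// expr2 (psiM psiP)// pa pb.
  rewrite (_ : _ * _ = conj_root rho q * conj_root rho q ^+ 3); last by ring.
  by rewrite l3'; ring.
have [F0 Fc FE] := FP.
have FE' : F = [set conj_root rho q ^+ 3 * z | z in F] `|` [set conj_root rho q ^+ 2 * (1 - z) | z in F].
  by rewrite {1}FE /tent_left /tent_right pa pb (psi1 psiP).
have [th [th1 th2]] := theta_exists R.
split; [by rewrite aE; exact: alpha_approx| |exact: (tent_proper_tiling rho3 q2 F0 Fc FE' pa pg1 pg2)].
exists (th ^+ 2); rewrite bE -expr2; split.
- exact: mu_dominant.
- exact: mu_approx.
- exact: (dim_boundary rho3 q2 F0 Fc FE' th1 th2).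
- exact: ratio_approx.
Qed.
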